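(* Let $c,d$ be positive integers, let $G=\langle a,b: ab^c=b^da\rangle$, and let $P$ be the submonoid of $G$ generated by $a$ and $b$. Then the quasi-lattice ordered group $(G,P)$ is amenable.
   Context: Order: for $g,h\in G$, $g\leq h$ means $g^{-1}h\in P$. It is known (Spielberg) that $(G,P)$ is quasi-lattice ordered: $P\cap P^{-1}=\{e\}$, and every pair $g,h\in G$ with a common upper bound in $P$ has a least upper bound $g\vee h$ in $P$. Write $g\vee h<\infty$ if a common upper bound in $P$ exists and $g\vee h=\infty$ otherwise. A Nica-covariant representation of $P$ is a map $x\mapsto S_x$ of $P$ into the isometries of a unital $C^*$-algebra with $S_e=1$, $S_xS_y=S_{xy}$, and $S_xS_x^*S_yS_y^*=S_{x\vee y}S_{x\vee y}^*$ if $x\vee y<\infty$ and $=0$ if $x\vee y=\infty$. $C^*(G,P)$ is the $C^*$-algebra generated by a universal Nica-covariant representation $i:P\to C^*(G,P)$; it is the closed linear span of $\{i(x)i(y)^*:x,y\in P\}$. It is known that there is a positive norm-decreasing linear map $\Phi:C^*(G,P)\to\overline{\operatorname{span}}\{i(x)i(x)^*:x\in P\}$ such that $\Phi(i(x)i(y)^* )=i(x)i(x)^*$ if $x=y$ and $=0$ if $x\neq y$. The pair $(G,P)$ is amenable (in the sense of Nica) if $\Phi$ is faithful, that is, $\Phi(R^*R)=0$ implies $R=0$ for $R\in C^*(G,P)$. *)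

(* Defs.v *)
From HB Require Import structures.
From mathcomp Require Import all_boot all_order all_algebra.
From mathcomp Require Import generic_quotient complex.
From mathcomp Require Import boolp classical_sets reals.

Set Implicit Arguments.
Unset Strict Implicit.
Unset Printing Implicit Defensive.

Import Order.TTheory GRing.Theory Num.Theory.

Local Open Scope classical_set_scope.
Local Open Scope ring_scope.

Section Presentation.
Variable T : choiceType.

(* [(x, false)] stands for the generator [x], [(x, true)] for its formal
   inverse. *)
Definition word := seq (T * bool).

Definition word_inv (w : word) : word := rev [seq (x.1, ~~ x.2) | x <- w].

Variable rel : word -> word -> Prop.

Inductive word_eq : word -> word -> Prop :=
  | word_eq_rel u v : rel u v -> word_eq u v
  | word_eq_cancel x b : word_eq [:: (x, b); (x, ~~ b)] [::]
  | word_eq_refl u : word_eq u u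
  | word_eq_sym u v : word_eq u v -> word_eq v u
  | word_eq_trans v u w : word_eq u v -> word_eq v w -> word_eq u w
  | word_eq_cat u u' v v' :
      word_eq u u' -> word_eq v v' -> word_eq (u ++ v) (u' ++ v').

Definition word_eqb (u v : word) : bool := `[< word_eq u v >].

Fact word_eqb_equiv : equiv_class_of word_eqb.
Proof.
split=> [u|u v|v u w].
- exact/asboolP/word_eq_refl.
- by apply/asboolP/asboolP => /word_eq_sym.
- move=> /asboolP uv /asboolP vw.
  by apply/asboolP/(word_eq_trans uv vw).
Qed.

Canonical word_eqb_equiv_rel := EquivRelPack word_eqb_equiv.

Definition presented : Type := {eq_quot word_eqb_equiv_rel}%qT.

HB.instance Definition _ := Choice.on presented.
HB.instance Definition _ : EqQuotient _ word_eqb_equiv_rel presented :=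
  EqQuotient.on presented.

Definition word_class (w : word) : presented := \pi_presented%qT w.

Definition presented_gen (x : T) : presented := word_class [:: (x, false)].

Definition presented_one : presented := word_class [::].
Definition presented_mul (g h : presented) : presented :=
  word_class (repr g ++ repr h).
Definition presented_inv (g : presented) : presented :=
  word_class (word_inv (repr g)).

Lemma word_classP u v : word_class u = word_class v <-> word_eq u v.
Proof.
split=> [/eqquotP/asboolP //|uv].
exact/eqquotP/asboolP.
Qed.

Lemma word_class_repr g : word_class (repr g) = g.
Proof. exact: reprK. Qed.

Lemma repr_word_class u : word_eq (repr (word_class u)) u.
Proof. by apply/word_classP; rewrite word_class_repr. Qed.

Lemma word_class_cat u v :
  word_class (u ++ v) = presented_mul (word_class u) (word_class v).
Proof.
apply/word_classP/word_eq_sym.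
by apply: word_eq_cat; apply: repr_word_class.
Qed.

Lemma word_inv_catr w : word_eq (w ++ word_inv w) [::].
Proof.
elim: w => [|[x b] w IH]; first exact: word_eq_refl.
rewrite /word_inv /= rev_cons -cats1 -/(word_inv w).
apply: (word_eq_trans (v := [:: (x, b)] ++ ([::] ++ [:: (x, ~~ b)]))).
  rewrite catA -cat1s.
  apply: word_eq_cat; first exact: word_eq_refl.
  by apply: word_eq_cat; [exact: IH | exact: word_eq_refl].
exact: word_eq_cancel.
Qed.

Lemma word_inv_catl w : word_eq (word_inv w ++ w) [::].
Proof.
have invK : word_inv (word_inv w) = w.
  rewrite /word_inv map_rev revK -map_comp -[RHS]map_id.
  by apply: eq_map => -[x b] /=; rewrite negbK.
by have := word_inv_catr (word_inv w); rewrite invK.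
Qed.

Fact presented_mulA : associative presented_mul.
Proof.
move=> g h k.
rewrite -(word_class_repr g) -(word_class_repr h) -(word_class_repr k).
by rewrite -!word_class_cat catA.
Qed.

Fact presented_mul1 : left_id presented_one presented_mul.
Proof.
by move=> g; rewrite -(word_class_repr g) -word_class_cat.
Qed.

Fact presented_mulr1 : right_id presented_one presented_mul.
Proof.
by move=> g; rewrite -(word_class_repr g) -word_class_cat cats0.
Qed.

Fact presented_mulV : left_inverse presented_one presented_inv presented_mul.
Proof.
move=> g; rewrite -{2}(word_class_repr g) -word_class_cat.
exact/word_classP/word_inv_catl.
Qed.

Fact presented_mulrV : right_inverse presented_one presented_inv presented_mul.
Proof.
move=> g; rewrite -{1}(word_class_repr g) -word_class_cat.
exact/word_classP/word_inv_catr.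
Qed.

HB.instance Definition _ := isGroup.Build presented
  presented_mulA presented_mul1 presented_mulr1 presented_mulV presented_mulrV.

End Presentation.

Section BaumslagSolitar.
Variables c d : nat.

(* The generator [a] is [true] and the generator [b] is [false]. *)
Definition BS_rel (u v : word bool) : Prop :=
  u = (true, false) :: nseq c (false, false) /\
  v = rcons (nseq d (false, false)) (true, false).

Definition BS : groupType := presented BS_rel.

Definition BS_a : BS := presented_gen BS_rel true.
Definition BS_b : BS := presented_gen BS_rel false.

Definition submonoid (G : groupType) (M : set G) : Prop :=
  M 1%g /\ forall x y, M x -> M y -> M (x * y)%g.

Definition BS_pos : set BS := smallest (@submonoid BS) [set BS_a; BS_b].

Lemma BS_relation : (BS_a * BS_b ^+ c = BS_b ^+ d * BS_a)%g.
Proof.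
have powb n : (BS_b ^+ n)%g = word_class BS_rel (nseq n (false, false)).
  elim: n => [|n IH]; first by rewrite expg0.
  by rewrite expgS IH -[nseq n.+1 _]cat1s word_class_cat.
rewrite !powb.
apply: etrans (esym (word_class_cat _ _ _)) _.
apply: etrans _ (word_class_cat _ _ _).
by apply/word_classP/word_eq_rel; split => //; rewrite cats1.
Qed.

End BaumslagSolitar.

Arguments BS_pos : clear implicits.

Section Order.
Variables (G : groupType) (P : set G).

Definition ple (g h : G) : Prop := P (g^-1 * h)%g.

Definition common_ub (g h z : G) : Prop := [/\ P z, ple g z & ple h z].

Definition is_join (g h z : G) : Prop :=
  common_ub g h z /\ forall w, common_ub g h w -> ple z w.

End Order.

(* As every [algType], a [cstarAlgType] satisfies [1 != 0]; excluding the zero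
   algebra does not affect universal properties among unital C*-algebras, as
   everything maps uniquely to it. The norm is a
   separate operation with values in [R], because MathComp's hierarchy has no
   structure joining [NzRing] and [NormedModule] below the number domains. *)
HB.mixin Record Algebra_isCstarAlg (R : realType) (A : Type)
    of GRing.Algebra R[i] A := {
  cnorm : A -> R;
  cnormD : forall x y : A, cnorm (x + y) <= cnorm x + cnorm y;
  cnormZ : forall (k : R[i]) (x : A),
    cnorm (k *: x) = complex.Re `|k| * cnorm x;
  cnorm_eq0 : forall x : A, cnorm x = 0 -> x = 0;
  cnormM : forall x y : A, cnorm (x * y) <= cnorm x * cnorm y;
  cnorm_complete : forall u : nat -> A,
    (forall e : R, 0 < e -> exists N, forall m n, (N <= m)%N -> (N <= n)%N ->
       cnorm (u m - u n) < e) ->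
    exists l, forall e : R, 0 < e -> exists N, forall n, (N <= n)%N ->
      cnorm (u n - l) < e;
  star : A -> A;
  starD : forall x y : A, star (x + y) = star x + star y;
  starZ : forall (k : R[i]) (x : A), star (k *: x) = Num.conj k *: star x;
  starM : forall x y : A, star (x * y) = star y * star x;
  starK : forall x : A, star (star x) = x;
  cnorm_starM : forall x : A, cnorm (star x * x) = cnorm x ^+ 2
}.

#[short(type="cstarAlgType")]
HB.structure Definition CstarAlg (R : realType) :=
  {A of GRing.Algebra R[i] A & Algebra_isCstarAlg R A}.

Section CstarTheory.
Variables (R : realType) (A : cstarAlgType R).

Definition isometry_elt (s : A) : Prop := star s * s = 1.

Definition positive_elt (x : A) : Prop := exists y : A, x = star y * y.

Definition cnorm_closed (W : set A) : Prop :=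
  forall x, (forall e : R, 0 < e -> exists2 y, W y & cnorm (x - y) < e) -> W x.

Definition closed_subspace (W : set A) : Prop :=
  [/\ cnorm_closed W, W 0 & forall (k : R[i]) u v, W u -> W v -> W (k *: u + v)].

Definition closed_span (X : set A) : set A := smallest closed_subspace X.

Definition cstar_subalg (W : set A) : Prop :=
  [/\ closed_subspace W, forall u v, W u -> W v -> W (u * v)
    & forall u, W u -> W (star u)].

Definition cstar_generated (X : set A) : set A := smallest cstar_subalg X.

End CstarTheory.

Section Nica.
Variables (R : realType) (G : groupType) (P : set G).

(* A representation of [P] is encoded as a function on [G] whose values
   outside [P] are irrelevant. *)
Definition nica_covariant (A : cstarAlgType R) (S : G -> A) : Prop :=
  [/\ forall x, P x -> isometry_elt (S x),
      S 1%g = 1,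
      forall x y, P x -> P y -> S x * S y = S (x * y)%g,
      forall x y z, P x -> P y -> is_join P x y z ->
        S x * star (S x) * (S y * star (S y)) = S z * star (S z)
    & forall x y, P x -> P y -> ~ (exists z, common_ub P x y z) ->
        S x * star (S x) * (S y * star (S y)) = 0].

(* [(A, i)] is a model of C*(G, P) with its universal representation; such a
   model is unique up to isomorphism. Uniqueness of [pi] follows from the
   fact that [i] generates [A]. *)
Definition is_cstar_of (A : cstarAlgType R) (i : G -> A) : Prop :=
  [/\ nica_covariant i,
      cstar_generated (i @` P) = [set: A]
    & forall (B : cstarAlgType R) (S : G -> B), nica_covariant S ->
        exists pi : {lrmorphism A -> B},
          (forall u, pi (star u) = star (pi u)) /\
          (forall x, P x -> pi (i x) = S x)].

Definition is_expectation (A : cstarAlgType R) (i : G -> A)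
    (Phi : {linear A -> A}) : Prop :=
  [/\ forall u, closed_span [set i x * star (i x) | x in P] (Phi u),
      forall u, positive_elt u -> positive_elt (Phi u),
      forall u, cnorm (Phi u) <= cnorm u,
      forall x, P x -> Phi (i x * star (i x)) = i x * star (i x)
    & forall x y, P x -> P y -> x <> y -> Phi (i x * star (i y)) = 0].

(* The map [Phi] is determined by [is_expectation], since the elements
   [i x * star (i y)] span a dense subspace. *)
Definition nica_amenable : Prop :=
  forall (A : cstarAlgType R) (i : G -> A), is_cstar_of i ->
  forall Phi : {linear A -> A}, is_expectation i Phi ->
  forall r : A, Phi (star r * r) = 0 -> r = 0.

End Nica.

(* Main.v *)
(** A Nica-covariant representation grades A by G: the elements of degree g are
    the multiples of i(x) i(y)' with g = x y^-1, and Phi is the projection onto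
    degree 1. To a finitely supported family of elements kap_x of A, x in P, one
    associates the multiplier

      r |-> sum_(x, y) (kap_x i(x)')' Phi (i(x)' r i(y)) kap_y i(y)',

    where ' is the adjoint. It is positive by completing squares over the
    multiplicative domain of Phi, hence bounded by 2 as soon as it is at most 1
    at 1, and it vanishes at r if Phi (r' r) = 0. On an element r of degree g it is sum_y w_(g y) r w_y, where
    w_y = i(y) kap_y i(y)'. So Phi is faithful if there are families with
    sum_y w_y^2 close to 1 that are almost invariant under the generators, in
    the sense that sum_y |r w_y - w_(g y) r|^2 is small for r = i(a), i(b).

    For the Baumslag-Solitar monoid such families live on the normal forms
    b^s1 a ... b^sk a b^j with 0 <= s_m < d, k < n and j < M. Multiplying by b
    adds 1 to the word s with a carry, which changes j by at most c^k. So a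
    geometric weight q^j is almost invariant once q is close to 1 depending on
    n, while a geometric weight lam^k is almost invariant under a. *)

From Stdlib Require Import Ncring Ncring_tac.
Require Import Defs.
From mathcomp Require Import all_boot all_order all_algebra.
From mathcomp Require Import complex boolp classical_sets reals.
From mathcomp Require Import ring lra zify.

Set Implicit Arguments.
Unset Strict Implicit.
Unset Printing Implicit Defensive.

Import Order.TTheory GRing.Theory Num.Theory.

Local Open Scope ring_scope.
Local Open Scope complex_scope.

Notation "t ** x" := (t%:C *: x) (at level 40, left associativity) : ring_scope.

(** For c, d > 1 the group contains a free group, so almost invariance is only asked against the
    operators i(a), i(b), where orthogonality helps: i(a)' i(b^s a) = 0 for 0 < s < d kills the
    defect of every point that a translation by [a] would enter through a nonzero leading digit. The
    weights kap_y are operators because the ranges of the i(y) overlap, and scalar weights would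
    count them repeatedly. Damping on the range of i(b), and on the joint range of the i(b^s a),
    makes the sum of the w_y^2 telescope to almost 1. It also bounds the second source of defect: if
    y lies outside the finite family and g y inside, then w_(g y) i(g) is compensated by nothing,
    but the damping leaves there only a factor sqrt(1 - q^2) or sqrt(1 - lam^2). Positivity of the
    multiplier is not immediate, since the coefficients kap_y i(y)' lie outside the multiplicative
    domain D of Phi. The matrix of the Phi(i(x)' r i(y)) has entries in D and is positive on vectors
    over D; Schur complements formed inside D extend this to all vectors. The order on A is built
    from a norm condition and an iterative square root. *)

#[local] Instance ncring_ops (A : pzRingType) :
  @Ring_ops A 0 1 +%R *%R (fun x y => x - y) -%R eq := {}.

#[local] Instance ncring_ring (A : pzRingType) : Ring (Ro := ncring_ops A).
Proof.
split=> //=; try (by move=> ? ? -> ? ? ->); try by move=> ? ? ->.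
- exact: eq_equivalence.
- exact: add0r.
- exact: addrC.
- exact: addrA.
- exact: mul1r.
- exact: mulr1.
- exact: mulrA.
- exact: mulrDl.
- by move=> x y z; exact: mulrDr.
- exact: subrr.
Qed.

Ltac ncring := non_commutative_ring.

(** * Norm and convergence in C*-algebras *)

Section CstarBasics.
Variables (R : realType) (A : cstarAlgType R).
Implicit Types (x y z h k : A) (s t e : R).

Lemma rscaleA s t x : s ** (t ** x) = (s * t) ** x.
Proof. by rewrite scalerA -rmorphM. Qed.

Lemma rscaleDl s t x : (s + t) ** x = s ** x + t ** x.
Proof. by rewrite rmorphD scalerDl. Qed.

Lemma rscaleBl s t x : (s - t) ** x = s ** x - t ** x.
Proof. by rewrite rmorphB scalerBl. Qed.

Lemma rscaleNl t x : (- t) ** x = - (t ** x).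
Proof. by rewrite rmorphN scaleNr. Qed.

Lemma rscale0 x : 0 ** x = 0.
Proof. by rewrite rmorph0 scale0r. Qed.

Lemma rscale1 x : 1 ** x = x.
Proof. by rewrite rmorph1 scale1r. Qed.

Lemma rscale2 x : 2 ** x = x + x.
Proof. by rewrite (_ : 2 = 1 + 1)// rscaleDl rscale1. Qed.

Lemma cnorm_rscale t x : cnorm (t ** x) = `|t| * cnorm x.
Proof.
rewrite cnormZ normc_def /= expr0n addr0 sqrtr_sqr //.
Qed.

Lemma cnorm_iscale x : cnorm ('i *: x) = cnorm x.
Proof. by rewrite cnormZ normc_def /= expr0n expr1n add0r sqrtr1 mul1r. Qed.

Lemma cnorm0 : cnorm (0 : A) = 0.
Proof. by rewrite -(rscale0 0) cnorm_rscale normr0 mul0r. Qed.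

Lemma cnormN x : cnorm (- x) = cnorm x.
Proof. by rewrite -{1}(rscale1 x) -rscaleNl cnorm_rscale normrN normr1 mul1r. Qed.

Lemma cnorm_ge0 x : 0 <= cnorm x.
Proof. by have := cnormD x (- x); rewrite subrr cnorm0 cnormN; lra. Qed.

Lemma cnormB x y : cnorm (x - y) <= cnorm x + cnorm y.
Proof. by rewrite -(cnormN y) cnormD. Qed.

Lemma cnorm_subC x y : cnorm (x - y) = cnorm (y - x).
Proof. by rewrite -cnormN opprB. Qed.

Lemma cnorm_eq0P x : (cnorm x == 0) = (x == 0).
Proof. by apply/eqP/eqP => [/cnorm_eq0//|->]; rewrite cnorm0. Qed.

Lemma cnorm_small x : (forall e, 0 < e -> cnorm x <= e) -> x = 0.
Proof.
move=> h; apply/cnorm_eq0/eqP; rewrite eq_le cnorm_ge0 andbT.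
by apply/ler_addgt0Pl => e e0; rewrite addr0 h.
Qed.

Lemma star0 : star (0 : A) = 0.
Proof. by apply: (addIr (star 0)); rewrite -starD !add0r. Qed.

Lemma starN x : star (- x) = - star x.
Proof. by apply/eqP; rewrite -addr_eq0 -starD addNr star0. Qed.

Lemma starB x y : star (x - y) = star x - star y.
Proof. by rewrite starD starN. Qed.

Lemma star1 : star (1 : A) = 1.
Proof.
by rewrite -[LHS]mul1r -{1}(starK 1) -starM mul1r starK.
Qed.

Lemma star_rscale t x : star (t ** x) = t ** star x.
Proof. by rewrite starZ [Num.conj _]conjc_real. Qed.

Lemma star_iscale x : star ('i *: x) = - ('i *: star x).
Proof.
rewrite starZ -scaleNr; congr (_ *: _).
by apply/eqP; rewrite eq_complex /= oppr0 !eqxx.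
Qed.

Lemma star_sum (I : Type) (r : seq I) (P : pred I) (F : I -> A) :
  star (\sum_(i <- r | P i) F i) = \sum_(i <- r | P i) star (F i).
Proof. exact: (big_morph _ starD star0). Qed.

Lemma cnorm1 : cnorm (1 : A) = 1.
Proof.
have := cnorm_starM (1 : A); rewrite star1 mulr1 => h.
have : cnorm (1 : A) != 0 by rewrite cnorm_eq0P oner_neq0.
by move=> n0; apply: (mulfI n0); rewrite mulr1 [RHS]h expr2.
Qed.

Lemma cnorm_star x : cnorm (star x) = cnorm x.
Proof.
suff le y : cnorm y <= cnorm (star y).
  by apply/eqP; rewrite eq_le le -{2}(starK x) le.
have [->|y0] := eqVneq y 0; first by rewrite star0.
have ny : 0 < cnorm y by rewrite lt_def cnorm_ge0 cnorm_eq0P y0.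
rewrite -(ler_pM2r ny) -expr2 -cnorm_starM; exact: cnormM.
Qed.

Lemma cnorm_scalar t : cnorm (t ** 1 : A) = `|t|.
Proof. by rewrite cnorm_rscale cnorm1 mulr1. Qed.

Lemma cnorm_sum (I : Type) (r : seq I) (P : pred I) (F : I -> A) :
  cnorm (\sum_(i <- r | P i) F i) <= \sum_(i <- r | P i) cnorm (F i).
Proof.
elim/big_rec2: _ => [|i y x _ h]; first by rewrite cnorm0.
by apply: le_trans (cnormD _ _) _; rewrite lerD2l.
Qed.

Definition ccvg (u : nat -> A) (l : A) :=
  forall e, 0 < e -> exists N, forall n, (N <= n)%N -> cnorm (u n - l) < e.

Lemma ccvg_uniq u l l' : ccvg u l -> ccvg u l' -> l = l'.
Proof.
move=> ul ul'; apply/eqP; rewrite -subr_eq0; apply/eqP/cnorm_small => e e0.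
have e2 : 0 < e / 2 by rewrite divr_gt0.
have [[N hN] [N' hN']] := (ul _ e2, ul' _ e2).
have h1 := hN _ (leq_maxl N N'); have h2 := hN' _ (leq_maxr N N').
have -> : l - l' = (u (maxn N N') - l') - (u (maxn N N') - l).
  by ncring.
by apply: le_trans (cnormB _ _) _; lra.
Qed.

Lemma ccvg_map (f : A -> A) (C : R) u l :
  (forall n, cnorm (f (u n) - f l) <= C * cnorm (u n - l)) ->
  ccvg u l -> ccvg (f \o u) (f l).
Proof.
move=> fC ul e e0.
have C0 : 0 < `|C| + 1 by rewrite ltr_pwDr.
have [N hN] := ul (e / (`|C| + 1)) (divr_gt0 e0 C0).
exists N => n /hN h /=; apply: le_lt_trans (fC n) _.
rewrite ltr_pdivlMr// in h; rewrite mulrC; apply: le_lt_trans h.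
by rewrite ler_wpM2l ?cnorm_ge0// (le_trans (ler_norm C))// lerDl.
Qed.

Lemma ccvg_eq u v l : u =1 v -> ccvg u l -> ccvg v l.
Proof. by move=> /funext <-. Qed.

Lemma ccvg_shift u l : ccvg u l -> ccvg (fun n => u n.+1) l.
Proof. by move=> ul e /ul[N hN]; exists N => n Nn; apply/hN/leqW. Qed.

Lemma ccvg_cst l : ccvg (fun _ => l) l.
Proof. by move=> e e0; exists 0%N => n _; rewrite subrr cnorm0. Qed.

Lemma ccvgD u v l m : ccvg u l -> ccvg v m -> ccvg (fun n => u n + v n) (l + m).
Proof.
move=> ul vm e e0; have e2 : 0 < e / 2 by rewrite divr_gt0.
have [[N hN] [N' hN']] := (ul _ e2, vm _ e2).
exists (maxn N N') => n; rewrite geq_max => /andP[/hN h /hN' h'].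
rewrite opprD addrACA; apply: le_lt_trans (cnormD _ _) _; lra.
Qed.

Lemma ccvgMl z u l : ccvg u l -> ccvg (fun n => z * u n) (z * l).
Proof.
by apply: (@ccvg_map _ (cnorm z)) => n; rewrite -mulrBr cnormM.
Qed.

Lemma ccvgMr z u l : ccvg u l -> ccvg (fun n => u n * z) (l * z).
Proof.
by apply: (@ccvg_map (fun x => x * z) (cnorm z)) => n; rewrite -mulrBl mulrC cnormM.
Qed.

Lemma ccvgM (B : R) u v l m : (forall n, cnorm (u n) <= B) ->
  ccvg u l -> ccvg v m -> ccvg (fun n => u n * v n) (l * m).
Proof.
move=> uB ul vm e e0.
have B0 : 0 < `|B| + cnorm m + 1.
  by rewrite ltr_wpDl ?addr_ge0 ?cnorm_ge0.
have d0 : 0 < e / (`|B| + cnorm m + 1) / 2 by rewrite !divr_gt0.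
have [[N hN] [N' hN']] := (ul _ d0, vm _ d0).
exists (maxn N N') => n; rewrite geq_max => /andP[/hN h /hN' h'].
have -> : u n * v n - l * m = u n * (v n - m) + (u n - l) * m.
  by ncring.
apply: le_lt_trans (cnormD _ _) _.
set d := e / _ in d0 h h' *.
have dE : d * (`|B| + cnorm m + 1) = e by rewrite /d divfK ?gt_eqF.
have h1 : cnorm (u n * (v n - m)) <= (`|B| + 1) * (d / 2).
  apply: le_trans (cnormM _ _) _; apply: ler_pM; rewrite ?cnorm_ge0 ?(ltW h')//.
  by rewrite (le_trans (uB n))// (le_trans (ler_norm B))// lerDl.
have h2 : cnorm ((u n - l) * m) <= d / 2 * cnorm m.
  apply: le_trans (cnormM _ _) _; rewrite ler_wpM2r ?cnorm_ge0//; exact: ltW.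
have := cnorm_ge0 m; have := normr_ge0 B; nra.
Qed.

Lemma ccvg_star u l : ccvg u l -> ccvg (fun n => star (u n)) (star l).
Proof.
by apply: (@ccvg_map _ 1) => n; rewrite mul1r -starB cnorm_star.
Qed.

Lemma ccvg_scale (k : R[i]) u l : ccvg u l -> ccvg (fun n => k *: u n) (k *: l).
Proof.
apply: (@ccvg_map _ (complex.Re `|k|)) => n.
by rewrite -scalerBr cnormZ.
Qed.

Lemma ccvg_norm_le u l (C : R) : (forall n, cnorm (u n) <= C) ->
  ccvg u l -> cnorm l <= C.
Proof.
move=> uC ul; apply/ler_addgt0Pl => e /ul[N /(_ N (leqnn N)) h].
have -> : l = u N - (u N - l) by ncring.
by apply: le_trans (cnormB _ _) _; have := uC N; lra.
Qed.

(** The sequence [s] is increasing and bounded, hence Cauchy by its supremum, and its increments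
    dominate those of [u]. No rate of convergence is required. *)
Lemma ccvg_majorant (u : nat -> A) (s : nat -> R) (C : R) :
  (forall n, cnorm (u n.+1 - u n) <= s n.+1 - s n) ->
  (forall n, s n <= C) -> exists l, ccvg u l.
Proof.
move=> us sC; apply: cnorm_complete => e e0.
have mono m n : (m <= n)%N -> s m <= s n /\ cnorm (u n - u m) <= s n - s m.
  move=> /subnK <-; elim: (n - m)%N => [|k [IH1 IH2]].
    by rewrite add0n !subrr cnorm0.
  rewrite addSn; have := us (k + m)%N; have := cnorm_ge0 (u (k + m).+1 - u (k + m)%N).
  move=> p q; split; first lra.
  have -> : u (k + m).+1 - u m = (u (k + m).+1 - u (k + m)%N) + (u (k + m)%N - u m).
    by ncring.
  by apply: le_trans (cnormD _ _) _; lra.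
pose E := [set s n | n in [set: nat]]%classic.
have supE : has_sup E.
  by split; [exists (s 0%N), 0%N|exists C => _ [n _ <-]; exact: sC].
have [_ [N _ <-] hN] := sup_adherent e0 supE.
have ub n : s n <= sup E by apply: ub_le_sup; [case: supE|exists n].
exists N => m n Nm Nn.
wlog mn : m n Nm Nn / (n <= m)%N.
  move=> W; case/orP: (leq_total n m) => [|mn]; first exact: W.
  by rewrite cnorm_subC; apply: W.
have [_ h] := mono _ _ mn; have [h2 _] := mono _ _ Nn; have := ub m; lra.
Qed.

End CstarBasics.

(** * Positive elements *)

Section Positivity.
Variables (R : realType) (A : cstarAlgType R).
Implicit Types (x y z h k l : A) (s t e : R).

(** A fixed point l of y -> (h + y^2) / 2 satisfies (1 - l)^2 = 1 - h, so square roots arise without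
    functional calculus. *)
Fixpoint sqrt_iter h n : A :=
  if n is m.+1 then 2^-1 ** (h + sqrt_iter h m * sqrt_iter h m) else 0.

(** The same iteration for the scalar h = 1. It dominates [sqrt_iter h] and its increments as soon
    as [h] has norm at most 1. *)
Fixpoint sqrt_bound n : R :=
  if n is m.+1 then (1 + sqrt_bound m ^+ 2) / 2 else 0.

Lemma sqrt_bound_itv n : 0 <= sqrt_bound n <= 1.
Proof.
elim: n => [|n /andP[h0 h1]] /=; first by rewrite lexx ler01.
by apply/andP; split; nra.
Qed.

(** Two different elements are allowed, rather than only [h = h'], because the positivity of
    [star x * x] needs y sqrt(p^2) = sqrt(q^2) y for distinct p and q. *)
Lemma sqrt_iter_intertwine z h h' n :
  z * h = h' * z -> z * sqrt_iter h n = sqrt_iter h' n * z.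
Proof.
move=> zh; elim: n => [|n IH] /=; first by rewrite mulr0 mul0r.
rewrite -scalerAr -scalerAl mulrDr mulrDl zh; congr (_ *: (_ + _)).
by rewrite mulrA IH -mulrA IH mulrA.
Qed.

Lemma sqrt_iterC h m n : sqrt_iter h m * sqrt_iter h n = sqrt_iter h n * sqrt_iter h m.
Proof. exact/sqrt_iter_intertwine/esym/sqrt_iter_intertwine. Qed.

Lemma star_sqrt_iter h n : star h = h -> star (sqrt_iter h n) = sqrt_iter h n.
Proof.
by move=> hs; elim: n => [|n IH] /=; rewrite ?star0// star_rscale starD starM hs IH.
Qed.

Lemma cnorm_sqrt_iter h n : cnorm h <= 1 -> cnorm (sqrt_iter h n) <= sqrt_bound n.
Proof.
move=> h1; elim: n => [|n IH] /=; first by rewrite cnorm0.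
rewrite cnorm_rscale gtr0_norm ?invr_gt0// mulrC ler_pM2r ?invr_gt0//.
apply: le_trans (cnormD _ _) _; apply: lerD => //.
apply: le_trans (cnormM _ _) _; rewrite expr2.
by apply: ler_pM; rewrite ?cnorm_ge0.
Qed.

Lemma cnorm_sqrt_iterB h n : cnorm h <= 1 ->
  cnorm (sqrt_iter h n.+1 - sqrt_iter h n) <= sqrt_bound n.+1 - sqrt_bound n.
Proof.
move=> h1; elim: n => [|n IH].
  by rewrite subr0 subr0; exact: cnorm_sqrt_iter.
set y := sqrt_iter h n in IH *; set y' := sqrt_iter h n.+1 in IH *.
(* Iterates of the same [h] commute, so the difference of their squares factors. *)
have -> : sqrt_iter h n.+2 - y' = 2^-1 ** ((y' - y) * (y' + y)).
  rewrite [in LHS]/y' /= -/y -/y' -scalerBr.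
  congr (_ *: _); have := sqrt_iterC h n n.+1; rewrite -/y -/y' => c.
  by rewrite mulrBl !mulrDr c; ncring.
rewrite cnorm_rscale gtr0_norm ?invr_gt0//.
have n1 : cnorm (y' + y) <= sqrt_bound n.+1 + sqrt_bound n.
  by apply: le_trans (cnormD _ _) _; apply: lerD; exact: cnorm_sqrt_iter.
have h2 := le_trans (cnormM _ _) (ler_pM (cnorm_ge0 _) (cnorm_ge0 _) IH n1).
have -> : sqrt_bound n.+2 - sqrt_bound n.+1 =
    (sqrt_bound n.+1 - sqrt_bound n) * (sqrt_bound n.+1 + sqrt_bound n) / 2.
  have e2 : sqrt_bound n.+2 = (1 + sqrt_bound n.+1 ^+ 2) / 2 by [].
  have e1 : sqrt_bound n.+1 = (1 + sqrt_bound n ^+ 2) / 2 by [].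
  rewrite e2; move: (sqrt_bound n.+1) (sqrt_bound n) e1 => w u e1; lra.
by rewrite mulrC ler_pM2r ?invr_gt0.
Qed.

Lemma sqrt_iter_cvg h : cnorm h <= 1 -> exists l, ccvg (sqrt_iter h) l.
Proof.
move=> h1; apply: (@ccvg_majorant _ _ _ sqrt_bound 1) => n.
  exact: cnorm_sqrt_iterB.
by case/andP: (sqrt_bound_itv n).
Qed.

Definition sqrt_lim h : A := xget 0 [set l | ccvg (sqrt_iter h) l]%classic.

Lemma sqrt_limP h : cnorm h <= 1 -> ccvg (sqrt_iter h) (sqrt_lim h).
Proof. by move=> /sqrt_iter_cvg[l hl]; rewrite /sqrt_lim; case: xgetP => [? _ //|/(_ l)]. Qed.

Lemma sqrt_lim_intertwine z h h' : cnorm h <= 1 -> cnorm h' <= 1 ->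
  z * h = h' * z -> z * sqrt_lim h = sqrt_lim h' * z.
Proof.
move=> /sqrt_limP h1 /sqrt_limP h1' zh.
apply: ccvg_uniq (ccvgMl z h1) _; apply: ccvg_eq (ccvgMr z h1') => n.
by rewrite (sqrt_iter_intertwine n zh).
Qed.

Lemma star_sqrt_lim h : cnorm h <= 1 -> star h = h -> star (sqrt_lim h) = sqrt_lim h.
Proof.
move=> /sqrt_limP h1 hs; apply: ccvg_uniq (ccvg_star h1) _.
by apply: ccvg_eq h1 => n; rewrite star_sqrt_iter.
Qed.

Lemma cnorm_sqrt_lim h : cnorm h <= 1 -> cnorm (sqrt_lim h) <= 1.
Proof.
move=> h1; apply: ccvg_norm_le (sqrt_limP h1) => n.
by apply: le_trans (cnorm_sqrt_iter n h1) _; case/andP: (sqrt_bound_itv n).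
Qed.

Lemma sqrt_lim_eq h : cnorm h <= 1 ->
  (1 - sqrt_lim h) * (1 - sqrt_lim h) = 1 - h.
Proof.
move=> h1; have hl := sqrt_limP h1; set l := sqrt_lim h in hl *.
have b n : cnorm (sqrt_iter h n) <= 1.
  by apply: le_trans (cnorm_sqrt_iter n h1) _; case/andP: (sqrt_bound_itv n).
have E : l = 2^-1 ** (h + l * l).
  apply: ccvg_uniq (ccvg_shift hl) _; apply: ccvg_scale.
  exact: (ccvgD (ccvg_cst h) (ccvgM b hl hl)).
have E2 : l + l = h + l * l by rewrite -rscale2 {1}E rscaleA divff ?pnatr_eq0// rscale1.
have -> : h = l + l - l * l by rewrite E2 addrK.
by ncring.
Qed.

Definition pos h := star h = h /\ exists2 t, 0 <= t & cnorm (t ** 1 - h) <= t.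

Lemma pos_star h : pos h -> star h = h. Proof. by case. Qed.

Lemma cnorm_le_trans t t' h : t <= t' -> cnorm (t ** 1 - h) <= t -> cnorm (t' ** 1 - h) <= t'.
Proof.
move=> tt' ht; have -> : t' ** 1 - h = (t' - t) ** 1 + (t ** 1 - h).
  by rewrite rscaleBl; ncring.
apply: le_trans (cnormD _ _) _; rewrite cnorm_scalar ger0_norm ?subr_ge0//; lra.
Qed.

Lemma pos_gt h s : pos h -> exists t, [/\ s <= t, 0 < t & cnorm (t ** 1 - h) <= t].
Proof.
case=> _ [t t0 ht]; exists (t + `|s| + 1); split.
- by have := ler_norm s; lra.
- by rewrite ltr_wpDl// addr_ge0.
- by apply: cnorm_le_trans ht; have := normr_ge0 s; lra.
Qed.

Lemma posD h k : pos h -> pos k -> pos (h + k).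
Proof.
move=> [hs [t t0 ht]] [ks [s s0 hk]]; split; first by rewrite starD hs ks.
exists (t + s); first exact: addr_ge0.
rewrite rscaleDl opprD addrACA; apply: le_trans (cnormD _ _) _; exact: lerD.
Qed.

Lemma posZ t h : 0 <= t -> pos h -> pos (t ** h).
Proof.
move=> t0 [hs [s s0 ht]]; split; first by rewrite star_rscale hs.
exists (t * s); first exact: mulr_ge0.
by rewrite -rscaleA -scalerBr cnorm_rscale ger0_norm// ler_wpM2l.
Qed.

Lemma pos0 : pos (0 : A).
Proof. by split; [exact: star0|exists 0 => //; rewrite rscale0 subr0 cnorm0]. Qed.

Lemma pos1 : pos (1 : A).
Proof. by split; [exact: star1|exists 1 => //; rewrite rscale1 subrr cnorm0]. Qed.

Lemma pos_scalar t : 0 <= t -> pos (t ** (1 : A)).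
Proof. by move=> t0; apply: posZ => //; exact: pos1. Qed.

Lemma pos_sum (I : eqType) (r : seq I) (P : pred I) (F : I -> A) :
  (forall i, i \in r -> P i -> pos (F i)) -> pos (\sum_(i <- r | P i) F i).
Proof.
move=> FP; rewrite big_seq_cond; elim/big_ind: _ => //; first exact: pos0.
  exact: posD.
by move=> i /andP[]; exact: FP.
Qed.

Lemma pos_cnormB h : star h = h -> pos (cnorm h ** 1 - h).
Proof.
move=> hs; split; first by rewrite starB star_rscale star1 hs.
by exists (cnorm h); rewrite ?cnorm_ge0// opprB addrC subrK.
Qed.

(** Writes h = t (1 - (1 - h / t)) and takes the root of each factor; any positive witness [t] of
    [pos h] serves. *)
Definition csqrt t h : A := Num.sqrt t ** (1 - sqrt_lim (1 - t^-1 ** h)).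

Lemma cnorm_1B t h : 0 < t -> cnorm (t ** 1 - h) <= t -> cnorm (1 - t^-1 ** h) <= 1.
Proof.
move=> t0 ht.
have -> : 1 - t^-1 ** h = t^-1 ** (t ** 1 - h).
  by rewrite scalerBr rscaleA mulVf ?gt_eqF// rscale1.
by rewrite cnorm_rscale gtr0_norm ?invr_gt0// ler_pdivrMl// mulr1.
Qed.

Lemma csqrt_sqr t h : 0 < t -> cnorm (t ** 1 - h) <= t -> csqrt t h * csqrt t h = h.
Proof.
move=> t0 ht; rewrite /csqrt -scalerAl -scalerAr rscaleA -expr2 sqr_sqrtr ?ltW//.
rewrite sqrt_lim_eq ?cnorm_1B// opprB addrC subrK rscaleA.
by rewrite divff ?gt_eqF// rscale1.
Qed.

Lemma pos_csqrt t h : 0 < t -> star h = h -> cnorm (t ** 1 - h) <= t -> pos (csqrt t h).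
Proof.
move=> t0 hs ht; have n1 := cnorm_1B t0 ht.
have s1 : star (1 - t^-1 ** h) = 1 - t^-1 ** h by rewrite starB star_rscale star1 hs.
apply: posZ; first exact: sqrtr_ge0.
split; first by rewrite starB star1 star_sqrt_lim.
by exists 1 => //; rewrite rscale1 opprB addrC subrK cnorm_sqrt_lim.
Qed.

Lemma csqrt_intertwine t z h h' : 0 < t ->
  cnorm (t ** 1 - h) <= t -> cnorm (t ** 1 - h') <= t ->
  z * h = h' * z -> z * csqrt t h = csqrt t h' * z.
Proof.
move=> t0 n1 n2 zh; rewrite /csqrt -scalerAr -scalerAl; congr (_ *: _).
rewrite mulrBr mulrBl mulr1 mul1r; congr (_ - _).
apply: sqrt_lim_intertwine; rewrite ?cnorm_1B//.
by rewrite mulrBr mulrBl mulr1 mul1r -scalerAr -scalerAl zh.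
Qed.

Lemma pos_sqrt h : pos h ->
  exists k, [/\ pos k, k * k = h & forall z, z * h = h * z -> z * k = k * z].
Proof.
move=> hp; have [t [_ t0 ht]] := pos_gt 0 hp; exists (csqrt t h); split.
- exact: pos_csqrt (pos_star hp) ht.
- exact: csqrt_sqr.
- by move=> z; exact: csqrt_intertwine.
Qed.

Lemma mulii : 'i * 'i = -1 :> R[i].
Proof. by rewrite -expr2 sqr_i. Qed.

(* [k + il] is unitary, hence of norm 1. *)
Lemma cnorm_le1_of_sqrD k l : star k = k -> star l = l -> k * l = l * k ->
  k * k + l * l = 1 -> cnorm k <= 1.
Proof.
move=> ks ls kl kl1.
have [u uE] : exists u, u = k + 'i *: l by exists (k + 'i *: l).
have us : star u = k - 'i *: l by rewrite uE starD star_iscale ks ls.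
have u1 : cnorm u = 1.
  have : star u * u = 1.
    rewrite us uE mulrBl !mulrDr -!scalerAl -!scalerAr scalerA kl.
    rewrite mulii scaleN1r -kl1; ncring.
  move=> /(congr1 (@cnorm _ A)); rewrite cnorm_starM cnorm1 => /eqP.
  by rewrite sqrp_eq1 ?cnorm_ge0// => /eqP.
have kE : k = 2^-1 ** (u + star u).
  have -> : u + star u = k + k by rewrite us uE; ncring.
  by rewrite -rscale2 rscaleA mulVf ?pnatr_eq0// rscale1.
rewrite kE cnorm_rscale gtr0_norm ?invr_gt0//.
have := cnormD u (star u); rewrite cnorm_star u1; lra.
Qed.

Lemma cnorm_sqr h : star h = h -> cnorm (h * h) = cnorm h ^+ 2.
Proof. by move=> hs; rewrite -{1}hs cnorm_starM. Qed.

(** The element 1 - k^2 is positive with witness 1, so it has a root l commuting with k. Since k^2 +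
    l^2 = 1, l has norm at most 1, and so does l^2. *)
Lemma cnorm_1B_sqr k : star k = k -> cnorm k <= 1 -> cnorm (1 - k * k) <= 1.
Proof.
move=> ks k1; have n1 : cnorm (1 ** 1 - (1 - k * k)) <= 1.
  by rewrite rscale1 opprB addrC subrK cnorm_sqr// expr_le1// cnorm_ge0.
have s1 : star (1 - k * k) = 1 - k * k by rewrite starB starM star1 ks.
have lE := csqrt_sqr ltr01 n1; set l := csqrt _ _ in lE.
have ls : star l = l by apply/pos_star/pos_csqrt.
have kl : k * l = l * k.
  by apply: csqrt_intertwine => //; ncring.
have : cnorm l <= 1.
  by apply: (@cnorm_le1_of_sqrD l k) => //; rewrite lE subrK.
by rewrite -lE cnorm_sqr// => ?; rewrite expr_le1// cnorm_ge0.
Qed.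

Lemma cnorm_scalarB_sqr k t : star k = k -> cnorm k ^+ 2 <= t -> cnorm (t ** 1 - k * k) <= t.
Proof.
move=> ks kt; have := le_trans (sqr_ge0 _) kt; rewrite le_eqVlt => /orP[/eqP t0|t0].
  have : cnorm k ^+ 2 == 0 by rewrite eq_le sqr_ge0 andbT t0.
  rewrite sqrf_eq0 cnorm_eq0P => /eqP ->; rewrite mulr0 subr0 cnorm_scalar.
  by rewrite -t0 normr0.
set k' := (Num.sqrt t)^-1 ** k.
have st : 0 < Num.sqrt t by rewrite sqrtr_gt0.
have k's : star k' = k' by rewrite star_rscale ks.
have k'1 : cnorm k' <= 1.
  rewrite cnorm_rscale gtr0_norm ?invr_gt0// ler_pdivrMl// mulr1.
  by rewrite -[cnorm k]ger0_norm ?cnorm_ge0// -sqrtr_sqr ler_sqrt// ltW.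
have -> : t ** 1 - k * k = t ** (1 - k' * k').
  have -> : k' * k' = t^-1 ** (k * k).
    by rewrite -scalerAl -scalerAr rscaleA -invfM -expr2 sqr_sqrtr ?ltW.
  by rewrite scalerBr rscaleA divff ?gt_eqF// rscale1.
rewrite cnorm_rscale gtr0_norm// -[leRHS]mulr1 ler_pM2l//; exact: cnorm_1B_sqr.
Qed.

Lemma pos_sqr k : star k = k -> pos (k * k).
Proof.
move=> ks; split; first by rewrite starM ks.
by exists (cnorm k ^+ 2); [exact: sqr_ge0|exact: cnorm_scalarB_sqr].
Qed.

(** Frees the witness in [pos] from its existential: after [h] is written as the square of its root,
    every bound of the norm serves. This uniformity makes positivity stable under limits, as in
    [pos_eps]. *)
Lemma pos_cnorm h t : pos h -> cnorm h <= t -> cnorm (t ** 1 - h) <= t.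
Proof.
move=> /pos_sqrt[k [/pos_star ks <- _]]; rewrite cnorm_sqr//.
exact: cnorm_scalarB_sqr.
Qed.

Lemma pos_eps h : (forall e, 0 < e -> pos (h + e ** 1)) -> pos h.
Proof.
move=> H; split.
  have [s _] := H _ ltr01; move: s; rewrite starD star_rscale star1; exact: addIr.
exists (cnorm h); rewrite ?cnorm_ge0//; apply/ler_addgt0Pr => e e0.
have -> : cnorm h ** 1 - h = (cnorm h + e) ** 1 - (h + e ** 1).
  by rewrite rscaleDl; ncring.
apply: pos_cnorm; first exact: H.
by apply: le_trans (cnormD _ _) _; rewrite cnorm_scalar gtr0_norm.
Qed.

Lemma pos_comm_mul h k : pos h -> pos k -> h * k = k * h -> pos (h * k).
Proof.
move=> /pos_sqrt[x [/pos_star xs <- xC]] /pos_sqrt[y [/pos_star ys <- yC]] c.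
have xy : x * y = y * x.
  by apply: yC; apply: esym; apply: xC.
have -> : x * x * (y * y) = (x * y) * (x * y) by rewrite -!mulrA; congr (x * _); rewrite !mulrA xy.
by apply: pos_sqr; rewrite starM xs ys.
Qed.

(* If [k ^ 2 + l ^ 2 = 1] then also [(k ^ 2 - l ^ 2) ^ 2 + (2 k l) ^ 2 = 1]. *)
Lemma cnorm_le_of_pos h s : 0 <= s -> pos (s ** 1 - h) -> pos (s ** 1 + h) -> cnorm h <= s.
Proof.
move=> s0 p1 p2; apply/ler_addgt0Pr => e e0.
have se : 0 < s + e by rewrite ltr_wpDl.
(* Normalizes s - h + e and s + h + e to have sum 1; the shift by [e] keeps the denominator positive
   when s = 0. *)
pose r := (2 * (s + e))^-1.
have r0 : 0 < r by rewrite invr_gt0 mulr_gt0.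
have q1 : pos (r ** (s ** 1 - h + e ** 1)).
  by apply: posZ; [exact: ltW|apply: posD => //; apply/pos_scalar/ltW].
have q2 : pos (r ** (s ** 1 + h + e ** 1)).
  by apply: posZ; [exact: ltW|apply: posD => //; apply/pos_scalar/ltW].
have sum1 : r ** (s ** 1 - h + e ** 1) + r ** (s ** 1 + h + e ** 1) = 1.
  have E : s ** 1 - h + e ** 1 + (s ** 1 + h + e ** 1) = (2 * (s + e)) ** 1.
    by rewrite -rscaleA rscale2 rscaleDl; ncring.
  by rewrite -scalerDr E rscaleA mulVf ?rscale1// mulf_neq0 ?gt_eqF.
have diff : r ** (s ** 1 + h + e ** 1) - r ** (s ** 1 - h + e ** 1) = (s + e)^-1 ** h.
  have E : s ** 1 + h + e ** 1 - (s ** 1 - h + e ** 1) = 2 ** h.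
    by rewrite rscale2; ncring.
  by rewrite -scalerBr E rscaleA /r invfM mulrAC mulVf ?pnatr_eq0// mul1r.
have [k [kp kE kC]] := pos_sqrt q1; have [l [lp lE lC]] := pos_sqrt q2.
have ks := pos_star kp; have ls := pos_star lp.
have kl : k * l = l * k.
  apply: lC; apply: esym; apply: kC.
  by rewrite -!scalerAl -!scalerAr; congr (_ *: (_ *: _));
     rewrite !(mulrDl, mulrDr, mulNr, mulrN) -!scalerAl -!scalerAr !mulr1 !mul1r; ncring.
have lk : l * k = k * l by [].
have zlk z : z * l * k = z * k * l by rewrite -mulrA lk mulrA.
have : cnorm (l * l - k * k) <= 1.
  apply: (@cnorm_le1_of_sqrD _ (2 ** (k * l))).
  - by rewrite starB !starM ks ls.
  - by rewrite star_rscale starM ks ls kl.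
  - rewrite -scalerAr -scalerAl mulrBr mulrBl; congr (_ *: (_ - _)).
      by rewrite !mulrA !(zlk, lk).
    by rewrite !mulrA !(zlk, lk).
  - rewrite -[RHS](mulr1 1) -sum1 -kE -lE -scalerAl -scalerAr rscaleA.
    rewrite -rscaleA !rscale2 mulrBl !mulrBr mulrDl !mulrDr !mulrA !(zlk, lk).
    by ncring.
rewrite kE lE diff cnorm_rscale gtr0_norm ?invr_gt0//.
by rewrite ler_pdivrMl// mulr1.
Qed.

Lemma pos_antisym h : pos h -> pos (- h) -> h = 0.
Proof.
move=> p1 p2; apply/cnorm_small => e e0; apply: le_trans (ltW e0).
by apply: cnorm_le_of_pos => //; rewrite rscale0 ?sub0r ?add0r.
Qed.

Lemma pos_cnorm_le h s : 0 <= s -> pos h -> pos (s ** 1 - h) -> cnorm h <= s.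
Proof.
move=> s0 ph p; apply: cnorm_le_of_pos => //; apply: posD => //; exact: pos_scalar.
Qed.

Lemma sqr_eq0 h : star h = h -> h * h = 0 -> h = 0.
Proof.
move=> hs hh; apply/cnorm_eq0/eqP; rewrite -sqrf_eq0 -cnorm_sqr// hh.
by rewrite cnorm0.
Qed.

Lemma cube_eq0 h : star h = h -> h * h * h = 0 -> h = 0.
Proof.
move=> hs h3; apply: sqr_eq0 => //; apply: sqr_eq0; first by rewrite starM hs.
by rewrite mulrA h3 mul0r.
Qed.

(** With D = p - k, the commuting products D^2 p and D^2 k are positive and add up to D (p^2 - k^2)
    = 0, so both vanish, and D^3 is their difference. *)
Lemma pos_sqrt_uniq p k : pos p -> pos k -> p * k = k * p -> p * p = k * k -> p = k.
Proof.
move=> pp kp c pk; set D := p - k.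
have Ds : star D = D by rewrite starB !pos_star.
have Dp : p * D = D * p by rewrite /D mulrBr mulrBl c.
have Dk : k * D = D * k by rewrite /D mulrBr mulrBl c.
have X : pos (D * D * p).
  by apply: pos_comm_mul => //; [exact: pos_sqr|rewrite mulrA Dp -!mulrA Dp].
have Y : pos (D * D * k).
  by apply: pos_comm_mul => //; [exact: pos_sqr|rewrite mulrA Dk -!mulrA Dk].
have XY : D * D * p = - (D * D * k).
  apply/eqP; rewrite -addr_eq0 -mulrDr -mulrA (_ : D * (p + k) = 0) ?mulr0//.
  by rewrite /D mulrBl !mulrDr c pk; ncring.
have X0 : D * D * p = 0.
  by apply: pos_antisym => //; rewrite XY opprK.
have Y0 : D * D * k = 0 by apply/eqP; rewrite -oppr_eq0 -XY X0.
have : D * D * D = 0 by rewrite -[RHS](subrr 0) -{1}X0 -Y0 -mulrBr.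
by move=> /(cube_eq0 Ds)/eqP; rewrite subr_eq0 => /eqP.
Qed.

(* With [p = - y* y] and [q = y y*], [y p = - q y], while [y] intertwines
   [p = sqrt (p ^ 2)] and [q = sqrt (q ^ 2)]. *)
Lemma neg_star_mul_eq0 y : pos (- (star y * y)) -> pos (y * star y) -> y = 0.
Proof.
set p := - _; set q := y * _ => pp qp.
have yp : y * p = - (q * y) by rewrite /p /q mulrN mulrA.
have ypp : y * (p * p) = (q * q) * y.
  by rewrite mulrA yp mulNr -[q * y * p]mulrA yp mulrN opprK mulrA.
have ps := pos_star pp; have qs := pos_star qp.
have [t [_ t0 pt]] := pos_gt 0 (pos_sqr ps).
have [s [ts s0 qt]] := pos_gt t (pos_sqr qs).
have {}pt := cnorm_le_trans ts pt.
have /= := csqrt_intertwine s0 pt qt ypp.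
have -> : csqrt s (p * p) = p.
  apply/esym; apply: pos_sqrt_uniq => //.
  - by apply: pos_csqrt => //; rewrite starM ps.
  - by apply: csqrt_intertwine => //; rewrite mulrA.
  - by rewrite csqrt_sqr.
have -> : csqrt s (q * q) = q.
  apply/esym; apply: pos_sqrt_uniq => //.
  - by apply: pos_csqrt => //; rewrite starM qs.
  - by apply: csqrt_intertwine => //; rewrite mulrA.
  - by rewrite csqrt_sqr.
rewrite yp => /eqP; rewrite eq_sym -addr_eq0 -rscale2 => /eqP qy.
have {}qy : q * y = 0.
  by have := congr1 ( *:%R 2^-1%:C) qy; rewrite scaler0 rscaleA mulVf ?pnatr_eq0// rscale1.
have : p * p = 0 by rewrite {1}/p mulNr -mulrA yp qy oppr0 mulr0 oppr0.
move=> /(sqr_eq0 ps)/eqP; rewrite oppr_eq0 => /eqP yy.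
by apply/cnorm_eq0/eqP; rewrite -sqrf_eq0 -cnorm_starM yy cnorm0.
Qed.

Lemma re_imE x : exists a b, [/\ star a = a, star b = b & x = a + 'i *: b].
Proof.
exists (2^-1 ** (x + star x)), (2^-1 ** ('i *: (star x - x))).
split.
- by rewrite star_rscale starD starK addrC.
- by rewrite star_rscale star_iscale starB starK -scalerN opprB.
- rewrite !scalerA (mulrC 'i) -mulrA mulii.
  rewrite mulrN1 scaleNr -scalerBr.
  have -> : x + star x - (star x - x) = x + x by ncring.
  by rewrite -rscale2 rscaleA mulVf ?pnatr_eq0// rscale1.
Qed.

(** With k = |h| the root of h^2 and m = k - h, twice the negative part of h, one has m (h + k) = 0.
    Hence y = x m satisfies y' y = m h m = - m^2 k <= 0, while y y' + y' y is a sum of squares of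
    real and imaginary parts, so that y y' >= 0. Then y = 0, which forces m^3 = 0 and h = k. *)
Lemma pos_starM x : pos (star x * x).
Proof.
have hs : star (star x * x) = star x * x by rewrite starM starK.
set h := star x * x in hs *.
have [k [kp kE kC]] := pos_sqrt (pos_sqr hs).
have ks := pos_star kp.
have hk : h * k = k * h by apply: kC; rewrite mulrA.
set m := k - h.
have ms : star m = m by rewrite starB hs ks.
have hm : h * m = m * h by rewrite /m mulrBr mulrBl hk.
have m3 : m * h * m = - (m * m * k).
  rewrite -mulrA hm mulrA; apply/eqP; rewrite -addr_eq0 -mulrDr -mulrA.
  by rewrite (_ : m * (h + k) = 0) ?mulr0// /m mulrBl !mulrDr kE hk; ncring.
have yy : star (x * m) * (x * m) = - (m * m * k).
  by rewrite starM ms -m3 /h !mulrA.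
have mk : m * k = k * m by rewrite /m mulrBr mulrBl hk.
have np : pos (- (star (x * m) * (x * m))).
  rewrite yy opprK; apply: pos_comm_mul => //; first exact: pos_sqr.
  by rewrite -mulrA mk !mulrA mk.
have [a [b [sa sb E]]] := re_imE (x * m).
have : x * m = 0.
  apply: neg_star_mul_eq0 => //.
  have -> : x * m * star (x * m) = 2 ** (a * a + b * b) + - (star (x * m) * (x * m)).
    rewrite E starD star_iscale sa sb rscale2.
    rewrite !(mulrDl, mulrDr, mulNr, mulrN) -!scalerAl -!scalerAr !scalerA.
    by rewrite mulii !scaleN1r; ncring.
  by apply: posD => //; apply: posZ => //; apply: posD; exact: pos_sqr.
move=> xm; have : m * m * k = 0.
  by apply/eqP; rewrite -oppr_eq0 -yy xm mulr0.
have : m * h = 0 by rewrite -hm /h -mulrA xm mulr0.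
move=> mh mmk; have : m = 0.
  by apply: cube_eq0 => //; rewrite -[RHS](subrr 0) -{1}mmk -(mulr0 m) -mh mulrA -mulrBr.
by move=> /eqP; rewrite subr_eq0 => /eqP <-.
Qed.

Lemma pos_Mstar x : pos (x * star x).
Proof. by rewrite -{1}(starK x); exact: pos_starM. Qed.

Lemma pos_positive_elt h : pos h <-> positive_elt h.
Proof.
split=> [/pos_sqrt[k [/pos_star ks <- _]]|[y ->]]; last exact: pos_starM.
by exists k; rewrite ks.
Qed.

Lemma pos_conj x h : pos h -> pos (star x * h * x).
Proof.
move=> /pos_sqrt[k [/pos_star ks <- _]].
have -> : star x * (k * k) * x = star (k * x) * (k * x) by rewrite starM ks !mulrA.
exact: pos_starM.
Qed.

Definition cle x y := pos (y - x).

Lemma cle_refl x : cle x x. Proof. by rewrite /cle subrr; exact: pos0. Qed.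

Lemma cle_trans y x z : cle x y -> cle y z -> cle x z.
Proof. by move=> /posD h /h; rewrite addrC addrA subrK. Qed.

Lemma cleD x y x' y' : cle x y -> cle x' y' -> cle (x + x') (y + y').
Proof. by move=> h /(posD h); rewrite /cle opprD addrACA. Qed.

Lemma cle_sum (I : eqType) (r : seq I) (P : pred I) (F G : I -> A) :
  (forall i, i \in r -> P i -> cle (F i) (G i)) ->
  cle (\sum_(i <- r | P i) F i) (\sum_(i <- r | P i) G i).
Proof. by move=> h; rewrite /cle -sumrB; exact: pos_sum. Qed.

Lemma cleZ t x y : 0 <= t -> cle x y -> cle (t ** x) (t ** y).
Proof. by move=> t0 xy; rewrite /cle -scalerBr; exact: posZ. Qed.

Lemma cle_conj z x y : cle x y -> cle (star z * x * z) (star z * y * z).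
Proof. by move=> /(pos_conj z); rewrite /cle mulrBr mulrBl. Qed.

Lemma cle_conjV z x y : cle x y -> cle (z * x * star z) (z * y * star z).
Proof. by move=> /(cle_conj (star z)); rewrite starK. Qed.

Lemma cle_scalar s t : s <= t -> cle (s ** 1) (t ** 1).
Proof. by move=> st; rewrite /cle -rscaleBl; apply: pos_scalar; rewrite subr_ge0. Qed.

Lemma cle_cnorm h s : 0 <= s -> pos h -> cle h (s ** 1) -> cnorm h <= s.
Proof. exact: pos_cnorm_le. Qed.

Lemma cle_scalar_cnorm h : star h = h -> cle h (cnorm h ** 1).
Proof. exact: pos_cnormB. Qed.

End Positivity.

(** * The Cauchy-Schwarz inequality and positive forms *)

Section CauchySchwarz.
Variables (R : realType) (A : cstarAlgType R).

Lemma mulr_sum2 (I : Type) (r : seq I) (F G : I -> A) :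
  (\sum_(i <- r) F i) * (\sum_(i <- r) G i) = \sum_(i <- r) \sum_(j <- r) F i * G j.
Proof. by rewrite mulr_suml; apply: eq_bigr => i _; rewrite mulr_sumr. Qed.

(** Expanding the positive sum of the squares of [a ** Y i - star (X i) * Z], and bounding the sum
    of the [X i * star (X i)] by a, gives a Z' Z <= a^2 times the sum of the [star (Y i) * Y i]. *)
Lemma cauchy_schwarz (I : eqType) (r : seq I) (X Y : I -> A) (a b : R) :
  0 < a -> 0 <= b ->
  cle (\sum_(i <- r) X i * star (X i)) (a ** 1) ->
  cle (\sum_(i <- r) star (Y i) * Y i) (b ** 1) ->
  cnorm (\sum_(i <- r) X i * Y i) ^+ 2 <= a * b.
Proof.
move=> a0 b0 Xa Yb; set Z := \sum_(i <- r) X i * Y i.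
have ZE : star Z = \sum_(i <- r) star (Y i) * star (X i).
  by rewrite star_sum; apply: eq_bigr => i _; rewrite starM.
have key : cle (a ** (star Z * Z)) ((a * a) ** (\sum_(i <- r) star (Y i) * Y i)).
  rewrite /cle.
  have -> : (a * a) ** (\sum_(i <- r) star (Y i) * Y i) - a ** (star Z * Z) =
    \sum_(i <- r) star (a ** Y i - star (X i) * Z) * (a ** Y i - star (X i) * Z) +
    star Z * (a ** 1 - \sum_(i <- r) X i * star (X i)) * Z.
    have -> : \sum_(i <- r) star (a ** Y i - star (X i) * Z) * (a ** Y i - star (X i) * Z) =
      (a * a) ** (\sum_(i <- r) star (Y i) * Y i) - a ** (star Z * Z) - a ** (star Z * Z)
      + star Z * (\sum_(i <- r) X i * star (X i)) * Z.
      transitivity (\sum_(i <- r) ((a * a) ** (star (Y i) * Y i)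
         - a ** ((star (Y i) * star (X i)) * Z) - a ** (star Z * (X i * Y i))
         + star Z * (X i * star (X i)) * Z)).
        apply: eq_bigr => i _; rewrite starB star_rscale starM starK.
        rewrite mulrBl !mulrBr -!scalerAl -!scalerAr rscaleA !mulrA; ncring.
      rewrite big_split !sumrB /= -!scaler_sumr -!mulr_suml -!mulr_sumr.
      by rewrite -ZE.
    rewrite mulrBr mulrBl -scalerAr mulr1 -scalerAl; ncring.
  apply: posD; last exact: pos_conj.
  by apply: pos_sum => i _ _; exact: pos_starM.
have {}key : cle (star Z * Z) ((a * b) ** 1).
  have ai : 0 <= a^-1 by rewrite invr_ge0 ltW.
  have := cleZ ai key; rewrite !rscaleA mulrA mulVf ?gt_eqF// mul1r rscale1 => h.
  by apply: cle_trans h _; rewrite -rscaleA; apply: cleZ => //; exact: ltW.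
rewrite -cnorm_starM; apply: cle_cnorm => //; first by rewrite mulr_ge0// ltW.
exact: pos_starM.
Qed.

End CauchySchwarz.

(** * Positivity of quadratic forms with entries in a C*-subalgebra *)

Section CompletePositivity.
Variables (R : realType) (A : cstarAlgType R) (D : set A).
Hypotheses (D_alg : cstar_subalg D) (D1 : D 1).

Let Dlin : forall (k : R[i]) u v, D u -> D v -> D (k *: u + v).
Proof. by case: D_alg => [[_ _ h] _ _]. Qed.

Let D0 : D 0.
Proof. by case: D_alg => [[_ ? _] _ _]. Qed.

Let DZ (k : R[i]) u : D u -> D (k *: u).
Proof. by move=> Du; rewrite -[X in D X]addr0; exact: Dlin. Qed.

Let DD u v : D u -> D v -> D (u + v).
Proof. by move=> Du; rewrite -[u]scale1r; exact: Dlin. Qed.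

Let DN u : D u -> D (- u).
Proof. by move=> Du; rewrite -scaleN1r; exact: DZ. Qed.

Let DM u v : D u -> D v -> D (u * v).
Proof. by case: D_alg => [_ h _]; exact: h. Qed.

Let Dsum (I : Type) (r : seq I) (F : I -> A) : (forall i, D (F i)) -> D (\sum_(i <- r) F i).
Proof. by move=> DF; elim/big_ind: _. Qed.

Lemma ccvg_closed (W : set A) (u : nat -> A) l :
  cnorm_closed W -> (forall n, W (u n)) -> ccvg u l -> W l.
Proof.
move=> cW Wu ul; apply: cW => e /ul[N /(_ N (leqnn N)) h].
by exists (u N) => //; rewrite cnorm_subC.
Qed.

(** A Neumann series for 1 - f with f = 1 - h / (t + e), of norm at most t / (t + e) < 1. Its
    partial sums stay in [D], and the scalar geometric series [s] dominates them. *)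
Lemma pos_inverse h (e : R) : 0 < e -> D h -> pos (h - e ** 1) ->
  exists g, [/\ D g, star g = g, h * g = 1 & g * h = 1].
Proof.
move=> e0 Dh hp; have [t [_ t0 ht]] := pos_gt 0 hp.
have hs : star h = h.
  by have := pos_star hp; rewrite starB star_rscale star1 => /addIr.
set T := t + e; have T0 : 0 < T by rewrite addr_gt0.
set q := t / T; have q0 : 0 <= q by rewrite divr_ge0// ltW.
have q1 : q < 1 by rewrite ltr_pdivrMr// mul1r ltrDl.
set f : A := 1 - T^-1 ** h.
have fq : cnorm f <= q.
  have -> : f = T^-1 ** (t ** 1 - (h - e ** 1)).
    rewrite opprB addrA -rscaleDl -/T scalerBr rscaleA mulVf ?gt_eqF//.
    by rewrite rscale1.
  by rewrite cnorm_rscale gtr0_norm ?invr_gt0// mulrC ler_pM2r ?invr_gt0.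
have Df : D f by apply: DD => //; apply: DN; exact: DZ.
have fs : star f = f by rewrite starB star_rscale star1 hs.
pose b := fix b n : A := if n is m.+1 then 1 + f * b m else 0.
pose s := fix s n : R := if n is m.+1 then 1 + q * s m else 0.
have sb n : s n <= (1 - q)^-1.
  elim: n => [|n IH] /=; first by rewrite invr_ge0 subr_ge0 ltW.
  have q2 : 0 < 1 - q by rewrite subr_gt0.
  have := ler_wpM2l q0 IH; have : (1 - q) * (1 - q)^-1 = 1 by rewrite divff ?gt_eqF.
  by move=> ? ?; lra.
have bs n : cnorm (b n.+1 - b n) <= s n.+1 - s n.
  elim: n => [|n IH]; first by rewrite /= !mulr0 !addr0 !subr0 cnorm1.
  have -> : b n.+2 - b n.+1 = f * (b n.+1 - b n).
    by rewrite mulrBr [b n.+2]/(1 + f * b n.+1) [X in _ - X]/(1 + f * b n); ncring.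
  have -> : s n.+2 - s n.+1 = q * (s n.+1 - s n).
    by rewrite mulrBr [s n.+2]/(1 + q * s n.+1) [X in _ - X]/(1 + q * s n) opprD addrACA subrr add0r.
  apply: le_trans (cnormM _ _) _; apply: ler_pM; rewrite ?cnorm_ge0//.
have [g gl] := ccvg_majorant bs sb.
have bD n : D (b n) by elim: n => [|n IH] //=; apply: DD => //; exact: DM.
have bC n : f * b n = b n * f.
  elim: n => [|n IH] /=; first by rewrite mulr0 mul0r.
  by rewrite mulrDr (mulrDl 1 (f * b n) f) mulr1 mul1r -mulrA -IH.
have bstar n : star (b n) = b n.
  elim: n => [|n IH] /=; first exact: star0.
  by rewrite starD star1 starM IH fs -bC.
have Dg : D g by apply: ccvg_closed gl => //; case: D_alg => [[]].
have gs : star g = g.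
  by apply: ccvg_uniq (ccvg_star gl) _; apply: ccvg_eq gl => n; rewrite bstar.
have gE : g = 1 + f * g.
  by apply: ccvg_uniq (ccvg_shift gl) _; apply: ccvgD (ccvg_cst _) (ccvgMl f gl).
have gC : f * g = g * f.
  apply: ccvg_uniq (ccvgMl f gl) _; apply: ccvg_eq (ccvgMr f gl) => n; exact/esym/bC.
have hE : h = T ** (1 - f).
  by rewrite /f opprB addrC subrK rscaleA divff ?gt_eqF// rscale1.
have e1 : (1 - f) * g = 1 by rewrite mulrBl mul1r {1}gE addrK.
have e2 : g * (1 - f) = 1 by rewrite mulrBr mulr1 -gC {1}gE addrK.
exists (T^-1 ** g); split.
- exact: DZ.
- by rewrite star_rscale gs.
- by rewrite hE -scalerAl -scalerAr rscaleA e1 divff ?gt_eqF// rscale1.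
- by rewrite hE -scalerAl -scalerAr rscaleA e2 mulVf ?gt_eqF// rscale1.
Qed.

Section Form.
Variable I : eqType.
Implicit Types (m : I -> I -> A) (c : I -> A) (r : seq I).

Definition qform r m c := \sum_(x <- r) \sum_(y <- r) star (c x) * m x y * c y.

Lemma eq_qform r m c c' : {in r, c =1 c'} -> qform r m c = qform r m c'.
Proof.
move=> cc; rewrite /qform big_seq [RHS]big_seq; apply: eq_bigr => x xr.
by rewrite big_seq [RHS]big_seq; apply: eq_bigr => y yr; rewrite !cc.
Qed.

Lemma qform_cons x r m c : (forall x y, star (m x y) = m y x) ->
  let w := \sum_(y <- r) m x y * c y in
  qform (x :: r) m c = star (c x) * m x x * c x + star (c x) * w + star w * c x + qform r m c.
Proof.
move=> mH w; rewrite /qform big_cons big_cons.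
have -> : \sum_(j <- r) star (c x) * m x j * c j = star (c x) * w.
  by rewrite mulr_sumr; apply: eq_bigr => y _; rewrite mulrA.
have -> : star w * c x = \sum_(y <- r) star (c y) * m y x * c x.
  by rewrite star_sum mulr_suml; apply: eq_bigr => y _; rewrite starM mH.
rewrite -[in RHS]addrA; congr (_ + _); rewrite -big_split /=.
by apply: eq_bigr => y _; rewrite big_cons.
Qed.

(* Completing the square with the Schur complement of [m x x]. *)
Lemma qform_schur x r m c g : (forall x y, star (m x y) = m y x) ->
  star g = g -> m x x * g = 1 -> g * m x x = 1 ->
  let w := \sum_(y <- r) m x y * c y in
  qform (x :: r) m c =
  star (c x + g * w) * m x x * (c x + g * w) +
  qform r (fun y z => m y z - m y x * g * m x z) c.
Proof.
move=> mH gs mg gm w; rewrite qform_cons// -/w.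
have -> : qform r (fun y z => m y z - m y x * g * m x z) c =
          qform r m c - star w * g * w.
  rewrite /w star_sum -mulrA mulr_sumr mulr_sum2 -sumrB; apply: eq_bigr => y _.
  rewrite -sumrB; apply: eq_bigr => z _; rewrite starM mH mulrBr mulrBl.
  by rewrite !mulrA.
have -> : star (c x + g * w) * m x x * (c x + g * w) =
    star (c x) * m x x * c x + star (c x) * (m x x * g) * w +
    star w * (g * m x x) * c x + star w * (g * m x x) * g * w.
  by rewrite starD starM gs; ncring.
by rewrite mg gm !mulr1; ncring.
Qed.

(** Eliminates one index at a time. The margin [e] makes the diagonal entry invertible inside [D],
    so the Schur complement again has entries in [D], and it inherits the same margin. *)
Lemma qform_pos_strict r m (e : R) : uniq r -> 0 < e ->
  (forall x y, D (m x y)) -> (forall x y, star (m x y) = m y x) ->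
  (forall c, (forall x, D (c x)) ->
     pos (qform r m c - e ** \sum_(x <- r) star (c x) * c x)) ->
  forall c, pos (qform r m c).
Proof.
elim: r m => [|x r IH] m /=; first by move=> *; rewrite /qform big_nil; exact: pos0.
move=> /andP[xr ur] e0 mD mH mP c.
(* Tests the form on the vector with 1 at [x] and 0 elsewhere. *)
have mxx : pos (m x x - e ** 1).
  have := mP (fun y => if y == x then 1 else 0).
  have z0 : forall (F : I -> A) (G : I -> A),
      \sum_(y <- r) F y * (if y == x then 1 else 0) * G y = 0.
    move=> F G; rewrite big_seq big1// => y yr; case: eqP => [yx|_].
      by rewrite -yx yr in xr.
    by rewrite mulr0 mul0r.
  have z1 : \sum_(y <- r) m x y * (if y == x then 1 else 0) = 0.
    rewrite big_seq big1// => y yr; case: eqP => [yx|_]; last by rewrite mulr0.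
    by rewrite -yx yr in xr.
  have z2 : qform r m (fun y => if y == x then 1 else 0) = 0.
    rewrite (@eq_qform _ _ _ (fun=> 0)); last first.
      by move=> y yr; case: eqP => [yx|//]; rewrite -yx yr in xr.
    by rewrite /qform big1// => y _; rewrite big1// => z _; rewrite mulr0.
  have z3 : \sum_(y <- r) star (if y == x then 1 else 0 : A) * (if y == x then 1 else 0) = 0.
    rewrite big_seq big1// => y yr; case: eqP => [yx|_]; last by rewrite mulr0.
    by rewrite -yx yr in xr.
  rewrite qform_cons// z1 z2 big_cons z3 eqxx star1 !mul1r mulr1 star0 mul0r.
  by rewrite !addr0 => h; apply: h => y; case: ifP.
have [g [Dg gs mg gm]] := pos_inverse e0 (mD x x) mxx.
have pxx : pos (m x x).
  by rewrite -[m x x](subrK (e ** 1)); apply: posD => //; apply/pos_scalar/ltW.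
rewrite (qform_schur r c mH gs mg gm); apply: posD; first exact: pos_conj.
apply: (IH _ ur e0) => {c}.
- by move=> y z; apply: DD => //; apply: DN; apply: DM => //; exact: DM.
- by move=> y z; rewrite starB !starM gs !mH mulrA.
move=> c cD; set w := \sum_(y <- r) m x y * c y.
(* The value at [x] makes the completed square vanish, so the full form at [c'] is the Schur
   complement at [c]. *)
pose c' y := if y == x then - (g * w) else c y.
have cc' : {in r, c' =1 c}.
  by move=> y yr; rewrite /c'; case: eqP => [yx|//]; rewrite -yx yr in xr.
have w' : \sum_(y <- r) m x y * c' y = w.
  by rewrite /w big_seq [RHS]big_seq; apply: eq_bigr => y yr; rewrite cc'.
have c'D y : D (c' y).
  rewrite /c'; case: ifP => // _; apply: DN; apply: DM => //.
  by apply: Dsum => z; exact: DM.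
have := mP c' c'D; rewrite (qform_schur r c' mH gs mg gm) w' {1 2}/c' eqxx.
rewrite addNr mulr0 add0r (eq_qform _ cc') big_cons scalerDr opprD addrA => h.
have -> : \sum_(y <- r) star (c y) * c y = \sum_(y <- r) star (c' y) * c' y.
  by rewrite big_seq [RHS]big_seq; apply: eq_bigr => y yr; rewrite cc'.
set q := qform _ _ _ in h *.
have -> : q - e ** (\sum_(y <- r) star (c' y) * c' y) =
  (q - e ** (star (c' x) * c' x) - e ** (\sum_(y <- r) star (c' y) * c' y)) +
  e ** (star (c' x) * c' x) by ncring.
by apply: posD => //; apply: posZ; [exact: ltW|exact: pos_starM].
Qed.

(** Passes from test vectors over [D] to vectors over the whole algebra. Adding a small scalar to
    the diagonal provides the strict margin. *)
Lemma qform_pos r m : uniq r ->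
  (forall x y, D (m x y)) -> (forall x y, star (m x y) = m y x) ->
  (forall c, (forall x, D (c x)) -> pos (qform r m c)) ->
  forall c, pos (qform r m c).
Proof.
move=> ur mD mH mP c.
pose m' (e : R) x y := m x y + (if x == y then e ** 1 else 0).
have m'E e c' : qform r (m' e) c' = qform r m c' + e ** \sum_(x <- r) star (c' x) * c' x.
  rewrite /qform scaler_sumr -big_split [LHS]big_seq [RHS]big_seq; apply: eq_bigr => x xr /=.
  rewrite (bigD1_seq x)//= [in RHS](bigD1_seq x)//= /m' eqxx.
  rewrite (eq_bigr (fun y => star (c' x) * m x y * c' y)); last first.
    by move=> y; rewrite eq_sym => /negbTE ->; rewrite addr0.
  rewrite mulrDr mulrDl -scalerAr -scalerAl mulr1; ncring.
(* With [B] bounding the squared length of [c], a diagonal perturbation by e / B changes the form at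
   [c] by at most e. *)
have [B [B0 BE]] : exists B : R, 0 < B /\ cle (\sum_(x <- r) star (c x) * c x) (B ** 1).
  have p : pos (\sum_(x <- r) star (c x) * c x) by apply: pos_sum => *; exact: pos_starM.
  exists (cnorm (\sum_(x <- r) star (c x) * c x) + 1); split; first by rewrite ltr_wpDl ?cnorm_ge0.
  apply: cle_trans (cle_scalar_cnorm (pos_star p)) _.
  by apply: cle_scalar; rewrite lerDl.
apply: pos_eps => e e0; have eB : 0 < e / B by rewrite divr_gt0.
have : pos (qform r (m' (e / B)) c).
  apply: (qform_pos_strict ur eB).
  - by move=> x y; apply: DD => //; case: ifP => // _; exact: DZ.
  - move=> x y; rewrite starD mH eq_sym; congr (_ + _).
    by case: ifP; rewrite ?star0// star_rscale star1.
  - by move=> c' c'D; rewrite m'E addrK; exact: mP.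
rewrite m'E => h.
have -> : qform r m c + e ** 1 =
  (qform r m c + (e / B) ** (\sum_(x <- r) star (c x) * c x)) +
  (e / B) ** (B ** 1 - \sum_(x <- r) star (c x) * c x).
  by rewrite scalerBr rscaleA divfK ?gt_eqF//; ncring.
by apply: posD => //; apply: posZ => //; exact: ltW.
Qed.

End Form.
End CompletePositivity.

(** * Normal forms in the Baumslag-Solitar group *)

Section NormalForm.
Variables (c d : nat).
Hypotheses (hc : (0 < c)%N) (hd : (0 < d)%N).

Local Notation G := (BS c d).
Local Notation a := (BS_a c d).
Local Notation b := (BS_b c d).

(* The pair [(w, t)] encodes the normal form [b^s1 a^e1 ... b^sk a^ek b^t] of
   an element of the HNN extension, with [w] the list of the [(ei, si)];
   [true] stands for the exponent [1] and [false] for [-1]. *)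
Definition nform : Type := seq (bool * nat) * int.

Definition digit_bound (e : bool) := if e then d else c.

Fixpoint reduced (w : seq (bool * nat)) : bool :=
  if w is (e, s) :: w' then
    [&& (s < digit_bound e)%N, reduced w' &
        if w' is (e', s') :: _ then ~~ ((e' == ~~ e) && (s' == 0%N)) else true]
  else true.

(** Left multiplication by b^m: by b^d a = a b^c, each multiple of d pushed through [a] becomes the
    same multiple of c, and conversely for a^-1. The quotient is the carry, the remainder the new
    digit. *)
Fixpoint shift_nform (w : seq (bool * nat)) (t m : int) : nform :=
  if w is (e, s) :: w' then
    let r := shift_nform w' t ((digit_bound (~~ e))%:Z * ((s%:Z + m) %/ digit_bound e)%Z) in
    ((e, `|((s%:Z + m) %% digit_bound e)%Z|%N) :: r.1, r.2)
  else ([::], t + m).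

Definition stable_nform (e : bool) (w : seq (bool * nat)) : seq (bool * nat) :=
  if w is (e', 0%N) :: w' then if e' == ~~ e then w' else (e, 0%N) :: w
  else (e, 0%N) :: w.

Definition letter_act (x : bool * bool) (f : nform) : nform :=
  if x.1 then (stable_nform (~~ x.2) f.1, f.2)
  else shift_nform f.1 f.2 (if x.2 then -1 else 1).

Definition word_act (u : word bool) (f : nform) : nform := foldr letter_act f u.

Lemma digit_bound_gt0 e : (0 < digit_bound e)%N. Proof. by case: e. Qed.

Lemma digit_boundZ_neq0 e : (digit_bound e)%:Z != 0.
Proof. by rewrite -lt0n ?digit_bound_gt0. Qed.

Lemma mod_digit e (m : int) :
  (`|(m %% digit_bound e)%Z|%N : int) = (m %% digit_bound e)%Z.
Proof. by rewrite abszE ger0_norm ?modz_ge0 ?digit_boundZ_neq0. Qed.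

Lemma shift_nformD w t m n :
  shift_nform (shift_nform w t m).1 (shift_nform w t m).2 n = shift_nform w t (m + n).
Proof.
elim: w t m n => [|[e s] w IH] t m n /=; first by rewrite addrA.
have E : s%:Z + (m + n) = ((s%:Z + m) %/ digit_bound e)%Z * digit_bound e +
          (((s%:Z + m) %% digit_bound e)%Z + n).
  by rewrite (addrA s%:Z) {1}(divz_eq (s%:Z + m) (digit_bound e)) -addrA.
rewrite IH mod_digit -mulrDr E divzMDl ?digit_boundZ_neq0//.
by rewrite modzMDl.
Qed.

Lemma shift_nform0 w t : reduced w -> shift_nform w t 0 = (w, t).
Proof.
elim: w => [|[e s] w IH] /=; first by rewrite addr0.
move=> /and3P[sD rw _]; rewrite addr0 divz_nat modz_nat divn_small// modn_small//.
by rewrite mulr0 IH.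
Qed.

Lemma reduced_shift w t m : reduced w -> reduced (shift_nform w t m).1.
Proof.
elim: w m => [|[e s] w IH] m //= /and3P[sD rw h]; apply/and3P; split.
- by rewrite -ltz_nat mod_digit ltz_pmod// ltz_nat digit_bound_gt0.
- exact: IH.
case: w rw h {IH} => [|[e' s'] w] //= /and3P[s'D _ _].
have [eE|//] := eqVneq e' (~~ e); rewrite eE /= in s'D * => s'0.
by rewrite addrC mulrC modzMDl modz_nat modn_small.
Qed.

Lemma reduced_stable e w : reduced w -> reduced (stable_nform e w).
Proof.
case: w => [|[e' s] w] rw; first by rewrite /= digit_bound_gt0.
have [->|sE] := eqVneq (stable_nform e ((e', s) :: w)) w; first by case/and3P: rw.
have -> : stable_nform e ((e', s) :: w) = (e, 0%N) :: (e', s) :: w.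
  by case: s rw sE => //= rw; case: ifP => // _; rewrite eqxx.
apply/and3P; split=> //; first exact: digit_bound_gt0.
by case: s rw sE => [|s] rw; rewrite /= ?andbF//; case: ifP; rewrite ?eqxx.
Qed.

Lemma stable_nformK e w : reduced w -> stable_nform (~~ e) (stable_nform e w) = w.
Proof.
case: w => [|[e' [|s]] w] /=; rewrite ?negbK ?eqxx//.
case: eqVneq => [->|_] /=; last by rewrite negbK eqxx.
case: w => [|[e2 [|s2]] w] //= /and3P[_ _].
by rewrite eqxx andbT !negbK => /negbTE ->.
Qed.

(** The defining relation on normal forms. Behind a new letter [a], adding d to its digit 0 carries
    exactly c. If [a] cancels a leading a^-1 instead, adding c to the digit 0 of that letter has
    carried exactly d. *)
Lemma stable_shift w t : reduced w ->
  (stable_nform true (shift_nform w t c).1, (shift_nform w t c).2) =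
  shift_nform (stable_nform true w) t d.
Proof.
have gen w' : shift_nform ((true, 0%N) :: w') t d =
    ((true, 0%N) :: (shift_nform w' t c).1, (shift_nform w' t c).2).
  by rewrite /= add0r divzz modzz/= eqz_nat -lt0n hd mulr1.
case: w => [|[[] s] w] rw.
- by rewrite gen.
- rewrite [stable_nform _ (_ :: _)](_ : _ = (true, 0%N) :: (true, s) :: w); last by case: s rw.
  by rewrite gen /=; case: (absz _).
case: s rw => [|s] rw.
  rewrite /= add0r divzz modzz/= eqz_nat -lt0n hc mulr1.
  by case: shift_nform.
rewrite [stable_nform _ (_ :: _)]/= gen /=; move: rw => /= /and3P[sD _ _].
by rewrite modzDr modz_nat modn_small.
Qed.

Lemma reduced_letter x f : reduced f.1 -> reduced (letter_act x f).1.
Proof.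
by rewrite /letter_act; case: ifP => _ rf; [exact: reduced_stable|exact: reduced_shift].
Qed.

Lemma reduced_word u f : reduced f.1 -> reduced (word_act u f).1.
Proof. by move=> rf; elim: u => //= x u IH; exact: reduced_letter. Qed.

Lemma word_act_cat u v f : word_act (u ++ v) f = word_act u (word_act v f).
Proof. exact: foldr_cat. Qed.

Lemma word_act_powb n f : reduced f.1 ->
  word_act (nseq n (false, false)) f = shift_nform f.1 f.2 n.
Proof.
move=> rf; elim: n => [|n IH] /=; first by rewrite shift_nform0//; case: f {rf}.
by rewrite IH /letter_act /= shift_nformD -addn1 PoszD.
Qed.

(** The group acts on reduced normal forms, so distinct normal forms are separated by their action
    on the trivial one. This replaces Britton's lemma. *)
Lemma word_act_eq u v f : word_eq (@BS_rel c d) u v -> reduced f.1 ->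
  word_act u f = word_act v f.
Proof.
move=> uv; elim: uv f => {u v} [u v [-> ->]|x e|//|u v _ IH|v u w _ IH1 _ IH2|
  u u' v v' _ IH1 _ IH2] f rf.
- rewrite -cats1 word_act_cat -cat1s word_act_cat !word_act_powb//; last exact: reduced_letter.
  by rewrite /= /letter_act /= stable_shift.
- rewrite /= /letter_act /=; case: x => /=.
    by rewrite negbK stable_nformK//; case: f rf.
  rewrite shift_nformD (_ : _ + _ = 0) ?shift_nform0//; last by case: e.
  by case: f rf.
- by rewrite IH.
- by rewrite IH1// IH2.
- by rewrite !word_act_cat IH2// IH1//; exact: reduced_word.
Qed.

Definition gact (g : G) (f : nform) : nform := word_act (repr g) f.

Lemma gact_class u f : reduced f.1 -> gact (word_class _ u) f = word_act u f.
Proof. by move=> rf; apply: word_act_eq => //; exact: repr_word_class. Qed.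

Lemma gactM (g h : G) f : reduced f.1 -> gact (g * h)%g f = gact g (gact h f).
Proof. by move=> rf; rewrite [LHS]gact_class// word_act_cat. Qed.

Lemma gact_b f : reduced f.1 -> gact b f = shift_nform f.1 f.2 1.
Proof. by move=> rf; rewrite gact_class. Qed.

Lemma gact_a f : reduced f.1 -> gact a f = (stable_nform true f.1, f.2).
Proof. by move=> rf; rewrite gact_class. Qed.

Lemma gact_powb n f : reduced f.1 -> gact (b ^+ n)%g f = shift_nform f.1 f.2 n.
Proof.
move=> rf; elim: n => [|n IH].
  by rewrite expg0 [LHS]gact_class//= shift_nform0//; case: f rf.
rewrite expgS gactM// IH gact_b; last exact: reduced_shift.
by rewrite shift_nformD -addn1 PoszD.
Qed.

(** * Normal forms and carries in the positive monoid *)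

Fixpoint stem (l : seq nat) : G := if l is s :: l' then (b ^+ s * a * stem l')%g else 1%g.

Definition nval (l : seq nat) (j : nat) : G := (stem l * b ^+ j)%g.

Definition digits (l : seq nat) := all (fun s => s < d)%N l.

Lemma gact_nval l j : digits l -> gact (nval l j) ([::], 0) = ([seq (true, s) | s <- l], Posz j).
Proof.
rewrite /nval; elim: l => [_|s l IH] /=.
  by rewrite mul1g gact_powb//= add0r.
move=> /andP[sd dl]; rewrite -!mulgA gactM// gactM// IH//.
have rl : reduced [seq (true, s) | s <- l].
  elim: {IH} l dl => //= x l IH /andP[xd dl]; rewrite xd IH//=.
  by case: l {IH dl}.
have rl0 : reduced ((true, 0%N) :: [seq (true, s) | s <- l]).
  by rewrite /= rl hd; case: l {IH dl rl}.
rewrite gact_a//= (_ : stable_nform _ _ = (true, 0%N) :: [seq (true, s0) | s0 <- l]).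
  by rewrite gact_powb//= add0r divz_nat modz_nat divn_small// modn_small// mulr0 shift_nform0.
by case: l {IH dl rl rl0} => [|[|x] l].
Qed.

Lemma nval_inj l l' j j' : digits l -> digits l' -> nval l j = nval l' j' -> l = l' /\ j = j'.
Proof.
move=> dl dl' /(congr1 (gact^~ ([::], 0))); rewrite !gact_nval// => -[e ->].
by split=> //; apply: inj_map e => x y [].
Qed.

Lemma BS_rel_ab : (a * b ^+ c = b ^+ d * a)%g.
Proof. exact: BS_relation. Qed.

Local Notation P := (BS_pos c d).

Lemma BS_pos1 : P 1%g. Proof. by move=> M [[M1 _] _]; exact: M1. Qed.

Lemma BS_posM x y : P x -> P y -> P (x * y)%g.
Proof.
by move=> Px Py M HM; case: (HM) => [[_ MM] _]; apply: MM; [exact: Px|exact: Py].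
Qed.

Lemma BS_pos_a : P a. Proof. by move=> M [_ gM]; apply: gM; left. Qed.

Lemma BS_pos_b : P b. Proof. by move=> M [_ gM]; apply: gM; right. Qed.

Lemma BS_posX x n : P x -> P (x ^+ n)%g.
Proof.
by move=> Px; elim: n => [|n IH]; rewrite ?expg0 ?expgS; [exact: BS_pos1|exact: BS_posM].
Qed.

Lemma BS_pos_bX n : P (b ^+ n)%g. Proof. by apply: BS_posX; exact: BS_pos_b. Qed.

Lemma BS_pos_stem l : P (stem l).
Proof.
elim: l => [|s l IH]; first exact: BS_pos1.
by apply: BS_posM; [apply: BS_posM; [exact: BS_pos_bX|exact: BS_pos_a]|exact: IH].
Qed.

Lemma BS_pos_nval l j : P (nval l j).
Proof. by apply: BS_posM; [exact: BS_pos_stem|exact: BS_pos_bX]. Qed.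

Lemma BS_pos_ind (Q : G -> Prop) : Q 1%g -> Q a -> Q b ->
  (forall x y, P x -> P y -> Q x -> Q y -> Q (x * y)%g) -> forall x, P x -> Q x.
Proof.
move=> Q1 Qa Qb QM x Px; suff [] : P x /\ Q x by [].
apply: (Px (fun y => P y /\ Q y)); split.
  split; first by split=> //; exact: BS_pos1.
  by move=> y z [Py Qy] [Pz Qz]; split; [exact: BS_posM|exact: QM].
by move=> y [->|->]; split=> //; [exact: BS_pos_a|exact: BS_pos_b].
Qed.


(** Counting with carry: only a full leading digit releases anything, namely c further factors [b]
    for the next level. After n levels each initial factor has become at most c^n. *)
Lemma stem_incrn n l : digits l -> size l = n -> forall m, exists l' t,
  [/\ digits l', size l' = n, (t <= m * c ^ n)%N & (b ^+ m * stem l = stem l' * b ^+ t)%g].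
Proof.
elim: n l => [|n IH] l.
  move=> _ /size0nil -> m; exists [::], m.
  by rewrite /= mul1g mulg1 expn0 muln1.
move=> dl sl m; elim: m => [|m [l1 [t1 [d1 s1 h1 e1]]]].
  by exists l, 0%N; rewrite !expg0 mul1g mulg1.
case: l1 d1 s1 e1 => // s l1 /= /andP[sd dl1] [s1] e1.
have [sd'|sd'] := ltnP s.+1 d.
  exists (s.+1 :: l1), t1; rewrite /= sd' dl1 s1; split=> //.
    by rewrite (leq_trans h1)// leq_mul2r leqnSn orbT.
  by rewrite expgS -mulgA e1 !mulgA -expgS.
have sE : s.+1 = d by apply/eqP; rewrite eqn_leq sd sd'.
(* The leading digit overflows: b^d a = a b^c resets it to 0 and sends b^c into the rest. *)
have [l2 [t2 [d2 s2 h2 e2]]] := IH l1 dl1 s1 c.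
exists (0%N :: l2), (t2 + t1)%N; rewrite /= hd d2 s2; split=> //.
  by rewrite mulSn expnS leq_add// -expnS.
rewrite expgS -mulgA e1 expg0 mul1g !mulgA -expgS sE -BS_rel_ab.
by rewrite -[(a * _ * stem _)%g]mulgA e2 mulgA expgnDr !mulgA.
Qed.

Lemma nval_incr l j : digits l -> exists l' t,
  [/\ digits l', size l' = size l, (t <= c ^ size l)%N & (b * nval l j = nval l' (t + j))%g].
Proof.
move=> dl; have [l' [t [dl' sl' tl e]]] := stem_incrn dl erefl 1.
exists l', t; split=> //; first by rewrite mul1n in tl.
by rewrite /nval mulgA -[b]expg1 e expgnDr mulgA.
Qed.

Lemma BS_pos_nvalE x : P x -> exists l j, digits l /\ x = nval l j.
Proof.
move=> Px; apply: (BS_pos_ind (Q := fun x => exists l j, digits l /\ x = nval l j)) x Px.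
- by exists [::], 0%N; rewrite /nval /= mul1g expg0.
- by exists [:: 0%N], 0%N; rewrite /nval /= hd !expg0 mul1g !mulg1.
- by exists [::], 1%N; rewrite /nval /= mul1g expg1.
move=> _ _ _ _ [l [j [dl ->]]] [m [k [dm ->]]].
have [m' [t [dm' _ _ e]]] := stem_incrn dm erefl j.
exists (l ++ m'), (t + k)%N; split; first by rewrite /digits all_cat; apply/andP.
have stem_cat : stem (l ++ m') = (stem l * stem m')%g.
  by elim: {dl} l => [|s l IH] /=; rewrite ?mul1g// IH !mulgA.
by rewrite /nval stem_cat -mulgA [(b ^+ j * _)%g]mulgA e expgnDr !mulgA.
Qed.

Lemma nval_cons s l j : nval (s :: l) j = (b ^+ s * a * nval l j)%g.
Proof. by rewrite /nval /= !mulgA. Qed.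

Lemma no_ub_a_bsa s : (0 < s < d)%N -> ~ exists z, common_ub P a (b ^+ s * a)%g z.
Proof.
move=> /andP[s0 sd] [z [Pz /BS_pos_nvalE[l [j [dl ej]]] /BS_pos_nvalE[m [k [dm ek]]]]].
have : nval (0%N :: l) j = nval (s :: m) k.
  by rewrite !nval_cons -ej -ek expg0 mul1g !mulVKg.
have dl0 : digits (0%N :: l) by rewrite /= hd.
have dm0 : digits (s :: m) by rewrite /= sd.
by move=> /(nval_inj dl0 dm0)[[s0' _] _]; rewrite -s0' in s0.
Qed.

(** The upper bound is a b^c = b^d a. This pair, together with the incompatible pairs of
    [no_ub_a_bsa], yields the relations that move [star (i a)] past positive elements. *)
Lemma join_a_b : is_join P a b (a * b ^+ c)%g.
Proof.
split.
  split; first by apply: BS_posM; [exact: BS_pos_a|exact: BS_pos_bX].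
    by rewrite /ple mulKg; exact: BS_pos_bX.
  have e : (b ^+ d = b * b ^+ d.-1)%g by rewrite -expgS prednK.
  by rewrite /ple BS_rel_ab e -mulgA mulKg; apply: BS_posM; [exact: BS_pos_bX|exact: BS_pos_a].
move=> w [Pw /BS_pos_nvalE[l [j [dl ej]]] /BS_pos_nvalE[m [k [dm ek]]]].
have wE : w = nval (0%N :: l) j by rewrite nval_cons -ej expg0 mul1g mulVKg.
have wE' : w = (b * nval m k)%g by rewrite -ek mulVKg.
have dl0 : digits (0%N :: l) by rewrite /= hd.
(* Compares the normal forms of w read from [a] and from [b]: the first has leading digit 0, so in
   the second the factor [b] must have overflowed the leading digit. *)
case: m dm ek wE' => [|s m] dm ek wE'.
  have : nval (0%N :: l) j = nval [::] k.+1.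
    by rewrite -wE wE' /nval /= !mul1g expgS.
  by case/(nval_inj dl0 dm).
move: dm => /andP[sd dm]; rewrite nval_cons !mulgA -expgS in wE'.
have [sd'|sd'] := ltnP s.+1 d.
  have : nval (0%N :: l) j = nval (s.+1 :: m) k by rewrite -wE wE'.
  have dm0 : digits (s.+1 :: m) by rewrite /= sd'.
  by case/(nval_inj dl0 dm0).
have sE : s.+1 = d by apply/eqP; rewrite eqn_leq sd sd'.
rewrite sE -BS_rel_ab in wE'.
have -> : w = (a * b ^+ c * nval m k)%g by rewrite wE' /nval !mulgA.
by rewrite /ple mulKg; exact: BS_pos_nval.
Qed.

End NormalForm.

(** * Closed subspaces *)

Section ClosedSubspaces.
Variables (R : realType) (A : cstarAlgType R).
Implicit Types (W X : set A) (u v : A).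

(* [s] is the identity or the conjugation of scalars. *)
Definition bounded_semilinear (s : R[i] -> R[i]) (f : A -> A) :=
  (forall k u v, f (k *: u + v) = s k *: f u + f v) /\
  exists C : R, forall u, cnorm (f u) <= C * cnorm u.

Lemma bounded_semilinear0 s f : bounded_semilinear s f -> f 0 = 0.
Proof.
case=> _ [C fC]; apply: cnorm_eq0; apply/eqP; rewrite eq_le cnorm_ge0 andbT.
by have := fC 0; rewrite cnorm0 mulr0.
Qed.

Lemma bounded_semilinearD s f u v : bounded_semilinear s f -> s 1 = 1 -> f (u + v) = f u + f v.
Proof. by case=> fl _ s1; rewrite -{1}(scale1r u) fl s1 scale1r. Qed.

Lemma closed_subspace_preim s f W : s 1 = 1 -> bounded_semilinear s f -> closed_subspace W ->
  closed_subspace [set u | W (f u)]%classic.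
Proof.
move=> s1 fb [cW W0 lW]; split.
- move=> u hu; apply: cW => e e0; have [_ [C fC]] := fb.
  have C0 : 0 < `|C| + 1 by rewrite ltr_pwDr.
  have [v Wv uv] := hu (e / (`|C| + 1)) (divr_gt0 e0 C0).
  exists (f v) => //.
  have -> : f u - f v = f (u - v).
    by apply/eqP; rewrite subr_eq -(bounded_semilinearD _ _ fb)// subrK.
  apply: le_lt_trans (fC _) _; rewrite ltr_pdivlMr// in uv; rewrite mulrC.
  apply: le_lt_trans uv; rewrite ler_wpM2l ?cnorm_ge0//.
  by rewrite (le_trans (ler_norm C))// lerDl.
- by rewrite /= (bounded_semilinear0 fb).
- by move=> k u v /= Wu Wv; case: fb => -> _; exact: lW.
Qed.

Lemma closed_subspace_0 : closed_subspace (fun u : A => u = 0).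
Proof.
split=> //.
- move=> u hu; apply: cnorm_small => e e0; have [v -> /ltW] := hu e e0.
  by rewrite subr0.
- by move=> k u v -> ->; rewrite scaler0 addr0.
Qed.

(** Extends an identity between bounded maps from homogeneous elements to the whole algebra. *)
Lemma closed_subspace_eq s f g : s 1 = 1 -> bounded_semilinear s f -> bounded_semilinear s g ->
  closed_subspace [set u | f u = g u]%classic.
Proof.
move=> s1 fb gb.
have fgb : bounded_semilinear s (fun u => f u - g u).
  case: fb gb => fl [C fC] [gl [C' gC]]; split.
    by move=> k u v; rewrite fl gl scalerBr; ncring.
  exists (C + C') => u; apply: le_trans (cnormB _ _) _.
  by rewrite mulrDl lerD.
have := closed_subspace_preim s1 fgb closed_subspace_0.
congr closed_subspace; apply/seteqP; split=> u /=.
  by move=> /eqP; rewrite subr_eq0 => /eqP.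
by move=> ->; rewrite subrr.
Qed.

Lemma closed_spanP X : closed_subspace (closed_span X).
Proof.
split.
- move=> u hu W [cW XW]; have [cl _ _] := cW; apply: cl => e e0.
  by have [v Xv uv] := hu e e0; exists v => //; exact: Xv.
- by move=> W [[_ W0 _] _].
- move=> k u v Xu Xv W HW; case: (HW) => [[_ _ lW] _].
  by apply: lW; [exact: Xu|exact: Xv].
Qed.

Lemma sub_closed_span X u : X u -> closed_span X u.
Proof. by move=> Xu W [_]; exact. Qed.

Lemma closed_span_ind X W u : closed_subspace W -> (forall v, X v -> W v) -> closed_span X u -> W u.
Proof. by move=> cW XW; apply; split. Qed.

Lemma bounded_semilinear_star : bounded_semilinear (Num.conj) (@star R A).
Proof.
split; first by move=> k u v; rewrite starD starZ.
by exists 1 => u; rewrite mul1r cnorm_star.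
Qed.

Lemma bounded_linear_mull x : bounded_semilinear id (fun u : A => x * u).
Proof.
split; first by move=> k u v; rewrite mulrDr -scalerAr.
by exists (cnorm x) => u; exact: cnormM.
Qed.

Lemma bounded_linear_mulr x : bounded_semilinear id (fun u : A => u * x).
Proof.
split; first by move=> k u v; rewrite mulrDl -scalerAl.
by exists (cnorm x) => u; rewrite mulrC; exact: cnormM.
Qed.

Lemma bounded_semilinear_comp s t f g : bounded_semilinear s f -> bounded_semilinear t g ->
  bounded_semilinear (s \o t) (f \o g).
Proof.
move=> [fl [C fC]] [gl [C' gC]]; split; first by move=> k u v /=; rewrite gl fl.
exists (`|C| * C') => u /=; apply: le_trans (fC _) _; rewrite -mulrA.
apply: le_trans (ler_wpM2r (cnorm_ge0 _) (ler_norm C)) _.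
by rewrite ler_wpM2l.
Qed.

End ClosedSubspaces.

Section StarPowers.
Variables (R : realType) (A : cstarAlgType R).
Implicit Types (s u : A).

Lemma starX u n : star (u ^+ n) = star u ^+ n.
Proof. by elim: n => [|n IH]; rewrite ?expr0 ?star1// exprS starM IH -exprSr. Qed.

Lemma isometry_expK s m n : isometry_elt s -> star s ^+ m * s ^+ (m + n) = s ^+ n.
Proof.
move=> ss; elim: m => [|m IH]; first by rewrite expr0 mul1r.
by rewrite addSn exprSr exprS -mulrA [star s * (_ * _)]mulrA ss mul1r.
Qed.

Lemma isometry_expKV s m n : isometry_elt s -> star s ^+ (m + n) * s ^+ m = star s ^+ n.
Proof.
by move=> ss; apply: (can_inj (@starK R A)); rewrite starM !starX starK isometry_expK.
Qed.

End StarPowers.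

(** * Multipliers and a criterion for amenability *)

Section Homogeneous.
Variables (R : realType) (G : groupType) (P : set G).
Variables (A : cstarAlgType R) (i : G -> A).
Hypotheses (P1 : P 1%g) (PM : forall x y, P x -> P y -> P (x * y)%g).
Hypothesis i_nica : nica_covariant P i.

Lemma i_isom x : P x -> star (i x) * i x = 1.
Proof. by case: i_nica => h _ _ _ _; exact: h. Qed.

Lemma i1 : i 1%g = 1.
Proof. by case: i_nica. Qed.

Lemma iM x y : P x -> P y -> i (x * y)%g = i x * i y.
Proof. by case: i_nica => _ _ h _ _ Px Py; rewrite h. Qed.

(** Single monomials instead of their span: the product of two monomials is again a monomial or 0.
    The value 0 does occur, for instance as [star (i a) * i (b^s a)] with 0 < s < d. *)
Definition hom (g : G) (u : A) :=
  u = 0 \/ exists x y, [/\ P x, P y, g = (x * y^-1)%g & u = i x * star (i y)].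

Lemma hom0 g : hom g 0. Proof. by left. Qed.

Lemma hom_i x : P x -> hom x (i x).
Proof.
move=> Px; right; exists x, 1%g; split=> //.
  by rewrite invg1 mulg1.
by rewrite i1 star1 mulr1.
Qed.

Lemma hom_star g u : hom g u -> hom g^-1%g (star u).
Proof.
move=> [->|[x [y [Px Py -> ->]]]]; first by rewrite star0; exact: hom0.
by right; exists y, x; split=> //; [rewrite invgM invgK|rewrite starM starK].
Qed.

Lemma hom_mull x g u : P x -> hom g u -> hom (x * g)%g (i x * u).
Proof.
move=> Px [->|[y [z [Py Pz -> ->]]]]; first by rewrite mulr0; exact: hom0.
by right; exists (x * y)%g, z; split=> //; [exact: PM|rewrite mulgA|rewrite iM ?mulrA].
Qed.

Lemma hom_mulr x g u : P x -> hom g u -> hom (g * x^-1)%g (u * star (i x)).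
Proof.
move=> Px /hom_star/(hom_mull Px)/hom_star.
by rewrite invgM invgK starM starK.
Qed.

(** Closure of monomials under left multiplication by adjoints. For the Baumslag-Solitar monoid it
    is derived further on from the Nica relations. *)
Hypothesis hom_star_mull : forall x g u,
  P x -> hom g u -> hom (x^-1 * g)%g (star (i x) * u).

Lemma hom_mul g h u v : hom g u -> hom h v -> hom (g * h)%g (u * v).
Proof.
move=> [->|[x [y [Px Py -> ->]]]] hv; first by rewrite mul0r; exact: hom0.
by rewrite -mulgA -mulrA; apply: hom_mull => //; exact: hom_star_mull.
Qed.

Hypothesis i_gen : cstar_generated (i @` P)%classic = [set: A]%classic.

(** The closed span of the homogeneous elements is a C*-subalgebra containing the generators, hence
    everything. *)
Lemma hom_span W : closed_subspace W -> (forall g u, hom g u -> W u) -> forall u, W u.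
Proof.
move=> cW hW u; pose H := [set u | exists g, hom g u]%classic.
have cH := closed_spanP H.
suff : closed_span H u by apply: closed_span_ind => // v [g]; exact: hW.
suff : cstar_subalg (closed_span H) /\ (i @` P `<=` closed_span H)%classic.
  move=> Hgen; have : (cstar_generated (i @` P)%classic) u by rewrite i_gen.
  by apply.
split; last first.
  by move=> _ [x Px <-]; apply: sub_closed_span; exists x; exact: hom_i.
split=> //.
- move=> v w Hv Hw.
  apply: (closed_span_ind (W := fun v => closed_span H (v * w))) Hv.
    exact: closed_subspace_preim (bounded_linear_mulr w) cH.
  move=> v' [g hg].
  apply: (closed_span_ind (W := fun w => closed_span H (v' * w))) Hw.
    exact: closed_subspace_preim (bounded_linear_mull v') cH.
  by move=> w' [g' hg']; apply: sub_closed_span; exists (g * g')%g; exact: hom_mul.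
- move=> v Hv.
  apply: (closed_span_ind (W := fun v => closed_span H (star v))) Hv.
    by apply: closed_subspace_preim (@bounded_semilinear_star _ A) cH; rewrite rmorph1.
  by move=> v' [g hg]; apply: sub_closed_span; exists g^-1%g; exact: hom_star.
Qed.

Lemma cle_star_mul (u : A) : cle (star u * u) (cnorm u ^+ 2 ** 1).
Proof.
by rewrite -cnorm_starM; apply: cle_scalar_cnorm; rewrite starM starK.
Qed.

Lemma cle_mul_star (u : A) : cle (u * star u) (cnorm u ^+ 2 ** 1).
Proof. by have := cle_star_mul (star u); rewrite starK cnorm_star. Qed.

Lemma cle_sqrD (u v : A) :
  cle ((u + v) * star (u + v)) (2 ** (u * star u) + 2 ** (v * star v)).
Proof.
have -> : 2 ** (u * star u) + 2 ** (v * star v) =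
    (u + v) * star (u + v) + (u - v) * star (u - v).
  by rewrite !rscale2 starB starD; ncring.
by rewrite /cle addrAC subrr add0r; exact: pos_Mstar.
Qed.

(** * The multiplicative domain and the kernel of [Phi] *)

Variable Phi : {linear A -> A}.
Hypothesis Phi_exp : is_expectation P i Phi.

Lemma Phi_hom1 u : hom 1%g u -> Phi u = u.
Proof.
case: Phi_exp => _ _ _ Phi1 _ [->|[x [y [Px Py e ->]]]]; first by rewrite linear0.
have -> : y = x by rewrite -[LHS]mul1g e mulgVK.
exact: Phi1.
Qed.

Lemma Phi_hom0 g u : hom g u -> g <> 1%g -> Phi u = 0.
Proof.
case: Phi_exp => _ _ _ _ Phi0 [->|[x [y [Px Py -> ->]]]] ne; first by rewrite linear0.
by apply: Phi0 => // xy; apply: ne; rewrite xy mulgV.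
Qed.

Lemma Phi_bounded : bounded_semilinear id Phi.
Proof.
case: Phi_exp => _ _ nPhi _ _; split; first by move=> k u v; rewrite linearP.
by exists 1 => u; rewrite mul1r.
Qed.

Lemma Phi_star u : star (Phi u) = Phi (star u).
Proof.
apply: (hom_span (W := fun u => star (Phi u) = Phi (star u))).
  apply: (@closed_subspace_eq _ _ Num.conj); first by rewrite rmorph1.
    exact: bounded_semilinear_comp (bounded_semilinear_star A) Phi_bounded.
  exact: bounded_semilinear_comp Phi_bounded (bounded_semilinear_star A).
move=> g v hv; have hs := hom_star hv.
have [g1|g1] := eqVneq g 1%g.
  by rewrite g1 in hv hs; rewrite invg1 in hs; rewrite !Phi_hom1.
rewrite (Phi_hom0 hv); last exact/eqP.
by rewrite (Phi_hom0 hs) ?star0// => /eqP; rewrite invg_eq1; exact/negP.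
Qed.

Definition Phi_dom : set A :=
  [set e | forall u, Phi (e * u) = e * Phi u /\ Phi (u * e) = Phi u * e]%classic.

Lemma Phi_dom_subalg : cstar_subalg Phi_dom.
Proof.
split.
- split.
  + move=> e he u.
    have cl (f : A -> A) : (forall v w, f (v - w) = f v - f w) ->
        (exists C : R, forall v, cnorm (f v) <= C * cnorm v) ->
        (forall v, Phi_dom v -> f v = 0) -> f e = 0.
      move=> fB [C fC] f0; apply: cnorm_small => r r0.
      have C0 : 0 < `|C| + 1 by rewrite ltr_pwDr.
      have [v Dv ev] := he (r / (`|C| + 1)) (divr_gt0 r0 C0).
      have -> : f e = f (e - v) by rewrite fB (f0 _ Dv) subr0.
      apply: le_trans (fC _) _; rewrite ltr_pdivlMr// in ev; rewrite mulrC.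
      apply: le_trans (ltW ev); rewrite ler_wpM2l ?cnorm_ge0//.
      by rewrite (le_trans (ler_norm C))// lerDl.
    case: Phi_exp => _ _ nPhi _ _; split; apply/eqP; rewrite -subr_eq0; apply/eqP.
      apply: (cl (fun e => Phi (e * u) - e * Phi u)).
      * by move=> v w; rewrite !mulrBl linearB/=; ncring.
      * exists (cnorm u + cnorm u) => v; apply: le_trans (cnormB _ _) _.
        rewrite mulrDl; apply: lerD.
          by apply: le_trans (nPhi _) _; rewrite mulrC; exact: cnormM.
        apply: le_trans (cnormM _ _) _; rewrite mulrC ler_wpM2r ?cnorm_ge0//.
      * by move=> v /(_ u)[-> _]; rewrite subrr.
    apply: (cl (fun e => Phi (u * e) - Phi u * e)).
    * by move=> v w; rewrite !mulrBr linearB/=; ncring.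
    * exists (cnorm u + cnorm u) => v; apply: le_trans (cnormB _ _) _.
      rewrite mulrDl; apply: lerD; first by apply: le_trans (nPhi _) _; exact: cnormM.
      by apply: le_trans (cnormM _ _) _; rewrite ler_wpM2r ?cnorm_ge0.
    * by move=> v /(_ u)[_ ->]; rewrite subrr.
  + by move=> u; rewrite mul0r mulr0 linear0 mul0r mulr0.
  + move=> k e f he hf u; have [e1 e2] := he u; have [f1 f2] := hf u.
    rewrite mulrDl mulrDr -!scalerAl -!scalerAr !linearP/= e1 e2 f1 f2.
    by rewrite mulrDl mulrDr -!scalerAl -!scalerAr.
- move=> e f he hf u; split.
    by rewrite -mulrA (he _).1 (hf _).1 mulrA.
  by rewrite (mulrA u) (hf _).2 (he _).2 mulrA.
- move=> e he u; split.
    by rewrite -(starK u) -starM -Phi_star (he _).2 starM Phi_star.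
  by rewrite -(starK u) -starM -Phi_star (he _).1 starM Phi_star.
Qed.

Lemma Phi_dom1 : Phi_dom 1.
Proof. by move=> u; rewrite !mul1r !mulr1. Qed.

Lemma Phi_dom_hom1 e : hom 1%g e -> Phi_dom e.
Proof.
move=> he u; split.
  apply: (hom_span (W := fun u => Phi (e * u) = e * Phi u)).
    apply: (@closed_subspace_eq _ _ id) => //.
      exact: bounded_semilinear_comp Phi_bounded (bounded_linear_mull e).
    exact: bounded_semilinear_comp (bounded_linear_mull e) Phi_bounded.
  move=> g v hv; have := hom_mul he hv; rewrite mul1g => hev.
  have [g1|/eqP g1] := eqVneq g 1%g; first by rewrite g1 in hv hev; rewrite !Phi_hom1.
  by rewrite (Phi_hom0 hv)// (Phi_hom0 hev)// mulr0.
apply: (hom_span (W := fun u => Phi (u * e) = Phi u * e)).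
  apply: (@closed_subspace_eq _ _ id) => //.
    exact: bounded_semilinear_comp Phi_bounded (bounded_linear_mulr e).
  exact: bounded_semilinear_comp (bounded_linear_mulr e) Phi_bounded.
move=> g v hv; have := hom_mul hv he; rewrite mulg1 => hev.
have [g1|/eqP g1] := eqVneq g 1%g; first by rewrite g1 in hv hev; rewrite !Phi_hom1.
by rewrite (Phi_hom0 hv)// (Phi_hom0 hev)// mul0r.
Qed.

(** The range of [Phi] is spanned by elements of degree 1, over which [Phi] is a bimodule map. So
    the matrix entries of the multiplier lie in the multiplicative domain. *)
Lemma Phi_dom_Phi u : Phi_dom (Phi u).
Proof.
case: Phi_exp => cl _ _ _ _; have [cD _ _] := Phi_dom_subalg.
apply: closed_span_ind (cl u) => // _ [x Px <-]; apply: Phi_dom_hom1.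
by right; exists x, x; split=> //; rewrite mulgV.
Qed.

(** Conjugation by [i y] takes degree g to y^-1 g y, which is trivial exactly when g is. *)
Lemma Phi_conj y u : P y -> Phi (star (i y) * u * i y) = star (i y) * Phi u * i y.
Proof.
move=> Py.
have b := bounded_semilinear_comp (bounded_linear_mulr (i y)) (bounded_linear_mull (star (i y))).
apply: (hom_span (W := fun u => Phi (star (i y) * u * i y) = star (i y) * Phi u * i y)).
  apply: (@closed_subspace_eq _ _ id) => //.
    exact: bounded_semilinear_comp Phi_bounded b.
  exact: bounded_semilinear_comp b Phi_bounded.
move=> g v hv.
have := hom_mul (hom_star_mull Py hv) (hom_i Py) => hyv.
have [g1|/eqP g1] := eqVneq g 1%g.
  by rewrite g1 mulg1 mulVg in hyv; rewrite g1 in hv; rewrite !Phi_hom1.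
rewrite (Phi_hom0 hv)// (Phi_hom0 hyv) ?mulr0 ?mul0r// => e; apply: g1.
by apply: (mulgI y^-1%g); apply: (mulIg y); rewrite e mulg1 mulVg.
Qed.

Lemma Phi_pos u : pos u -> pos (Phi u).
Proof. by case: Phi_exp => _ h _ _ _ /pos_positive_elt/h/pos_positive_elt. Qed.

(* [Phi ((u + t w)* (u + t w))] is positive for all scalars [t], and affine in
   [t] and its conjugate. *)
Lemma Phi_kernel u w : Phi (star w * w) = 0 -> Phi (star u * w) = 0.
Proof.
move=> ww; set X := Phi (star u * w).
have Y : Phi (star w * u) = star X by rewrite /X Phi_star starM starK.
have key (k : R[i]) : k *: X + Num.conj k *: star X = 0.
  have up (t : R) : pos (Phi (star u * u) + t ** (k *: X + Num.conj k *: star X)).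
    have := Phi_pos (pos_starM (u + (t%:C * k) *: w)).
    rewrite starD starZ mulrDl !mulrDr -!scalerAl -!scalerAr !linearD !linearZ /= ww Y.
    rewrite !scaler0 addr0 rmorphM /= [Num.conj _]conjc_real -/X !scalerA.
    by rewrite (mulrC k) (mulrC (Num.conj k)) addrA.
  (* For t = r / e with r at least the norm of N, dividing N + t Z by t leaves a constant term of at
     most e. *)
  have lim (Z : A) : (forall t : R, 0 < t -> pos (Phi (star u * u) + t ** Z)) -> pos Z.
    move=> ht; set N := Phi (star u * u) in ht.
    have Np : pos N by apply: Phi_pos; exact: pos_starM.
    apply: pos_eps => e e0; set r := cnorm N + 1.
    have r0 : 0 < r by rewrite ltr_wpDl ?cnorm_ge0.
    have /(posZ (ltW (divr_gt0 e0 r0))) := ht (r / e) (divr_gt0 r0 e0).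
    rewrite scalerDr rscaleA (_ : e / r * (r / e) = 1); last first.
      by rewrite mulrA divfK ?gt_eqF// divff ?gt_eqF.
    rewrite rscale1 => p1.
    have -> : Z + e ** 1 = (e / r) ** N + Z + (e / r) ** (r ** 1 - N).
      by rewrite scalerBr rscaleA divfK ?gt_eqF//; ncring.
    apply: posD => //; apply: posZ; first exact/ltW/divr_gt0.
    have -> : r ** 1 - N = (cnorm N ** 1 - N) + 1.
      by rewrite /r rscaleDl rscale1; ncring.
    by apply: posD; [exact/pos_cnormB/pos_star|exact: pos1].
  apply: pos_antisym; apply: lim => t t0; first exact: up.
  by rewrite scalerN -rscaleNl; exact: up.
(* The scalars 1 and i give X + star X = 0 and X - star X = 0. *)
have k1 := key 1; rewrite rmorph1 !scale1r in k1.
have ki := key 'i.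
have ci : Num.conj ('i : R[i]) = - 'i by apply/eqP; rewrite eq_complex /= oppr0 !eqxx.
rewrite ci scaleNr -scalerBr in ki.
have {}ki : X - star X = 0.
  have := congr1 ( *:%R 'i) ki; rewrite scalerA mulii scaler0 scaleN1r => /eqP.
  by rewrite oppr_eq0 => /eqP.
have : X + X = 0.
  by rewrite -[RHS](addr0 0) -{1}k1 -{1}ki; ncring.
rewrite -rscale2 => h2; have := congr1 ( *:%R 2^-1%:C) h2.
by rewrite scaler0 rscaleA mulVf ?pnatr_eq0// rscale1.
Qed.

(** * The multiplier of a finite family of weights *)

Section Multiplier.
Variables (F : seq G) (kap : G -> A).
Hypotheses (uF : uniq F) (FP : forall x, x \in F -> P x).
Hypotheses (kap_star : forall y, star (kap y) = kap y).
Hypothesis kap0 : forall y, y \notin F -> kap y = 0.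

Definition wt (y : G) : A := i y * kap y * star (i y).

Definition multiplier (r : A) : A :=
  qform F (fun x y => Phi (star (i x) * r * i y)) (fun y => kap y * star (i y)).

Lemma star_wt y : star (wt y) = wt y.
Proof. by rewrite /wt !starM starK kap_star mulrA. Qed.

Lemma wt0 y : y \notin F -> wt y = 0.
Proof. by move=> /kap0 e; rewrite /wt e mulr0 mul0r. Qed.

Lemma multiplier_bounded : bounded_semilinear id multiplier.
Proof.
have lin k u v : multiplier (k *: u + v) = k *: multiplier u + multiplier v.
  rewrite /multiplier /qform scaler_sumr -big_split; apply: eq_bigr => x _ /=.
  rewrite scaler_sumr -big_split; apply: eq_bigr => y _ /=.
  rewrite mulrDr mulrDl -scalerAr -scalerAl linearP /=.
  by rewrite mulrDr mulrDl -scalerAr -scalerAl.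
split=> //; rewrite /multiplier /qform.
pose C x y : R := cnorm (star (kap x * star (i x))) *
   (cnorm (star (i x)) * cnorm (i y)) * cnorm (kap y * star (i y)).
exists (\sum_(x <- F) \sum_(y <- F) C x y) => u.
apply: le_trans (cnorm_sum _ _ _) _; rewrite mulr_suml; apply: ler_sum => x _.
apply: le_trans (cnorm_sum _ _ _) _; rewrite mulr_suml; apply: ler_sum => y _.
case: Phi_exp => _ _ nPhi _ _.
apply: le_trans (cnormM _ _) _; rewrite /C mulrAC ler_wpM2r ?cnorm_ge0//.
apply: le_trans (cnormM _ _) _; rewrite -[leRHS]mulrA ler_wpM2l ?cnorm_ge0//.
apply: le_trans (nPhi _) _; apply: le_trans (cnormM _ _) _.
by rewrite [leRHS]mulrAC ler_wpM2r ?cnorm_ge0//; exact: cnormM.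
Qed.

(** On coefficients from the multiplicative domain, the coefficients can be moved inside [Phi], and
    the form becomes [Phi] of some [star v * v]. The actual coefficients [kap y * star (i y)] are
    then covered by [qform_pos]. *)
Lemma multiplier_pos r : pos r -> pos (multiplier r).
Proof.
move=> /pos_sqrt[u [/pos_star us <- _]].
apply: (qform_pos Phi_dom_subalg Phi_dom1 uF) => [x y|x y|e De].
- exact: Phi_dom_Phi.
- by rewrite Phi_star !starM starK us !mulrA.
have -> : qform F (fun x y => Phi (star (i x) * (u * u) * i y)) e =
    Phi (star (\sum_(x <- F) u * i x * e x) * (\sum_(x <- F) u * i x * e x)).
  rewrite star_sum mulr_sum2 linear_sum; apply: eq_bigr => x _.
  rewrite linear_sum; apply: eq_bigr => y _ /=.
  have -> : star (u * i x * e x) * (u * i y * e y) =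
      star (e x) * (star (i x) * (u * u) * i y) * e y.
    by rewrite !starM us; ncring.
  have [_ _ sD] := Phi_dom_subalg.
  by rewrite (De y _).2 (sD _ (De x) _).1.
by apply: Phi_pos; exact: pos_starM.
Qed.

(** The entry at (x, y) has degree x^-1 g y, so [Phi] keeps it for x = g y and kills it
    otherwise. *)
Lemma multiplier_hom g r : hom g r ->
  multiplier r = \sum_(y <- F) wt (g * y)%g * r * wt y.
Proof.
move=> hr; rewrite /multiplier /qform exchange_big /=.
rewrite big_seq [RHS]big_seq; apply: eq_bigr => y yF.
have term x : x \in F -> star (kap x * star (i x)) * Phi (star (i x) * r * i y) *
    (kap y * star (i y)) = if x == (g * y)%g then wt x * r * wt y else 0.
  move=> xF; have hxy := hom_mul (hom_star_mull (FP xF) hr) (hom_i (FP yF)).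
  case: eqP => [xg|xg].
    rewrite Phi_hom1; last by rewrite xg -mulgA mulVg in hxy; rewrite xg.
    by rewrite starM starK kap_star /wt !mulrA.
  rewrite (Phi_hom0 hxy) ?mulr0 ?mul0r// => e; apply: xg.
  by apply: (mulgI x^-1%g); rewrite mulVg mulgA e.
have [gF|gF] := boolP ((g * y)%g \in F).
  rewrite (bigD1_seq (g * y)%g)//= term// eqxx big_seq_cond big1 ?addr0// => x.
  by move=> /andP[xF xg]; rewrite term// (negbTE xg).
rewrite wt0// !mul0r big_seq big1// => x xF; rewrite term//.
by case: eqP => // xg; rewrite -xg xF in gF.
Qed.

Lemma multiplier_le r : cle (\sum_(y <- F) wt y * wt y) 1 -> star r = r ->
  cnorm (multiplier r) <= cnorm r.
Proof.
have [ml _] := multiplier_bounded => e1 rs.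
have m1 : cle (multiplier 1) 1.
  have h1 : hom 1%g 1 by right; exists 1%g, 1%g; rewrite mulgV i1 star1 mulr1.
  rewrite (multiplier_hom h1); under eq_bigr do rewrite mul1g mulr1; exact: e1.
have mZ (t : R) u : multiplier (t ** u) = t ** multiplier u.
  by have := ml t%:C u 0; rewrite (bounded_semilinear0 multiplier_bounded) !addr0.
have mN u : multiplier (- u) = - multiplier u.
  by rewrite -[u]rscale1 -rscaleNl mZ rscaleNl !rscale1.
have mD u v : multiplier (u + v) = multiplier u + multiplier v.
  by rewrite -[u]scale1r ml !scale1r.
have half u : star u = u -> cnorm u = cnorm r -> pos (cnorm r ** 1 - multiplier u).
  move=> us ur; have := multiplier_pos (pos_cnormB us); rewrite mD mZ mN ur => h.
  have -> : cnorm r ** 1 - multiplier u =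
    cnorm r ** (1 - multiplier 1) + (cnorm r ** multiplier 1 - multiplier u).
    by rewrite scalerBr; ncring.
  by apply: posD => //; apply: posZ => //; exact: cnorm_ge0.
apply: cnorm_le_of_pos; [exact: cnorm_ge0|exact: half|].
by have := half (- r); rewrite mN opprK; apply; rewrite ?starN ?rs ?cnormN.
Qed.

(** Splits into real and imaginary parts. What matters is a bound independent of the family, so the
    crude factor 2 is harmless. *)
Lemma multiplier_le2 r : cle (\sum_(y <- F) wt y * wt y) 1 ->
  cnorm (multiplier r) <= 2 * cnorm r.
Proof.
move=> e1; have [p [q [ps qs rE]]] := re_imE r.
have [ml _] := multiplier_bounded.
have pr : cnorm p <= cnorm r.
  have -> : p = 2^-1 ** (r + star r).
    rewrite rE starD star_iscale ps qs.
    have -> : p + 'i *: q + (p - 'i *: q) = p + p by ncring.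
    by rewrite -rscale2 rscaleA mulVf ?pnatr_eq0// rscale1.
  rewrite cnorm_rscale gtr0_norm ?invr_gt0//.
  by have := cnormD r (star r); rewrite cnorm_star; lra.
have qr : cnorm q <= cnorm r.
  rewrite -cnorm_iscale; have -> : 'i *: q = 2^-1 ** (r - star r).
    rewrite rE starD star_iscale ps qs.
    have -> : p + 'i *: q - (p - 'i *: q) = 'i *: q + 'i *: q by ncring.
    by rewrite -rscale2 rscaleA mulVf ?pnatr_eq0// rscale1.
  rewrite cnorm_rscale gtr0_norm ?invr_gt0//.
  by have := cnormB r (star r); rewrite cnorm_star; lra.
have -> : multiplier r = 'i *: multiplier q + multiplier p by rewrite rE addrC ml.
apply: le_trans (cnormD _ _) _; rewrite cnorm_iscale.
have := multiplier_le e1 ps; have := multiplier_le e1 qs; lra.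
Qed.

(** By [Phi_conj] each [r * i y] again satisfies the hypothesis, and [Phi_kernel] then kills every
    matrix entry. *)
Lemma multiplier_ker r : Phi (star r * r) = 0 -> multiplier r = 0.
Proof.
move=> rr; rewrite /multiplier /qform big1_seq// => x /andP[_ xF].
rewrite big1_seq// => y /andP[_ yF].
have -> : Phi (star (i x) * r * i y) = 0; last by rewrite mulr0 mul0r.
rewrite -mulrA; apply: Phi_kernel.
have -> : star (r * i y) * (r * i y) = star (i y) * (star r * r) * i y.
  by rewrite starM; ncring.
by rewrite (Phi_conj _ (FP yF)) rr mulr0 mul0r.
Qed.

(** * Defects of a family of weights *)

Definition delta (r : A) (g : G) (y : G) : A := r * wt y - wt (g * y)%g * r.

(** All finite families of indices are allowed, not just the support [F]: the defect of a product
    involves translated indices, which leave [F]. *)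
Definition small_rows r g (e : R) := forall Y, uniq Y ->
  cle (\sum_(y <- Y) delta r g y * star (delta r g y)) (e ** 1).

Definition small_cols r g (e : R) := forall Y, uniq Y ->
  cle (\sum_(y <- Y) star (delta r g y) * delta r g y) (e ** 1).

Lemma sum_translate (D : G -> A) g (Y : seq G) :
  \sum_(y <- Y) D (g * y)%g = \sum_(y <- [seq (g * y)%g | y <- Y]) D y.
Proof. by rewrite big_map. Qed.

Lemma uniq_translate g (Y : seq G) : uniq Y -> uniq [seq (g * y)%g | y <- Y].
Proof. by move=> uY; rewrite map_inj_uniq//; exact: mulgI. Qed.

(** The reason for tracking columns as well: adjoints of the generators only inherit a row bound
    from a column bound. *)
Lemma small_rows_star r g e : small_cols r g e -> small_rows (star r) g^-1%g e.
Proof.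
move=> h Y uY; have := h _ (uniq_translate g^-1%g uY).
rewrite -sum_translate; congr (cle _ _); apply: eq_bigr => y _.
have -> : delta (star r) g^-1%g y = - star (delta r g (g^-1 * y)%g).
  by rewrite /delta mulVKg starB (starM r) (starM (wt y)) !star_wt opprB.
by rewrite starN starK mulrNN.
Qed.

(** The defect obeys a Leibniz rule, with its second term translated by h; the factor 2 comes from
    the parallelogram law. *)
Lemma small_rowsM r s g h e f : small_rows r g e -> small_rows s h f ->
  small_rows (r * s) (g * h)%g (2 * (cnorm r ^+ 2 * f + cnorm s ^+ 2 * e)).
Proof.
move=> re sf Y uY.
have dE y : delta (r * s) (g * h)%g y = r * delta s h y + delta r g (h * y)%g * s.
  by rewrite /delta mulgA; ncring.
apply: (cle_trans (y := \sum_(y <- Y)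
    (2 ** (r * (delta s h y * star (delta s h y)) * star r) +
     2 ** (cnorm s ^+ 2 ** (delta r g (h * y)%g * star (delta r g (h * y)%g)))))).
  apply: cle_sum => y _ _; rewrite dE; apply: cle_trans (cle_sqrD _ _) _.
  apply: cleD; first by rewrite starM !mulrA; exact: cle_refl.
  apply: cleZ => //; rewrite starM mulrA -(mulrA _ s).
  have := cle_conjV (delta r g (h * y)%g) (cle_mul_star s).
  by rewrite -scalerAr -scalerAl mulr1.
rewrite big_split /= -!scaler_sumr -mulr_suml -mulr_sumr.
rewrite (sum_translate (fun y => delta r g y * star (delta r g y))).
have -> : (2 * (cnorm r ^+ 2 * f + cnorm s ^+ 2 * e)) ** (1 : A) =
    2 ** ((f * cnorm r ^+ 2) ** 1) + 2 ** (cnorm s ^+ 2 ** (e ** 1)).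
  by rewrite !rscaleA -rscaleDl; congr (_%:C *: _); ring.
apply: cleD; apply: cleZ => //.
  apply: cle_trans (cle_conjV r (sf _ uY)) _.
  rewrite -scalerAr -scalerAl mulr1 -rscaleA.
  apply: cleZ; last exact: cle_mul_star.
  (* The empty family already forces f >= 0. *)
  have := sf [::] isT; rewrite big_nil /cle subr0 => p0.
  rewrite leNgt; apply/negP => f0.
  have p1 : pos (- (f ** 1 : A)).
    by rewrite -rscaleNl; apply: pos_scalar; rewrite oppr_ge0 ltW.
  have := congr1 (@cnorm R A) (pos_antisym p0 p1).
  by rewrite cnorm_scalar cnorm0 => /eqP; rewrite normr_eq0 lt_eqF.
by apply: cleZ; [exact: sqr_ge0|exact/re/uniq_translate].
Qed.

End Multiplier.

Definition approx_invariant (X : set G) (e : R) (F : seq G) (kap : G -> A) :=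
  [/\ uniq F, (forall x, x \in F -> P x), (forall y, star (kap y) = kap y),
      (forall y, y \notin F -> kap y = 0) &
  [/\ cle (\sum_(y <- F) wt kap y * wt kap y) 1,
      cle ((1 - e) ** 1) (\sum_(y <- F) wt kap y * wt kap y) &
      forall x, X x -> small_rows kap (i x) x e /\ small_cols kap (i x) x e]].

(** * Convergence of the multipliers along almost invariant families *)

Variable X : set G.
Hypothesis P_gen : forall Q : G -> Prop, Q 1%g -> (forall x, X x -> Q x) ->
  (forall x y, P x -> P y -> Q x -> Q y -> Q (x * y)%g) -> forall x, P x -> Q x.

(** Induction over products of generators and their adjoints. The point is that [B] depends on the
    element only, not on the tolerance or the family. *)
Lemma small_rows_hom g r : hom g r -> exists2 B : R, 0 <= B &
  forall e F kap, 0 <= e -> approx_invariant X e F kap -> small_rows kap r g (B * e).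
Proof.
pose good g r := exists2 B : R, 0 <= B &
  forall e F kap, 0 <= e -> approx_invariant X e F kap -> small_rows kap r g (B * e).
have goodM g' h u v : good g' u -> good h v -> good (g' * h)%g (u * v).
  move=> [B B0 hB] [C C0 hC].
  exists (2 * (cnorm u ^+ 2 * C + cnorm v ^+ 2 * B)).
    by rewrite mulr_ge0// addr_ge0// mulr_ge0// sqr_ge0.
  move=> e F kap e0 ai.
  have := small_rowsM (hB e F kap e0 ai) (hC e F kap e0 ai).
  by congr (small_rows _ _ _ _); ring.
have good1 : good 1%g 1.
  exists 0 => // e F kap e0 _ Y _; rewrite mul0r rscale0 big1; first exact: cle_refl.
  by move=> y _; rewrite /delta mul1g mul1r mulr1 subrr mul0r.
have goodi x : P x -> good x (i x) /\ good x^-1%g (star (i x)).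
  move: x; apply: P_gen => [|x Xx|x y Px Py [x1 x2] [y1 y2]].
  - by rewrite invg1 i1 star1.
  - split; exists 1 => // e F kap e0 [uF FP ks k0 [_ _ h]]; rewrite mul1r.
      by case: (h _ Xx).
    by apply: small_rows_star => //; case: (h _ Xx).
  - by rewrite invgM iM// starM; split; apply: goodM.
move=> [->|[x [y [Px Py -> ->]]]]; last first.
  by apply: goodM; [case: (goodi x Px)|case: (goodi y Py)].
exists 0 => // e F kap e0 _ Y _; rewrite mul0r rscale0 big1; first exact: cle_refl.
by move=> y _; rewrite /delta mul0r mulr0 subrr mul0r.
Qed.

(** The elements on which the multipliers converge to the identity form a closed subspace, by the
    uniform bound 2; so homogeneous elements suffice. *)
Lemma multiplier_approx r (eta : R) : 0 < eta -> exists2 e0 : R, 0 < e0 &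
  forall e F kap, 0 < e <= e0 -> approx_invariant X e F kap ->
    cnorm (multiplier F kap r - r) <= eta.
Proof.
pose W r := forall eta : R, 0 < eta -> exists2 e0 : R, 0 < e0 &
  forall e F kap, 0 < e <= e0 -> approx_invariant X e F kap ->
    cnorm (multiplier F kap r - r) <= eta.
move: eta; apply: (hom_span (W := W)) => {r}.
  split.
  - move=> u hu eta eta0.
    (* The error at u is at most 2 (eta/4) + eta/4 + eta/4. *)
    have eta4 : 0 < eta / 4 by rewrite divr_gt0.
    have [v Wv uv] := hu _ eta4; have [e0 e00 he0] := Wv _ eta4.
    exists e0 => // e F kap ee ai; have := he0 _ _ _ ee ai => h.
    case: (ai) => uF FP ks k0 [e1 _ _].
    have [ml _] := multiplier_bounded F kap.
    have mB : multiplier F kap u - multiplier F kap v = multiplier F kap (u - v).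
      apply/eqP; rewrite subr_eq -{1}(scale1r (multiplier F kap (u - v))).
      by rewrite -ml scale1r subrK.
    have := multiplier_le2 uF FP ks k0 (u - v) e1; rewrite -mB => h2.
    have -> : multiplier F kap u - u =
      (multiplier F kap u - multiplier F kap v) + (multiplier F kap v - v) - (u - v) by ncring.
    apply: le_trans (cnormB _ _) _; have := cnormD (multiplier F kap u - multiplier F kap v) (multiplier F kap v - v).
    by move: h h2 uv => h h2 uv h3; lra.
  - move=> eta eta0; exists 1 => // e F kap _ _.
    by rewrite (bounded_semilinear0 (multiplier_bounded F kap)) subrr cnorm0 ltW.
  - move=> k u v Wu Wv eta eta0.
    have eta2 : 0 < eta / 2 by rewrite divr_gt0.
    set K := complex.Re `|k| + 1.
    have K0 : 0 < K.
      rewrite ltr_wpDl//; have := cnorm_ge0 (k *: 1 : A).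
      by rewrite cnormZ cnorm1 mulr1.
    have [e1 e10 h1] := Wu (eta / 2 / K) (divr_gt0 eta2 K0).
    have [e2 e20 h2] := Wv (eta / 2) eta2.
    exists (Num.min e1 e2); first by rewrite lt_min e10.
    move=> e F kap /andP[ep]; rewrite le_min => /andP[ee1 ee2] ai.
    have {}h1 := h1 e F kap; rewrite ep ee1 in h1; have {}h1 := h1 isT ai.
    have {}h2 := h2 e F kap; rewrite ep ee2 in h2; have {}h2 := h2 isT ai.
    have [-> _] := multiplier_bounded F kap.
    have -> : k *: multiplier F kap u + multiplier F kap v - (k *: u + v) =
      k *: (multiplier F kap u - u) + (multiplier F kap v - v) by rewrite scalerBr; ncring.
    apply: le_trans (cnormD _ _) _; rewrite cnormZ.
    have : K * cnorm (multiplier F kap u - u) <= eta / 2.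
      by rewrite mulrC -ler_pdivlMr.
    have := cnorm_ge0 (multiplier F kap u - u).
    by rewrite /K mulrDl mul1r; move: h2 => *; lra.
move=> g r hr eta eta0; have [B B0 hB] := small_rows_hom hr.
(* [e1] bounds the part r (1 - E), and [e2] makes the Cauchy-Schwarz bound (B + 1) e at most
   (eta/2)^2. The added ones keep the denominators positive. *)
pose e1 := eta / (2 * (cnorm r + 1)); pose e2 := (eta / 2) ^+ 2 / (B + 1).
have r1 : 0 < cnorm r + 1 by rewrite ltr_wpDl ?cnorm_ge0.
have B1 : 0 < B + 1 by rewrite ltr_wpDl.
have e10 : 0 < e1 by rewrite divr_gt0// mulr_gt0.
have e20 : 0 < e2 by rewrite divr_gt0// exprn_gt0// divr_gt0.
exists (Num.min e1 e2); first by rewrite lt_min e10.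
move=> e F kap /andP[e0]; rewrite le_min => /andP[ee1 ee2] ai.
have rows := hB e F kap (ltW e0) ai.
case: (ai) => uF FP ks k0 [le1 le2 _].
set E := \sum_(y <- F) wt kap y * wt kap y in le1 le2.
have -> : multiplier F kap r - r =
    - (\sum_(y <- F) delta kap r g y * wt kap y) - r * (1 - E).
  rewrite (multiplier_hom uF FP ks k0 hr).
  have -> : \sum_(y <- F) delta kap r g y * wt kap y =
      r * E - \sum_(y <- F) wt kap (g * y)%g * r * wt kap y.
    by rewrite mulr_sumr -sumrB; apply: eq_bigr => y _; rewrite mulrBl mulrA.
  by ncring.
have n1 : cnorm (1 - E) <= e.
  apply: cle_cnorm; [exact: ltW|exact: le1|].
  rewrite /cle; have -> : e ** 1 - (1 - E) = E - (1 - e) ** 1.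
    by rewrite rscaleBl rscale1; ncring.
  exact: le2.
have n2 : cnorm (\sum_(y <- F) delta kap r g y * wt kap y) <= eta / 2.
  have Be : 0 < (B + 1) * e by rewrite mulr_gt0.
  have c1 : cle (\sum_(y <- F) delta kap r g y * star (delta kap r g y)) (((B + 1) * e) ** 1).
    by apply: cle_trans (rows F uF) _; apply: cle_scalar; rewrite ler_pM2r// lerDl.
  have c2 : cle (\sum_(y <- F) star (wt kap y) * wt kap y) (1 ** 1).
    by rewrite rscale1; under eq_bigr do rewrite star_wt//; exact: le1.
  have := cauchy_schwarz Be ler01 c1 c2; rewrite mulr1 => h.
  have eta2 : 0 <= eta / 2 by rewrite divr_ge0// ltW.
  rewrite -(@ler_pXn2r _ 2)// ?nnegrE ?cnorm_ge0//.
  by apply: le_trans h _; rewrite mulrC -ler_pdivlMr.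
apply: le_trans (cnormB _ _) _; rewrite cnormN.
have h3 : cnorm (r * (1 - E)) <= cnorm r * e1.
  apply: le_trans (cnormM _ _) _; apply: ler_wpM2l (le_trans n1 ee1); exact: cnorm_ge0.
have h4 : (cnorm r + 1) * e1 = eta / 2.
  by rewrite /e1; field; rewrite gt_eqF.
by move: h4; rewrite mulrDl mul1r => h4; lra.
Qed.

Theorem faithful_of_approx_invariant :
  (forall e : R, 0 < e -> exists F kap, approx_invariant X e F kap) ->
  forall r, Phi (star r * r) = 0 -> r = 0.
Proof.
move=> H r rr; apply: cnorm_small => eta eta0.
have [e0 e00 he] := multiplier_approx r eta0.
have [F [kap ai]] := H e0 e00.
have := he e0 F kap; rewrite e00 lexx => /(_ isT ai).
case: ai => uF FP ks k0 _.
by rewrite (multiplier_ker _ FP rr) sub0r cnormN.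
Qed.

End Homogeneous.

(** * Representations of the Baumslag-Solitar monoid *)

Section Representation.
Variables (R : realType) (c d : nat) (hc : (0 < c)%N) (hd : (0 < d)%N).
Variables (A : cstarAlgType R) (i : BS c d -> A).
Local Notation G := (BS c d).
Local Notation P := (BS_pos c d).
Local Notation a := (BS_a c d).
Local Notation b := (BS_b c d).
Local Notation stem := (@stem c d).
Local Notation nval := (@nval c d).
Local Notation digits := (digits d).
Hypothesis i_nica : nica_covariant P i.
Local Notation hom := (hom P i).
Local Notation S := (i b).
Local Notation V := (i a).

Lemma S_isom : isometry_elt S. Proof. by apply: (i_isom i_nica); exact: BS_pos_b. Qed.

Lemma V_isom : star V * V = 1. Proof. by apply: (i_isom i_nica); exact: BS_pos_a. Qed.

Lemma i_powb n : i (b ^+ n)%g = S ^+ n.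
Proof.
elim: n => [|n IH]; first by rewrite expg0 expr0 (i1 i_nica).
by rewrite expgS exprS (iM i_nica) ?IH//; [exact: BS_pos_b|exact: BS_pos_bX].
Qed.

Lemma i_nval l j : i (nval l j) = i (stem l) * S ^+ j.
Proof. by rewrite /nval (iM i_nica) ?i_powb//; [exact: BS_pos_stem|exact: BS_pos_bX]. Qed.

Lemma i_stem_cons s l : i (stem (s :: l)) = S ^+ s * V * i (stem l).
Proof.
rewrite /= !(iM i_nica) ?i_powb//; try exact: BS_pos_bX; try exact: BS_pos_a; try exact: BS_pos_stem.
by apply: BS_posM; [exact: BS_pos_bX|exact: BS_pos_a].
Qed.

Lemma V_S_rel : V * S ^+ c = S ^+ d * V.
Proof. by rewrite -!i_powb -!(iM i_nica) ?BS_rel_ab//; try exact: BS_pos_bX; exact: BS_pos_a. Qed.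

(** The Nica relation for the pair [a], [b] with join a b^c = b^d a, multiplied by [star V] on the
    left and by [S] on the right. *)
Lemma starV_S : star V * S = S ^+ c * star V * star S ^+ d.-1.
Proof.
case: i_nica => _ _ _ /(_ _ _ _ (@BS_pos_a c d) (@BS_pos_b c d) (join_a_b hc hd)) + _.
rewrite (iM i_nica) ?i_powb; [|exact: BS_pos_a|exact: BS_pos_bX] => /(congr1 (fun u => star V * u * S)).
rewrite !mulrA V_isom mul1r -!mulrA (S_isom) mulr1 => ->.
rewrite V_S_rel starM starX.
have e : star S ^+ d * S = star S ^+ d.-1.
  have := isometry_expKV 1 d.-1 S_isom; rewrite add1n prednK// => <-.
by rewrite mul1r -!mulrA e.
Qed.

Lemma starV_SV s : (0 < s < d)%N -> star V * S ^+ s * V = 0.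
Proof.
move=> sd; have Ps : P (b ^+ s * a)%g by apply: BS_posM; [exact: BS_pos_bX|exact: BS_pos_a].
case: i_nica => _ _ _ _ /(_ _ _ (@BS_pos_a c d) Ps (no_ub_a_bsa hc hd sd)).
rewrite (iM i_nica) ?i_powb; [|exact: BS_pos_bX|exact: BS_pos_a].
move=> /(congr1 (fun u => star V * u * (S ^+ s * V))); rewrite mulr0 mul0r starM => <-.
have e : star (S ^+ s) * S ^+ s = 1 by rewrite -i_powb (i_isom i_nica)//; exact: BS_pos_bX.
rewrite !mulrA V_isom mul1r -!mulrA [star (S ^+ s) * _]mulrA e mul1r V_isom mulr1.
by rewrite !mulrA.
Qed.

Lemma i_expK m n : star S ^+ m * S ^+ (m + n) = S ^+ n.
Proof. exact/isometry_expK/S_isom. Qed.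

Lemma i_expKV m n : star S ^+ (m + n) * S ^+ m = star S ^+ n.
Proof. exact/isometry_expKV/S_isom. Qed.

Lemma starS_V : star S * V = S ^+ d.-1 * V * star S ^+ c.
Proof.
by apply: (can_inj (@starK R A)); rewrite !starM !starX !starK starV_S mulrA.
Qed.

(** Counting down with borrow, the counterpart of [stem_incrn]. The group identity records the
    degree belonging to the operator identity. *)
Lemma starS_stem n l : digits l -> size l = n -> forall m, exists l' t,
  [/\ digits l', size l' = n, (t <= m * c ^ n)%N,
      (b ^+ m * stem l' = stem l * b ^+ t)%g &
      star S ^+ m * i (stem l) = i (stem l') * star S ^+ t].
Proof.
elim: n l => [|n IH] l.
  move=> _ /size0nil -> m; exists [::], m.
  by rewrite /= mul1g mulg1 expn0 muln1 (i1 i_nica) mul1r mulr1.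
move=> dl sl m; elim: m => [|m [l1 [t1 [d1 s1 h1 e1 f1]]]].
  by exists l, 0%N; rewrite !expg0 mul1g mulg1 !expr0 mul1r mulr1.
case: l1 d1 s1 e1 f1 => // -[|s] l1 /andP[sd dl1] [s1] e1 f1; last first.
  exists (s :: l1), t1; split=> //.
  - by rewrite /= (ltnW sd).
  - by rewrite /= s1.
  - by rewrite (leq_trans h1)// leq_mul2r leqnSn orbT.
  - by rewrite -e1 /= expgSr !mulgA expgSr -!mulgA [(b * (b ^+ s * _))%g]mulgA -expgS expgSr !mulgA.
  - rewrite exprS -mulrA f1 !i_stem_cons exprS !mulrA (_ : star S * S = 1) ?mul1r//.
    exact: S_isom.
(* The leading digit is 0: by [starS_V] it becomes d - 1, and c factors [star S] are borrowed from
   the next level. *)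
have [l2 [t2 [d2 s2 h2 e2 f2]]] := IH l1 dl1 s1 c.
exists (d.-1 :: l2), (t2 + t1)%N; split.
- by rewrite /= prednK ?leqnn.
- by rewrite /= s2.
- by rewrite mulSn expnS leq_add// -expnS.
- have e : (b ^+ d.-1.+1 * a = a * b ^+ c)%g by rewrite prednK// BS_rel_ab.
  transitivity (b ^+ m * (b ^+ d.-1.+1 * a) * stem l2)%g.
    by rewrite /= expgSr expgS !mulgA.
  rewrite e -!mulgA e2 [(t2 + t1)%N]addnC expgnDr [RHS]mulgA -e1 /= expg0 mul1g.
  by rewrite !mulgA.
- rewrite exprS -mulrA f1 !i_stem_cons expr0 mul1r !mulrA starS_V.
  by rewrite -[_ * star S ^+ c * _]mulrA f2 exprD !mulrA.
Qed.

Lemma hom_starS_S m n : hom (b ^- m * b ^+ n)%g (star S ^+ m * S ^+ n).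
Proof.
have [mn|/ltnW nm] := leqP m n.
  rewrite -(subnKC mn) i_expK expgnDr mulKg -i_powb; apply: (hom_i (@BS_pos1 c d) i_nica); exact: BS_pos_bX.
rewrite -(subnKC nm) i_expKV expgnDr invgM mulgVK.
by rewrite -starX -i_powb; apply/hom_star/(hom_i (@BS_pos1 c d) i_nica); exact: BS_pos_bX.
Qed.

Lemma hom_starS x : P x -> hom (b^-1 * x)%g (star S * i x).
Proof.
move=> /(BS_pos_nvalE hd)[l [j [dl ->]]].
have [l' [t [_ _ _ e f]]] := starS_stem dl erefl 1.
rewrite expr1 in f; rewrite expg1 in e.
have -> : (b^-1 * nval l j = stem l' * (b ^- t * b ^+ j))%g.
  have sE : stem l = (b * stem l' * b ^- t)%g by rewrite e mulgK.
  by rewrite /nval sE !mulgA mulVg mul1g.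
rewrite i_nval mulrA f -mulrA; apply: (hom_mull (@BS_posM c d) i_nica); first exact: BS_pos_stem.
exact: hom_starS_S.
Qed.

(** For exponents up to d this is [starV_S]. Beyond that, [star V * S ^+ d = S ^+ c * star V] lowers
    the exponent by d. *)
Lemma hom_starV_S n : hom (a^-1 * b ^+ n)%g (star V * S ^+ n).
Proof.
have rel : (a^-1 * b ^+ d = b ^+ c * a^-1)%g.
  by apply: (mulgI a); rewrite mulVKg mulgA BS_rel_ab mulgK.
elim/ltn_ind: n => n IH; case: n IH => [|n] IH.
  by rewrite expg0 mulg1 expr0 mulr1; apply/hom_star/(hom_i (@BS_pos1 c d) i_nica); exact: BS_pos_a.
have [nd|dn] := leqP n.+1 d.
  have -> : (a^-1 * b ^+ n.+1 = b ^+ c * (a^-1 * b ^- (d - n.+1)))%g.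
    rewrite mulgA -rel -mulgA; congr (_ * _)%g.
    have e : (b ^+ d = b ^+ n.+1 * b ^+ (d - n.+1))%g by rewrite -expgnDr subnKC.
    by rewrite e mulgK.
  rewrite exprS mulrA starV_S -!mulrA -i_powb; apply: (hom_mull (@BS_posM c d) i_nica); first exact: BS_pos_bX.
  have dE : d.-1 = (n + (d - n.+1))%N by lia.
  rewrite dE i_expKV -starX -i_powb; apply: (hom_mulr (@BS_posM c d) i_nica); first exact: BS_pos_bX.
  by apply/hom_star/(hom_i (@BS_pos1 c d) i_nica); exact: BS_pos_a.
have dn' := ltnW dn.
have -> : (b ^+ n.+1 = b ^+ d * b ^+ (n.+1 - d))%g by rewrite -expgnDr subnKC.
have -> : S ^+ n.+1 = S ^+ d * S ^+ (n.+1 - d) by rewrite -exprD subnKC.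
have lt : (n.+1 - d < n.+1)%N by rewrite ltn_subrL hd.
rewrite mulgA rel mulrA.
have -> : star V * S ^+ d = S ^+ c * star V.
  have e := i_expKV d.-1 0; rewrite addn0 expr0 in e.
  have Sd : S ^+ d = S * S ^+ d.-1 by rewrite -exprS prednK.
  by rewrite Sd mulrA starV_S -!mulrA e mulr1.
rewrite -mulgA -mulrA -i_powb; apply: (hom_mull (@BS_posM c d) i_nica); [exact: BS_pos_bX|exact: IH].
Qed.

Lemma hom_starV x : P x -> hom (a^-1 * x)%g (star V * i x).
Proof.
move=> /(BS_pos_nvalE hd)[l [j [dl ->]]]; rewrite i_nval.
case: l dl => [_|s l /andP[sd dl]].
  by rewrite /nval /= mul1g (i1 i_nica) mul1r; exact: hom_starV_S.
rewrite i_stem_cons !mulrA; case: s sd => [_|s sd].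
  rewrite expr0 mulr1 V_isom mul1r -i_nval.
  have -> : (a^-1 * nval (0%N :: l) j)%g = nval l j.
    by rewrite nval_cons expg0 mul1g mulKg.
  by apply: (hom_i (@BS_pos1 c d) i_nica); exact: BS_pos_nval.
by rewrite starV_SV ?sd// !mul0r; exact: hom0.
Qed.

Lemma hom_star_mull x g u : P x -> hom g u -> hom (x^-1 * g)%g (star (i x) * u).
Proof.
move=> Px; move: x Px g u; apply: BS_pos_ind => [||| x y Px Py IHx IHy] g u.
- by rewrite (i1 i_nica) star1 invg1 mul1g mul1r.
- move=> [->|[y [z [Py Pz -> ->]]]]; first by rewrite mulr0; exact: hom0.
  by rewrite mulgA mulrA; apply: (hom_mulr (@BS_posM c d) i_nica) => //; exact: hom_starV.
- move=> [->|[y [z [Py Pz -> ->]]]]; first by rewrite mulr0; exact: hom0.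
  by rewrite mulgA mulrA; apply: (hom_mulr (@BS_posM c d) i_nica) => //; exact: hom_starS.
- move=> hu; rewrite (iM i_nica)// starM invgM -mulgA -mulrA; apply: IHy; exact: IHx.
Qed.

(** * The joint range projection of the [i (b^s a)] with s < d, and the range projection of [i b] *)

Definition stepQ : A := \sum_(s < d) S ^+ s * V * (star V * star S ^+ s).
Local Notation Q := stepQ.

Lemma star_Q : star Q = Q.
Proof.
by rewrite star_sum; apply: eq_bigr => s _; rewrite !starM !starX !starK.
Qed.

Lemma Q_V : Q * V = V.
Proof.
rewrite mulr_suml (bigD1 (Ordinal hd))//= big1 => [|[s sd] /= s0].
  by rewrite addr0 !expr0 mul1r mulr1 -mulrA V_isom mulr1.
have s0' : (0 < s)%N by rewrite lt0n.
have /(congr1 (@star R A)) := starV_SV (s := s) (introT andP (conj s0' sd)).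
by rewrite !starM star0 starX starK -!mulrA => ->; rewrite !mulr0.
Qed.

(** Multiplication by [S] shifts the summands cyclically: the summand s = 0 on the left matches s =
    d - 1 on the right, because V S^c = S^d V. *)
Lemma Q_S : Q * S = S * Q.
Proof.
have H n : n.+1 = d -> (\sum_(s < n.+1) S ^+ s * V * (star V * star S ^+ s)) * S =
    S * \sum_(s < n.+1) S ^+ s * V * (star V * star S ^+ s).
  move=> nd; rewrite mulr_suml mulr_sumr big_ord_recl [RHS]big_ord_recr addrC /=.
  congr (_ + _).
    apply: eq_bigr => s _; rewrite /bump /= add1n.
    rewrite [in LHS]exprS [star S ^+ s.+1]exprSr -!mulrA S_isom mulr1.
    by rewrite !mulrA.
  have e : V * S ^+ c = S ^+ n.+1 * V by rewrite V_S_rel nd.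
  have e' : star V * S = S ^+ c * star V * star S ^+ n by rewrite starV_S (_ : n = d.-1) // -nd.
  by rewrite !expr0 mul1r mulr1 -mulrA e' !mulrA e exprS.
by have := H d.-1 (prednK hd); rewrite (prednK hd).
Qed.

Lemma QQ : Q * Q = Q.
Proof.
have QSn n : Q * S ^+ n = S ^+ n * Q.
  elim: n => [|n IH]; first by rewrite expr0 mulr1 mul1r.
  by rewrite exprS mulrA Q_S -mulrA IH mulrA.
rewrite {2 3}/stepQ mulr_sumr; apply: eq_bigr => s _.
by rewrite !mulrA QSn -(mulrA _ Q) Q_V.
Qed.

Definition rangeS : A := S * star S.
Local Notation p := rangeS.

Lemma star_p : star p = p. Proof. by rewrite starM starK. Qed.

Lemma p_S : p * S = S. Proof. by rewrite -mulrA S_isom mulr1. Qed.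

Lemma pp : p * p = p. Proof. by rewrite mulrA p_S. Qed.

Lemma starS_Q : star S * Q = Q * star S.
Proof. by apply: (can_inj (@starK R A)); rewrite !starM starK star_Q Q_S. Qed.

Lemma Q_p : Q * p = p * Q.
Proof. by rewrite mulrA Q_S -mulrA -starS_Q mulrA. Qed.

Lemma cle_projection (e : A) : star e = e -> e * e = e -> cle e 1.
Proof.
move=> es ee; rewrite /cle; have -> : 1 - e = star (1 - e) * (1 - e).
  by rewrite starB star1 es mulrBl !mulrBr ee; ncring.
exact: pos_starM.
Qed.

Lemma Q_le1 : cle Q 1. Proof. exact: cle_projection star_Q QQ. Qed.

Lemma isometry_range_le1 (u : A) : star u * u = 1 -> cle (u * star u) 1.
Proof.
move=> uu; apply: cle_projection; first by rewrite starM starK.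
by rewrite mulrA -(mulrA u) uu mulr1.
Qed.

(* [1 - (1 - x) e] is [x] on the range of the projection [e] and [1] on its
   complement. *)
Definition damp (x : R) (e : A) : A := 1 - (1 - x) ** e.

Lemma star_damp x e : star e = e -> star (damp x e) = damp x e.
Proof. by move=> es; rewrite /damp starB star1 star_rscale es. Qed.

Lemma damp_mul x e u : e * u = u -> damp x e * u = x ** u.
Proof.
move=> eu; rewrite /damp mulrBl mul1r -scalerAl eu rscaleBl rscale1; ncring.
Qed.

Lemma damp_comm x e u : e * u = u * e -> damp x e * u = u * damp x e.
Proof.
by move=> eu; rewrite /damp mulrBl mulrBr mul1r mulr1 -scalerAl -scalerAr eu.
Qed.

Lemma damp_sqr x e : e * e = e -> damp x e * damp x e = 1 - (1 - x ^+ 2) ** e.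
Proof.
move=> ee; rewrite {2}/damp mulrBr mulr1 -scalerAr damp_mul// rscaleA /damp.
rewrite -addrA -opprD -rscaleDl; congr (_ - _%:C *: _); ring.
Qed.

(** * Diagonal weights with geometric decay *)

Variables (lam q : R) (n M : nat).
Hypotheses (lam_gt0 : 0 < lam) (lam_lt1 : lam < 1) (q_gt0 : 0 < q) (q_lt1 : q < 1).

Local Notation ell := (Num.sqrt (1 - lam ^+ 2)).
Local Notation bet := (Num.sqrt (1 - q ^+ 2)).
(* A point of the spectrum of the diagonal algebra is a path [b^s1 a b^s2 a ...].
   At each level its prefix carries a fixed proportion of the remaining mass, or
   all of it if the path ends there, and likewise for the powers of [b]. The
   weights are therefore geometric, and translating by a generator multiplies
   them by a constant, except near the boundary of the support. *)
Definition level_op : A := locked (damp ell Q).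
Definition base_op : A := locked (damp bet p).
Local Notation L := level_op.
Local Notation B := base_op.
Local Notation K := (L * B).

Lemma level_opE : L = damp ell Q. Proof. by rewrite /level_op -lock. Qed.

Lemma base_opE : B = damp bet p. Proof. by rewrite /base_op -lock. Qed.

Lemma ell_sqr : ell ^+ 2 = 1 - lam ^+ 2.
Proof. by rewrite sqr_sqrtr// subr_ge0 expr_le1// ltW. Qed.

Lemma bet_sqr : bet ^+ 2 = 1 - q ^+ 2.
Proof. by rewrite sqr_sqrtr// subr_ge0 expr_le1// ltW. Qed.

Lemma star_L : star L = L. Proof. by rewrite level_opE star_damp ?star_Q. Qed.

Lemma star_B : star B = B. Proof. by rewrite base_opE star_damp ?star_p. Qed.

Lemma LL : L * L = 1 - lam ^+ 2 ** Q.
Proof. by rewrite level_opE damp_sqr ?QQ// ell_sqr subKr. Qed.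

Lemma BB : B * B = 1 - q ^+ 2 ** p.
Proof. by rewrite base_opE damp_sqr ?pp// bet_sqr subKr. Qed.

Lemma L_B : L * B = B * L.
Proof.
rewrite level_opE base_opE.
by apply: damp_comm; apply: esym; apply: damp_comm; rewrite Q_p.
Qed.

Lemma star_K : star K = K.
Proof. by rewrite starM star_L star_B L_B. Qed.

Lemma KK : K * K = L * L * (B * B).
Proof. by rewrite -!mulrA; congr (_ * _); rewrite !mulrA -L_B. Qed.

Lemma L_S m : L * S ^+ m = S ^+ m * L.
Proof.
elim: m => [|m IH]; first by rewrite expr0 mulr1 mul1r.
have LS : L * S = S * L by rewrite level_opE; apply: damp_comm; exact: Q_S.
by rewrite exprS mulrA LS -!mulrA IH.
Qed.

Lemma L_starS m : L * star S ^+ m = star S ^+ m * L.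
Proof.
by apply: (can_inj (@starK R A)); rewrite !starM -!starX starK star_L L_S.
Qed.

Lemma sqr_le1 (e : A) (x : R) : star e = e -> e * e = e -> 0 <= x -> cle (1 - x ** e) 1.
Proof.
move=> es ee x0; rewrite /cle opprB addrC subrK -ee -{1}es.
by apply: posZ => //; exact: pos_starM.
Qed.

Lemma LL_le1 : cle (L * L) 1.
Proof. by rewrite LL; apply: sqr_le1; rewrite ?star_Q ?QQ ?sqr_ge0. Qed.

Lemma LL_pos : pos (L * L). Proof. exact/pos_sqr/star_L. Qed.

(** Telescopes, since B^2 = 1 - q^2 p and conjugating p by S^j gives the range projection of
    S^(j+1). *)
Lemma sumB m : \sum_(j <- iota 0 m) q ^+ j ^+ 2 ** (S ^+ j * (B * B) * star S ^+ j) =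
  1 - q ^+ m ^+ 2 ** (S ^+ m * star S ^+ m).
Proof.
elim: m => [|m IH]; first by rewrite big_nil !expr0 mulr1 expr1n rscale1 subrr.
rewrite -addn1 iotaD big_cat big_seq1 IH add0n BB.
rewrite mulrBr mulrBl mulr1 -scalerAr -scalerAl scalerBr rscaleA.
have -> : S ^+ m * p * star S ^+ m = S ^+ (m + 1) * star S ^+ (m + 1).
  by rewrite addn1 exprSr exprS /rangeS !mulrA.
have -> : q ^+ (m + 1) ^+ 2 = q ^+ m ^+ 2 * q ^+ 2 by rewrite exprD expr1 exprMn.
by ncring.
Qed.

Lemma LL_S m : S ^+ m * (L * L) = L * L * S ^+ m.
Proof. by rewrite mulrA -L_S -!mulrA -L_S. Qed.

Lemma sumK m : \sum_(j <- iota 0 m) q ^+ j ^+ 2 ** (S ^+ j * (K * K) * star S ^+ j) =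
  L * L - q ^+ m ^+ 2 ** (S ^+ m * (L * L) * star S ^+ m).
Proof.
have -> : L * L - q ^+ m ^+ 2 ** (S ^+ m * (L * L) * star S ^+ m) =
    L * L * (1 - q ^+ m ^+ 2 ** (S ^+ m * star S ^+ m)).
  by rewrite mulrBr mulr1 -scalerAr LL_S (mulrA (L * L)).
rewrite -sumB mulr_sumr; apply: eq_bigr => j _.
rewrite KK -scalerAr; congr (_ *: _).
by rewrite (mulrA (S ^+ j)) LL_S !mulrA.
Qed.

(** * Sums over a finite grid of normal forms *)

Fixpoint box m : seq (seq nat * nat) :=
  if m is m'.+1 then
    [seq ([::], j) | j <- iota 0 M] ++
    [seq (s :: r.1, r.2) | s <- iota 0 d, r <- box m']
  else [::].

Lemma mem_box m l j : ((l, j) \in box m) = [&& digits l, (size l < m)%N & (j < M)%N].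
Proof.
elim: m l j => [|m IH] l j; first by rewrite /= andbF.
rewrite mem_cat; case: l => [|s l].
  have -> : (([::], j) \in [seq (s :: r.1, r.2) | s <- iota 0 d, r <- box m]) = false.
    by apply/negP => /allpairsP[[s r] [_ _]].
  rewrite orbF /=; apply/mapP/idP => [[k]|jM]; first by rewrite mem_iota => kM [->].
  by exists j => //; rewrite mem_iota.
have -> : ((s :: l, j) \in [seq ([::], k) | k <- iota 0 M]) = false.
  by apply/negP => /mapP[].
rewrite /= ltnS; apply/allpairsP/idP => [[[s' [l' j']] [/= + + [-> -> ->]]]|].
  by rewrite mem_iota IH add0n => /= -> /and3P[-> -> ->].
move=> /and3P[/andP[sd dl] lm jM]; exists (s, (l, j)); split=> //=.
  by rewrite mem_iota.
by rewrite IH dl lm jM.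
Qed.

Lemma box_uniq m : uniq (box m).
Proof.
elim: m => [//|m IH]; rewrite cat_uniq; apply/and3P; split.
- by rewrite map_inj_uniq ?iota_uniq// => j k [].
- by apply/hasPn => _ /allpairsP[[s r] [_ _ ->]]; apply/negP => /mapP[].
- apply: allpairs_uniq => //; first exact: iota_uniq.
  by move=> [s [l j]] [s' [l' j']] _ _ /= [-> -> ->].
Qed.

Lemma big_box m (f : seq nat * nat -> A) : \sum_(r <- box m.+1) f r =
  \sum_(j <- iota 0 M) f ([::], j) +
  \sum_(s <- iota 0 d) \sum_(r <- box m) f (s :: r.1, r.2).
Proof. by rewrite big_cat big_map big_allpairs_dep. Qed.

Definition nv (r : seq nat * nat) : G := nval r.1 r.2.
Definition wgt (r : seq nat * nat) : R := lam ^+ size r.1 * q ^+ r.2.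

Lemma i_nv_cons s r : i (nv (s :: r.1, r.2)) = S ^+ s * V * i (nv r).
Proof. by rewrite /nv !i_nval i_stem_cons !mulrA. Qed.

Lemma i_nv_nil j : i (nv ([::], j)) = S ^+ j.
Proof. by rewrite /nv i_nval /= (i1 i_nica) mul1r. Qed.

(** Prepends all letters b^s a. It sends 1 to Q, so one more level of the grid costs a factor lam^2
    Q. *)
Definition transfer (x : A) : A :=
  \sum_(s <- iota 0 d) S ^+ s * V * x * (star V * star S ^+ s).

Lemma transfer_cle x y : cle x y -> cle (transfer x) (transfer y).
Proof.
move=> xy; apply: cle_sum => s _ _.
have := cle_conjV (S ^+ s * V) xy; by rewrite starM starX.
Qed.

Lemma transfer_scalar t : transfer (t ** 1) = t ** Q.
Proof.
have e : iota 0 d = index_iota 0 d by rewrite /index_iota subn0.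
rewrite /transfer /stepQ e big_mkord scaler_sumr.
by apply: eq_bigr => s _; rewrite -scalerAr mulr1 -scalerAl.
Qed.

Definition box_term (X : seq nat * nat -> A) r : A :=
  wgt r ^+ 2 ** (i (nv r) * X r * star (i (nv r))).

Lemma box_term_pos X r : pos (X r) -> pos (box_term X r).
Proof.
move=> Xp; apply: posZ; first exact: sqr_ge0.
by have := pos_conj (star (i (nv r))) Xp; rewrite starK.
Qed.

Lemma sum_box_term m X : \sum_(r <- box m.+1) box_term X r =
  \sum_(j <- iota 0 M) q ^+ j ^+ 2 ** (S ^+ j * X ([::], j) * star S ^+ j) +
  lam ^+ 2 ** (\sum_(s <- iota 0 d) S ^+ s * V *
    (\sum_(r <- box m) box_term (fun r => X (s :: r.1, r.2)) r) * (star V * star S ^+ s)).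
Proof.
rewrite big_box; congr (_ + _).
  by apply: eq_bigr => j _; rewrite /box_term i_nv_nil /wgt /= expr0 mul1r starX.
rewrite scaler_sumr; apply: eq_bigr => s _.
rewrite mulr_sumr mulr_suml scaler_sumr; apply: eq_bigr => r _.
rewrite /box_term i_nv_cons !starM starX -scalerAr -scalerAl rscaleA.
have -> : wgt (s :: r.1, r.2) ^+ 2 = lam ^+ 2 * wgt r ^+ 2.
  by rewrite /wgt /= [lam ^+ _.+1]exprS -mulrA exprMn.
by congr (_ *: _); rewrite !mulrA.
Qed.

(** Each of the m levels contributes at most rho, as lam^2 Q <= 1. *)
Lemma sum_box_term_le m (X : nat -> A) (rho : R) : 0 <= rho ->
  cle (\sum_(j <- iota 0 M) q ^+ j ^+ 2 ** (S ^+ j * X j * star S ^+ j)) (rho ** 1) ->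
  cle (\sum_(r <- box m) box_term (fun r => X r.2) r) ((m%:R * rho) ** 1).
Proof.
move=> rho0 h; elim: m => [|m IH].
  by rewrite big_nil mul0r rscale0; exact: cle_refl.
have -> : (m.+1%:R * rho) ** (1 : A) = rho ** 1 + (m%:R * rho) ** 1.
  by rewrite -natr1 mulrDl mul1r addrC rscaleDl.
rewrite sum_box_term; apply: cleD => //.
have := transfer_cle IH; rewrite transfer_scalar => h2.
apply: cle_trans (cleZ (sqr_ge0 _) h2) _; rewrite rscaleA.
have m0 : 0 <= lam ^+ 2 * (m%:R * rho) by apply: mulr_ge0; [exact: sqr_ge0|exact: mulr_ge0].
apply: cle_trans (cleZ m0 Q_le1) _; apply: cle_scalar.
by rewrite ler_piMl ?mulr_ge0// expr_le1// ltW.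
Qed.

Local Notation tot m := (\sum_(r <- box m) box_term (fun=> K * K) r).

(** By recursion, the level of words without [a] contributes at most L^2 = 1 - lam^2 Q and the
    others at most lam^2 Q. *)
Lemma tot_le1 m : cle (tot m) 1.
Proof.
elim: m => [|m IH]; first by rewrite big_nil /cle subr0; exact: pos1.
rewrite sum_box_term sumK.
have := transfer_scalar 1; rewrite !rscale1 => tr1.
have := transfer_cle IH; rewrite tr1 => /(cleZ (sqr_ge0 lam)) h.
have -> : (1 : A) = L * L + lam ^+ 2 ** Q by rewrite LL subrK.
apply: cleD => //; rewrite /cle opprB addrC subrK; apply: posZ; first exact: sqr_ge0.
by have := pos_conj (star (S ^+ M)) LL_pos; rewrite starK starX.
Qed.

Lemma powS_range_le1 m : cle (S ^+ m * star S ^+ m) 1.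
Proof.
rewrite -starX; apply: isometry_range_le1.
by have := i_expK m 0; rewrite addn0 expr0 starX.
Qed.

(** The missing mass satisfies rho_(m+1) <= q^(2M) + lam^2 rho_m: truncation at M loses q^(2M) on
    every level, and truncation at m levels loses lam^(2m). *)
Lemma tot_ge m : cle ((1 - (lam ^+ m ^+ 2 + m%:R * q ^+ M ^+ 2)) ** 1) (tot m).
Proof.
elim: m => [|m IH].
  by rewrite big_nil expr0 expr1n mul0r addr0 subrr rscale0; exact: cle_refl.
rewrite sum_box_term sumK.
have := transfer_cle IH; rewrite transfer_scalar => /(cleZ (sqr_ge0 lam)).
rewrite rscaleA; set rho := lam ^+ m ^+ 2 + m%:R * q ^+ M ^+ 2 => h.
have rho0 : 0 <= rho by apply: addr_ge0; [exact: sqr_ge0|apply: mulr_ge0 => //; exact: sqr_ge0].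
have h1 : cle (L * L - q ^+ M ^+ 2 ** 1)
    (L * L - q ^+ M ^+ 2 ** (S ^+ M * (L * L) * star S ^+ M)).
  apply: cleD; first exact: cle_refl.
  rewrite /cle opprK addrC -scalerBr; apply: posZ; first exact: sqr_ge0.
  apply: cle_trans (powS_range_le1 M).
  by have := cle_conjV (S ^+ M) LL_le1; rewrite mulr1 starX.
apply: cle_trans (cleD h1 h).
have -> : L * L - q ^+ M ^+ 2 ** 1 + (lam ^+ 2 * (1 - rho)) ** Q =
    1 - q ^+ M ^+ 2 ** 1 - (lam ^+ 2 * rho) ** Q.
  by rewrite LL mulrBr mulr1 rscaleBl; ncring.
have lr0 : 0 <= lam ^+ 2 * rho by apply: mulr_ge0 => //; exact: sqr_ge0.
apply: (@cle_trans _ _ (1 - q ^+ M ^+ 2 ** 1 - (lam ^+ 2 * rho) ** 1)).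
  have -> : (1 : A) - q ^+ M ^+ 2 ** 1 - (lam ^+ 2 * rho) ** 1 =
      (1 - (q ^+ M ^+ 2 + lam ^+ 2 * rho)) ** 1.
    by rewrite rscaleBl rscaleDl rscale1; ncring.
  apply: cle_scalar; rewrite lerD2l lerN2 /rho -natr1 [lam ^+ m.+1]exprS exprMn.
  have := sqr_ge0 (q ^+ M); have : lam ^+ 2 <= 1 by rewrite expr_le1// ltW.
  move=> l1 q0; have : lam ^+ 2 * (m%:R * q ^+ M ^+ 2) <= m%:R * q ^+ M ^+ 2.
    by rewrite ler_piMl// mulr_ge0.
  by lra.
apply: cleD; first exact: cle_refl.
by have := cleZ lr0 Q_le1; rewrite /cle opprK addrC.
Qed.

Lemma top_level_le m :
  cle (\sum_(r <- box m.+1 | size r.1 == m) box_term (fun=> K * K) r) (lam ^+ m ^+ 2 ** 1).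
Proof.
have E k : \sum_(r <- box k.+1 | size r.1 == k) box_term (fun=> K * K) r =
    \sum_(r <- box k.+1) box_term (fun r => if size r.1 == k then K * K else 0) r.
  rewrite big_mkcond; apply: eq_bigr => r _; rewrite /box_term; case: ifP => // _.
  by rewrite mulr0 mul0r scaler0.
elim: m => [|m IH].
  apply: (@cle_trans _ _ (tot 1)); last by rewrite expr0 expr1n rscale1; exact: tot_le1.
  rewrite big_mkcond; apply: cle_sum => r _ _; case: ifP => _; first exact: cle_refl.
  by rewrite /cle subr0; apply: box_term_pos; exact/pos_sqr/star_K.
rewrite E in IH; rewrite E sum_box_term /= big1 ?add0r; last first.
  by move=> j _; rewrite mulr0 mul0r scaler0.
have := transfer_cle IH; rewrite transfer_scalar => /(cleZ (sqr_ge0 lam)) h.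
apply: cle_trans h _; rewrite rscaleA [lam ^+ m.+1]exprS exprMn.
have c0 : 0 <= lam ^+ 2 * lam ^+ m ^+ 2 by apply: mulr_ge0 => //; exact: sqr_ge0.
exact: cleZ c0 Q_le1.
Qed.

(** * The family of weights on the group *)

Local Notation grid := (box n).
Definition support : seq G := [seq nv r | r <- grid].

Lemma nv_inj r r' : digits r.1 -> digits r'.1 -> nv r = nv r' -> r = r'.
Proof.
by case: r r' => [l j] [l' j'] dl dl' e; case: (nval_inj hc hd dl dl' e) => /= -> ->.
Qed.

Lemma grid_digits r : r \in grid -> digits r.1.
Proof. by case: r => l j; rewrite mem_box => /andP[]. Qed.

Lemma mem_support r : digits r.1 -> (nv r \in support) = (r \in grid).
Proof.
move=> dr; apply/mapP/idP => [[r' r'g /(nv_inj dr (grid_digits r'g)) ->] //|rg].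
by exists r.
Qed.

Lemma support_uniq : uniq support.
Proof.
rewrite map_inj_in_uniq ?box_uniq// => r r' rg r'g.
by apply: nv_inj; exact: grid_digits.
Qed.

Definition extend (phi : seq nat * nat -> A) (y : G) : A := \sum_(r <- grid | nv r == y) phi r.

Lemma extend_nv phi r : r \in grid -> extend phi (nv r) = phi r.
Proof.
move=> rg; rewrite /extend big_mkcond (bigD1_seq r) ?box_uniq//= eqxx.
rewrite big_seq_cond big1 ?addr0// => r' /andP[r'g rr'].
by case: eqP => // /(nv_inj (grid_digits r'g) (grid_digits rg)) e; rewrite e eqxx in rr'.
Qed.

Lemma extend_out phi y : y \notin support -> extend phi y = 0.
Proof.
move=> yF; rewrite /extend big_seq_cond big1// => r /andP[rg /eqP e].
by case/negP: yF; rewrite -e; apply/mapP; exists r.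
Qed.

Lemma extend_pos phi y : (forall r, pos (phi r)) -> pos (extend phi y).
Proof. by move=> h; apply: pos_sum. Qed.

Lemma sum_extend_le phi (Y : seq G) : (forall r, pos (phi r)) -> uniq Y ->
  cle (\sum_(y <- Y) extend phi y) (\sum_(r <- grid) phi r).
Proof.
move=> hp uY; rewrite /extend; under eq_bigr do rewrite big_mkcond.
rewrite exchange_big /=; apply: cle_sum => r _ _.
have [rY|rY] := boolP (nv r \in Y).
  rewrite (bigD1_seq (nv r))//= eqxx big1 ?addr0; first exact: cle_refl.
  by move=> y; rewrite eq_sym => /negbTE ->.
rewrite big_seq big1 /cle ?subr0// => y yY.
by case: eqP => // e; rewrite e yY in rY.
Qed.

(** The operator part [K] is the same at every point; only the scalar weight varies. *)
Definition kap : G -> A := extend (fun r => wgt r ** K).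
Local Notation a_ := (wt i kap).

Lemma star_kap y : star (kap y) = kap y.
Proof. by rewrite star_sum; apply: eq_bigr => r _; rewrite star_rscale star_K. Qed.

Lemma wt_nv r : r \in grid -> a_ (nv r) = wgt r ** (i (nv r) * K * star (i (nv r))).
Proof. by move=> rg; rewrite /wt /kap extend_nv// -scalerAr -scalerAl. Qed.

Lemma wt_out y : y \notin support -> a_ y = 0.
Proof. by move=> yF; rewrite /wt /kap extend_out// mulr0 mul0r. Qed.

Lemma i_nv_isom r : star (i (nv r)) * i (nv r) = 1.
Proof. by apply: (i_isom i_nica); exact: BS_pos_nval. Qed.

Lemma wt_sqr r : r \in grid -> a_ (nv r) * a_ (nv r) = box_term (fun=> K * K) r.
Proof.
move=> rg; rewrite wt_nv// -scalerAl -scalerAr rscaleA -expr2 /box_term.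
congr (_ *: _); set x := i (nv r).
have -> : x * K * star x * (x * K * star x) = x * K * (star x * x) * K * star x.
  by rewrite !mulrA.
by rewrite i_nv_isom mulr1 !mulrA.
Qed.

Lemma sum_wt_sqr : \sum_(y <- support) a_ y * a_ y = \sum_(r <- grid) box_term (fun=> K * K) r.
Proof.
by rewrite big_map big_seq [RHS]big_seq; apply: eq_bigr => r rg; rewrite wt_sqr.
Qed.

(** * Row and column bounds for the defect at one positive element *)

Section Estimate.
Variables (g : G) (th rho1 rho2 gam : R) (edge inner : pred (seq nat * nat)) (Y : A).
Hypotheses (Pg : P g) (th0 : 0 <= th) (Ystar : star Y = Y).
Local Notation x := (i g).
Local Notation D := (delta i kap x g).
(** On the support the defect is a small multiple t of [x * a_ (nv r)] when translation by g stays
    inside, and all of it at an edge point that leaves. The next hypothesis treats points that enter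
    from outside. *)
Hypothesis D_support : forall r, r \in grid ->
  (exists2 t, 0 <= t <= th & D (nv r) = t ** (x * a_ (nv r))) \/
  (edge r /\ D (nv r) = x * a_ (nv r)).
Hypothesis D_boundary : forall y r, y \notin support -> r \in grid -> (g * y)%g = nv r ->
  D y = 0 \/
  (inner r /\ D y = - ((gam * wgt r) ** (i (nv r) * Y * star (i (nv r)) * x))).
Hypothesis edge_le : cle (\sum_(r <- grid | edge r) box_term (fun=> K * K) r) (rho1 ** 1).
Hypothesis inner_le :
  cle (gam ^+ 2 ** \sum_(r <- grid | inner r) box_term (fun=> Y * Y) r) (rho2 ** 1).

Let f r := th ^+ 2 ** box_term (fun=> K * K) r +
  (if edge r then box_term (fun=> K * K) r else 0).
Let h r := if inner r then gam ^+ 2 ** box_term (fun=> Y * Y) r else 0.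

Let KK_pos r : pos (box_term (fun=> K * K) r).
Proof. by apply: box_term_pos; apply: pos_sqr; exact: star_K. Qed.

Let f_pos r : pos (f r).
Proof.
apply: posD; first by apply: posZ => //; exact: sqr_ge0.
by case: ifP => // _; exact: pos0.
Qed.

Let h_pos r : pos (h r).
Proof.
rewrite /h; case: ifP => _; last exact: pos0.
by apply: posZ; [exact: sqr_ge0|apply: box_term_pos; exact: pos_sqr].
Qed.

Let sum_f : cle (\sum_(r <- grid) f r) ((th ^+ 2 + rho1) ** 1).
Proof.
rewrite big_split /= -scaler_sumr -big_mkcond rscaleDl; apply: cleD => //.
by apply: cleZ; [exact: sqr_ge0|exact: tot_le1].
Qed.

Let sum_h : cle (\sum_(r <- grid) h r) (rho2 ** 1).
Proof. by rewrite -big_mkcond -scaler_sumr. Qed.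

Let xx : star x * x = 1. Proof. exact: (i_isom i_nica). Qed.

Let cle_posr (u v : A) : pos v -> cle u (u + v).
Proof. by move=> vp; rewrite /cle addrAC subrr add0r. Qed.

Let cle_posl (u v : A) : pos u -> cle v (u + v).
Proof. by move=> up; rewrite addrC; exact: cle_posr. Qed.

Let f_edge r : edge r -> cle (box_term (fun=> K * K) r) (f r).
Proof. by move=> er; rewrite /f er; apply: cle_posl; apply: posZ => //; exact: sqr_ge0. Qed.

Let f_th r t : 0 <= t <= th -> cle (t ^+ 2 ** box_term (fun=> K * K) r) (f r).
Proof.
move=> /andP[t0 tth]; apply: (@cle_trans _ _ (th ^+ 2 ** box_term (fun=> K * K) r)).
  by rewrite /cle -rscaleBl; apply: posZ => //; rewrite subr_ge0 lerXn2r ?nnegrE.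
by apply: cle_posr; case: ifP => // _; exact: pos0.
Qed.

Let boundary_sqr r : let u := (gam * wgt r) ** (i (nv r) * Y * star (i (nv r))) in
  star u = u /\ u * u = gam ^+ 2 ** box_term (fun=> Y * Y) r.
Proof.
set w := i (nv r); split; first by rewrite star_rscale !starM starK Ystar mulrA.
rewrite -scalerAl -scalerAr rscaleA /box_term rscaleA -/w.
have -> : w * Y * star w * (w * Y * star w) = w * Y * (star w * w) * Y * star w.
  by rewrite !mulrA.
by rewrite i_nv_isom mulr1 !mulrA; congr (_%:C *: _); ring.
Qed.

(** On the support D is a multiple of x w with w self-adjoint, so its column square is that of w and
    its row square is conjugated by the isometry x. At an entering point D = - u x with u
    self-adjoint, where the roles are exchanged and x star x <= 1 is used. *)
Let D_cases y :
  cle (D y * star (D y)) (x * extend f y * star x + extend h (g * y)%g) /\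
  cle (star (D y) * D y) (extend f y + star x * extend h (g * y)%g * x).
Proof.
have fp := extend_pos y f_pos; have hp := extend_pos (g * y)%g h_pos.
have [yF|yF] := boolP (y \in support).
  case/mapP: (yF) => r rg yr; rewrite yr in fp hp *; rewrite (extend_nv f rg).
  have as_ : star (a_ (nv r)) = a_ (nv r) by apply: star_wt; exact: star_kap.
  suff [DD1 DD2] : cle (D (nv r) * star (D (nv r))) (x * f r * star x) /\
      cle (star (D (nv r)) * D (nv r)) (f r).
    split; first by apply: cle_trans DD1 _; exact: cle_posr.
    by apply: cle_trans DD2 _; apply: cle_posr; exact: pos_conj.
  have e1 : x * a_ (nv r) * star (x * a_ (nv r)) =
      x * box_term (fun=> K * K) r * star x.
    by rewrite starM as_ -wt_sqr// !mulrA.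
  have e2 : star (x * a_ (nv r)) * (x * a_ (nv r)) = box_term (fun=> K * K) r.
    rewrite starM as_ -wt_sqr//.
    have -> : a_ (nv r) * star x * (x * a_ (nv r)) = a_ (nv r) * (star x * x) * a_ (nv r).
      by rewrite !mulrA.
    by rewrite xx mulr1.
  case: (D_support rg) => [[t tth ->]|[er ->]].
    rewrite star_rscale -!scalerAl -!scalerAr !rscaleA -expr2 e1 e2; split.
      by have := cle_conjV x (f_th r tth); rewrite -scalerAr -scalerAl.
    exact: f_th.
  by rewrite e1 e2; split; [apply: cle_conjV; exact: f_edge|exact: f_edge].
rewrite (extend_out _ yF) mulr0 mul0r !add0r.
have D0 : D y = 0 -> cle (D y * star (D y)) (extend h (g * y)%g) /\
    cle (star (D y) * D y) (star x * extend h (g * y)%g * x).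
  by move=> ->; rewrite star0 !mul0r /cle !subr0; split=> //; exact: pos_conj.
have [gF|gF] := boolP ((g * y)%g \in support); last first.
  by apply: D0; rewrite /delta !wt_out// mulr0 mul0r subrr.
case/mapP: (gF) => r rg gyr; case: (D_boundary yF rg gyr) => [/D0 //|[ir DE]].
rewrite gyr (extend_nv h rg) DE /h ir.
have [us uu] := boundary_sqr r; rewrite scalerAl.
move: us uu; set u := _ ** _ => us uu; rewrite starN !mulrNN -uu starM us.
split; last by rewrite !mulrA; exact: cle_refl.
have -> : u * x * (star x * u) = u * (x * star x) * u by rewrite !mulrA.
have := cle_conj u (isometry_range_le1 xx).
by rewrite us mulr1.
Qed.

Lemma small_of_cases (e : R) : th ^+ 2 + rho1 + rho2 <= e ->
  small_rows i kap x g e /\ small_cols i kap x g e.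
Proof.
move=> he; have fin : cle ((th ^+ 2 + rho1 + rho2) ** (1 : A)) (e ** 1) by exact: cle_scalar.
have pc : 0 <= th ^+ 2 + rho1.
  have := pos_sum (r := grid) (P := predT) (F := f) (fun r _ _ => f_pos r).
  move=> /posD/(_ sum_f); rewrite addrC subrK => p0.
  rewrite leNgt; apply/negP => c0.
  have p1 : pos (- ((th ^+ 2 + rho1) ** (1 : A))).
    by rewrite -rscaleNl; apply: pos_scalar; rewrite oppr_ge0 ltW.
  have := congr1 (@cnorm R A) (pos_antisym p0 p1).
  by rewrite cnorm_scalar cnorm0 => /eqP; rewrite normr_eq0 lt_eqF.
have Yf Y' : uniq Y' -> cle (\sum_(y <- Y') extend f y) ((th ^+ 2 + rho1) ** 1).
  by move=> uY; apply: cle_trans (sum_extend_le f_pos uY) sum_f.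
have Yh Y' : uniq Y' -> cle (\sum_(y <- Y') extend h (g * y)%g) (rho2 ** 1).
  move=> uY; rewrite sum_translate; apply: cle_trans sum_h.
  by apply: sum_extend_le => //; exact: uniq_translate.
split=> Y' uY; apply: cle_trans fin.
  apply: (@cle_trans _ _ (\sum_(y <- Y') (x * extend f y * star x + extend h (g * y)%g))).
    by apply: cle_sum => y _ _; case: (D_cases y).
  rewrite big_split /= -mulr_suml -mulr_sumr rscaleDl; apply: cleD; last exact: Yh.
  apply: cle_trans (cle_conjV x (Yf _ uY)) _; rewrite -scalerAr -scalerAl mulr1.
  by apply: cleZ => //; exact: isometry_range_le1.
apply: (@cle_trans _ _ (\sum_(y <- Y') (extend f y + star x * extend h (g * y)%g * x))).
  by apply: cle_sum => y _ _; case: (D_cases y).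
rewrite big_split /= -mulr_suml -mulr_sumr rscaleDl; apply: cleD; first exact: Yf.
apply: cle_trans (cle_conj x (Yh _ uY)) _; rewrite -scalerAr -scalerAl mulr1 xx.
exact: cle_refl.
Qed.

End Estimate.

(** * Defects at the generators [b] and [a] *)

Lemma i_mul_nv g r : P g -> i (g * nv r)%g = i g * i (nv r).
Proof. by move=> Pg; rewrite (iM i_nica)//; exact: BS_pos_nval. Qed.

Lemma delta_interior g r r' (t : R) : P g -> r \in grid -> r' \in grid ->
  (g * nv r)%g = nv r' -> wgt r' = t * wgt r ->
  delta i kap (i g) g (nv r) = (1 - t) ** (i g * a_ (nv r)).
Proof.
move=> Pg rg r'g gr wr; rewrite /delta gr !wt_nv// -gr i_mul_nv// starM.
have -> : i g * i (nv r) * K * (star (i (nv r)) * star (i g)) =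
  i g * (i (nv r) * K * star (i (nv r))) * star (i g) by rewrite !mulrA.
rewrite -(scalerAl _ _ (i g)) -(mulrA _ (star (i g))) (i_isom i_nica)// mulr1.
by rewrite wr -scalerAr rscaleA -rscaleBl; congr (_%:C *: _); ring.
Qed.

Lemma delta_exit g r : r \in grid -> (g * nv r)%g \notin support ->
  delta i kap (i g) g (nv r) = i g * a_ (nv r).
Proof. by move=> rg gr; rewrite /delta (wt_out gr) mul0r subr0. Qed.

(** The damping factor inside [K] meets the range of [i g] and becomes the small scalar [t], so that
    only the other factor [Y] of [K] remains. *)
Lemma delta_entry g y r (t : R) (Y : A) : y \notin support -> r \in grid ->
  (g * y)%g = nv r -> K * (star (i (nv r)) * i g) = t ** (Y * (star (i (nv r)) * i g)) ->
  delta i kap (i g) g y = - ((t * wgt r) ** (i (nv r) * Y * star (i (nv r)) * i g)).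
Proof.
move=> yF rg gy KY; rewrite /delta (wt_out yF) mulr0 sub0r gy wt_nv//; congr (- _).
rewrite -scalerAl.
have -> : i (nv r) * K * star (i (nv r)) * i g = i (nv r) * (K * (star (i (nv r)) * i g)).
  by rewrite !mulrA.
by rewrite KY -scalerAr rscaleA (mulrC t) !mulrA.
Qed.

Lemma mul_star_range (m : nat) (x : A) : (0 < m)%N -> B * (S ^+ m * x) = bet ** (S ^+ m * x).
Proof.
case: m => // m _; rewrite base_opE; apply: damp_mul.
by rewrite exprS !mulrA p_S.
Qed.

Local Notation T := (c ^ n)%N.

Lemma expr_q_itv m : 0 <= q ^+ m <= 1.
Proof. by rewrite exprn_ge0 ?exprn_ile1 ?ltW. Qed.

Lemma sum_box_term_if m (b0 : pred nat) (Z : A) :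
  \sum_(r <- box m | b0 r.2) box_term (fun=> Z) r =
  \sum_(r <- box m) box_term (fun r => (fun j => if b0 j then Z else 0) r.2) r.
Proof.
rewrite big_mkcond; apply: eq_bigr => r _; rewrite /box_term; case: ifP => // _.
by rewrite mulr0 mul0r scaler0.
Qed.

(** The exponents M - T <= j < M form the difference of two telescoping sums from [sumK]. *)
Lemma base_edge_le : (T <= M)%N ->
  cle (\sum_(r <- grid | (M <= r.2 + T)%N) box_term (fun=> K * K) r)
      ((n%:R * q ^+ (M - T) ^+ 2) ** 1).
Proof.
move=> TM; rewrite (@sum_box_term_if _ (fun j => M <= j + T)%N).
apply: (@sum_box_term_le n (fun j => if (M <= j + T)%N then K * K else 0)).
  exact: sqr_ge0.
have iE : iota 0 M = iota 0 (M - T) ++ iota (M - T) T by rewrite -{1}(subnK TM) iotaD add0n.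
have z : \sum_(j <- iota 0 (M - T)) q ^+ j ^+ 2 **
    (S ^+ j * (if (M <= j + T)%N then K * K else 0) * star S ^+ j) = 0.
  rewrite big_seq big1// => j; rewrite mem_iota add0n => /andP[_].
  by rewrite ltn_subRL addnC ltnNge => /negbTE ->; rewrite mulr0 mul0r scaler0.
have e : \sum_(j <- iota (M - T) T) q ^+ j ^+ 2 **
    (S ^+ j * (if (M <= j + T)%N then K * K else 0) * star S ^+ j) =
    \sum_(j <- iota (M - T) T) q ^+ j ^+ 2 ** (S ^+ j * (K * K) * star S ^+ j).
  rewrite big_seq [RHS]big_seq; apply: eq_bigr => j; rewrite mem_iota => /andP[+ _].
  by rewrite leq_subLR addnC => ->.
rewrite iE big_cat /= z add0r e.
have := sumK M; rewrite iE big_cat /= sumK => /eqP.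
rewrite addrC eq_sym -subr_eq => /eqP <-.
have pM : pos (q ^+ M ^+ 2 ** (S ^+ M * (L * L) * star S ^+ M)).
  apply: posZ; first exact: sqr_ge0.
  by have := pos_conj (star (S ^+ M)) LL_pos; rewrite starK starX.
set J := (M - T)%N.
apply: (@cle_trans _ _ (q ^+ J ^+ 2 ** (S ^+ J * (L * L) * star S ^+ J))).
  rewrite /cle; set u := _ ** _ in pM *; set v := _ ** _.
  by have -> : v - (L * L - u - (L * L - v)) = u by ncring.
apply: cleZ; first exact: sqr_ge0.
apply: cle_trans (powS_range_le1 J).
by have := cle_conjV (S ^+ J) LL_le1; rewrite mulr1 starX.
Qed.

(** Without [B] the sum over j does not telescope: each of the T exponents may contribute 1 on each
    of the n levels. The smallness comes from bet^2 = 1 - q^2 alone. *)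
Lemma base_inner_le : (T <= M)%N ->
  cle (bet ^+ 2 ** \sum_(r <- grid | (r.2 < T)%N) box_term (fun=> L * L) r)
      (((1 - q ^+ 2) * (n%:R * T%:R)) ** 1).
Proof.
move=> TM; rewrite bet_sqr -rscaleA; apply: cleZ.
  by rewrite subr_ge0 expr_le1// ltW.
rewrite (@sum_box_term_if _ (fun j => j < T)%N).
apply: (@sum_box_term_le n (fun j => if (j < T)%N then L * L else 0)).
  exact: ler0n.
rewrite -{1}(subnKC TM) iotaD big_cat add0n /=.
have -> : \sum_(j <- iota T (M - T)) q ^+ j ^+ 2 **
    (S ^+ j * (if (j < T)%N then L * L else 0) * star S ^+ j) = 0.
  rewrite big_seq big1// => j; rewrite mem_iota => /andP[jT _].
  by rewrite ltnNge jT /= mulr0 mul0r scaler0.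
rewrite addr0.
have -> : T%:R ** (1 : A) = \sum_(j <- iota 0 T) 1 ** (1 : A).
  rewrite big_const_seq count_predT size_iota; elim: (T) => [|m IH]; first by rewrite rscale0.
  by rewrite -natr1 rscaleDl IH addrC.
apply: cle_sum => j _ _.
have q1 : q ^+ j ^+ 2 <= 1.
  by have /andP[? ?] := expr_q_itv j; rewrite exprn_ile1.
apply: (@cle_trans _ _ (q ^+ j ^+ 2 ** 1)); last exact: cle_scalar.
apply: cleZ; first exact: sqr_ge0.
apply: cle_trans (powS_range_le1 j).
have := cle_conjV (S ^+ j) LL_le1; rewrite mulr1 starX.
case: ifP => // _ _; rewrite mulr0 mul0r /cle subr0.
by rewrite -starX; exact: pos_Mstar.
Qed.

Lemma c_expn_mono k : (k <= n)%N -> (c ^ k <= T)%N.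
Proof. by move=> kn; rewrite leq_pexp2l. Qed.

(** Here T bounds every carry t on the grid. Multiplication by [b] keeps the length of the stem, so
    it changes the weight by q^t, leaves only near the top exponents and enters only at exponents
    below T. *)
Lemma small_b e : (T <= M)%N ->
  (1 - q ^+ T) ^+ 2 + n%:R * q ^+ (M - T) ^+ 2 + (1 - q ^+ 2) * (n%:R * T%:R) <= e ->
  small_rows i kap S b e /\ small_cols i kap S b e.
Proof.
move=> TM; apply: (@small_of_cases b (1 - q ^+ T) _ _ bet
  (fun r => M <= r.2 + T)%N (fun r => r.2 < T)%N L).
- exact: BS_pos_b.
- by rewrite subr_ge0; have /andP[] := expr_q_itv T.
- exact: star_L.
- move=> [l j] rg; have dl := grid_digits rg; move: (rg); rewrite mem_box => /and3P[_ ln jM].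
  have [l' [t [dl' sl' tl e']]] := nval_incr c hd j dl.
  have tT : (t <= T)%N by apply: leq_trans tl _; apply: c_expn_mono; exact: ltnW.
  have [tjM|Mtj] := ltnP (t + j) M; last first.
    right; split; first by apply: leq_trans Mtj _; rewrite addnC leq_add2l.
    apply: delta_exit => //; rewrite [nv _]/nv e' -[nval _ _]/(nv (l', (t + j)%N)).
    by rewrite mem_support// mem_box dl' /= sl' ln /= -leqNgt.
  left; exists (1 - q ^+ t); last first.
    apply: (@delta_interior b (l, j) (l', (t + j)%N)) => //; first exact: BS_pos_b.
      by rewrite mem_box dl' sl' ln tjM.
    by rewrite /wgt /= sl' exprD; ring.
  have /andP[q0 q1] := expr_q_itv t.
  rewrite subr_ge0 q1 lerD2l lerN2 /=.
  by rewrite -(subnKC tT) exprD ler_piMr//; have /andP[] := expr_q_itv (T - t).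
- move=> y [l j] yF rg by_; have dl := grid_digits rg.
  move: (rg); rewrite mem_box => /and3P[_ ln jM]; right.
  have [l' [t [dl' sl' tl e' f']]] := starS_stem dl erefl 1.
  rewrite mul1n in tl; rewrite expg1 in e'; rewrite expr1 in f'.
  have tT : (t <= T)%N by apply: leq_trans tl _; apply: c_expn_mono; exact: ltnW.
  (* Otherwise the borrow t could be paid from the exponent j, and y would lie in the grid. *)
  have jt : (j < t)%N.
    rewrite ltnNge; apply/negP => tj; case/negP: yF.
    have -> : y = nv (l', (j - t)%N).
      apply: (mulgI b); rewrite by_ /nv /nval /= mulgA e' -mulgA -expgnDr.
      by rewrite subnKC.
    by rewrite mem_support// mem_box dl' sl' ln; apply: leq_ltn_trans (leq_subr _ _) jM.
  split; first exact: leq_trans jt tT.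
  apply: delta_entry => //.
  (* The power t - j is positive, so [B] meets the range of [S] and acts as the scalar [bet]. *)
  have -> : star (i (nv (l, j))) * S = S ^+ (t - j) * star (i (stem l')).
    rewrite /nv i_nval starM starX -mulrA.
    have -> : star (i (stem l)) * S = S ^+ t * star (i (stem l')).
      by apply: (can_inj (@starK R A)); rewrite !starM starK starK starX f'.
    by rewrite mulrA -{1}(subnKC (ltnW jt)) i_expK.
  by rewrite -mulrA mul_star_range ?subn_gt0// -scalerAr.
- exact: base_edge_le.
- exact: base_inner_le.
Qed.

Lemma level_inner_le n' : n = n'.+1 ->
  cle (ell ^+ 2 ** \sum_(r <- grid | r.1 == [::]) box_term (fun=> B * B) r)
      ((1 - lam ^+ 2) ** 1).
Proof.
move=> nE; rewrite ell_sqr; apply: cleZ; first by rewrite subr_ge0 expr_le1// ltW.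
rewrite nE big_mkcond big_box /= [X in _ + X]big1 ?addr0; last first.
  by move=> s _; rewrite big1.
have -> : \sum_(j <- iota 0 M) box_term (fun=> B * B) ([::], j) =
    \sum_(j <- iota 0 M) q ^+ j ^+ 2 ** (S ^+ j * (B * B) * star S ^+ j).
  by apply: eq_bigr => j _; rewrite /box_term i_nv_nil /wgt /= expr0 mul1r starX.
rewrite sumB /cle opprB addrC subrK -starX; apply: posZ; first exact: sqr_ge0.
exact: pos_Mstar.
Qed.

Lemma L_V : L * V = ell ** V.
Proof. by rewrite level_opE; apply: damp_mul; exact: Q_V. Qed.

(** Multiplication by [a] prepends the digit 0 and changes the weight by lam; it leaves the grid
    only from the top level n'. *)
Lemma small_a e n' : n = n'.+1 ->
  (1 - lam) ^+ 2 + lam ^+ n' ^+ 2 + (1 - lam ^+ 2) <= e ->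
  small_rows i kap V a e /\ small_cols i kap V a e.
Proof.
move=> nE; apply: (@small_of_cases a (1 - lam) _ _ ell
  (fun r => size r.1 == n') (fun r => r.1 == [::]) B).
- exact: BS_pos_a.
- by rewrite subr_ge0 ltW.
- exact: star_B.
- move=> [l j] rg; have dl := grid_digits rg; move: (rg); rewrite mem_box => /and3P[_ ln jM].
  have e' : (a * nv (l, j))%g = nv (0%N :: l, j).
    by rewrite /nv nval_cons expg0 mul1g.
  have dl0 : digits (0%N :: l) by rewrite /= hd.
  have [ln'|ln'] := ltnP (size l).+1 n.
    left; exists (1 - lam); first by rewrite lexx subr_ge0 ltW.
    apply: (@delta_interior a (l, j) (0%N :: l, j)) => //; first exact: BS_pos_a.
      by rewrite mem_box dl0 jM /= ln'.
    by rewrite /wgt /= exprS mulrA.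
  right; split; first by rewrite /= eqn_leq -ltnS -nE ln -ltnS -nE.
  by apply: delta_exit => //; rewrite e' mem_support// mem_box dl0 /= ltnNge ln'.
- move=> y [[|[|s] l] j] yF rg ay.
  (* A power of [b] is not [a] times a positive element; there [L] passes through the powers of
     [star S] and acts on [V] as the scalar [ell]. *)
  + right; split=> //; apply: delta_entry => //.
    have -> : star (i (nv ([::], j))) = star S ^+ j by rewrite i_nv_nil starX.
    rewrite L_B -mulrA (mulrA L) L_starS -(mulrA _ L) L_V -scalerAr -scalerAr //.
  + case/negP: yF; have -> : y = nv (l, j).
      by apply: (mulgI a); rewrite ay /nv nval_cons expg0 mul1g.
    have dl : digits l by case/andP: (grid_digits rg).
    rewrite mem_support//; move: rg; rewrite !mem_box => /and3P[_ ln ->].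
    by rewrite dl (ltnW ln).
  (* A nonzero leading digit: the ranges of [i (b^(s+1) a)] and [V] are orthogonal, so nothing
     enters. *)
  + left; have /andP[sd dl] := grid_digits rg.
    have e0 : star (i (nv (s.+1 :: l, j))) * V = 0.
      rewrite /nv i_nval i_stem_cons !starM !starX -!mulrA.
      have /(congr1 (@star R A)) := starV_SV (s := s.+1) (introT andP (conj isT sd)).
      by rewrite !starM star0 starX starK mulrA => ->; rewrite !mulr0.
    rewrite /delta (wt_out yF) mulr0 sub0r ay wt_nv// -scalerAl.
    by rewrite -(mulrA (_ * _) _ V) e0 mulr0 scaler0 oppr0.
- have := top_level_le n'; rewrite -nE; exact.
- exact: (@level_inner_le n').
Qed.

Lemma approx_invariant_grid e n' : n = n'.+1 -> (T <= M)%N ->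
  (1 - lam) ^+ 2 + lam ^+ n' ^+ 2 + (1 - lam ^+ 2) <= e ->
  (1 - q ^+ T) ^+ 2 + n%:R * q ^+ (M - T) ^+ 2 + (1 - q ^+ 2) * (n%:R * T%:R) <= e ->
  lam ^+ n ^+ 2 + n%:R * q ^+ M ^+ 2 <= e ->
  approx_invariant P i [set a; b]%classic e support kap.
Proof.
move=> nE TM ha hb ht; split.
- exact: support_uniq.
- by move=> y /mapP[r _ ->]; exact: BS_pos_nval.
- exact: star_kap.
- by move=> y; exact: extend_out.
split.
- by rewrite sum_wt_sqr; exact: tot_le1.
- rewrite sum_wt_sqr; apply: cle_trans (tot_ge n); apply: cle_scalar.
  by rewrite lerD2l lerN2.
- move=> y [->|->]; first exact: small_a nE ha.
  exact: small_b TM hb.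
Qed.

End Representation.

(** * Choice of lam, n, q and M *)

Section Constants.
Variable R : realType.
Implicit Types (x e : R).

(** A form of Bernoulli's inequality: it bounds x^m by the inverse of 1 + m (1 - x), which gives
    decay from the Archimedean property without logarithms. *)
Lemma expr_bernoulli x m : 0 <= x <= 1 -> x ^+ m * (1 + m%:R * (1 - x)) <= 1.
Proof.
move=> /andP[x0 x1]; elim: m => [|m IH]; first by rewrite expr0 mul0r addr0 mulr1.
apply: le_trans IH; rewrite exprSr -mulrA ler_wpM2l ?exprn_ge0//.
have m0 : 0 <= m%:R :> R by exact: ler0n.
have := mulr_ge0 m0 (sqr_ge0 (1 - x)); have := sqr_ge0 (1 - x).
by rewrite -natr1; move: (m%:R) => k; lra.
Qed.

Lemma expr_bernoulli1 x m : 0 <= x <= 1 -> 1 - x ^+ m <= m%:R * (1 - x).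
Proof.
move=> /andP[x0 x1]; elim: m => [|m IH]; first by rewrite expr0 subrr mul0r.
have : x * (m%:R * (1 - x)) <= m%:R * (1 - x).
  by rewrite ler_piMl// mulr_ge0// subr_ge0.
by rewrite exprS -natr1; nra.
Qed.

Lemma exists_expr_le x e : 0 < x < 1 -> 0 < e -> exists m, x ^+ m <= e.
Proof.
move=> /andP[x0 x1] e0; have y0 : 0 < 1 - x by rewrite subr_gt0.
have h0 : 0 <= (e * (1 - x))^-1 by rewrite invr_ge0 mulr_ge0// ltW.
exists (Num.bound (e * (1 - x))^-1); set m := Num.bound _.
have hm : (e * (1 - x))^-1 < m%:R by exact: archi_boundP.
have h := @expr_bernoulli x m (introT andP (conj (ltW x0) (ltW x1))).
have m1 : 1 <= e * (1 + m%:R * (1 - x)).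
  have : 1 < m%:R * (e * (1 - x)) by rewrite -ltr_pdivrMr ?mulr_gt0// div1r.
  by move=> ?; nra.
have d0 : 0 < 1 + m%:R * (1 - x) by rewrite ltr_wpDr// mulr_ge0// ltW.
by rewrite -(ler_pM2r d0); exact: le_trans h m1.
Qed.

(** The order of choice matters: lam, then the number of levels, which fixes the carry bound T, then
    q close to 1 relative to n T, and finally M. *)
Lemma exists_parameters (c : nat) e : (0 < c)%N -> 0 < e ->
  exists (lam q : R) (n' M : nat), let T := (c ^ n'.+1)%N in
  [/\ 0 < lam < 1, 0 < q < 1 & (T <= M)%N] /\
  [/\ (1 - lam) ^+ 2 + lam ^+ n' ^+ 2 + (1 - lam ^+ 2) <= e,
      (1 - q ^+ T) ^+ 2 + n'.+1%:R * q ^+ (M - T) ^+ 2 +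
        (1 - q ^+ 2) * (n'.+1%:R * T%:R) <= e &
      lam ^+ n'.+1 ^+ 2 + n'.+1%:R * q ^+ M ^+ 2 <= e].
Proof.
move=> c0 e0; set m := Num.min e 1.
have m0 : 0 < m by rewrite lt_min e0 ltr01.
have me : m <= e by rewrite ge_min lexx.
have m1 : m <= 1 by rewrite ge_min lexx orbT.
have sq (y : R) : 0 <= y <= 1 -> y ^+ 2 <= y by move=> /andP[? ?]; nra.
(* (1 - lam)^2 + (1 - lam^2) = 2 (1 - lam) = m / 2, which leaves e / 2 for the power of lam. *)
set lam := 1 - m / 4.
have lam01 : 0 < lam < 1 by apply/andP; split; rewrite /lam; lra.
have [n' hn'] := exists_expr_le lam01 (divr_gt0 e0 (ltr0Sn _ 1)).
set n := n'.+1; set T := (c ^ n)%N.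
have T1 : 1 <= T%:R :> R by rewrite ler1n expn_gt0 c0.
have n1 : 1 <= n%:R :> R by rewrite ler1n.
set k : R := n%:R * T%:R.
have k1 : 1 <= k by rewrite /k; nra.
have kT : T%:R <= k by rewrite /k ler_peMl// ler0n.
have k0 : 0 < k by lra.
(* With k = n T this gives T (1 - q) <= m / 8 and (1 - q^2) k <= m / 4, which together with e / 2
   stay below e. *)
set eta := m / 8 / k.
have eta0 : 0 < eta by rewrite /eta !divr_gt0.
have etak : eta * k = m / 8 by rewrite /eta divfK// gt_eqF.
have eta1 : eta <= 1 / 8 by rewrite /eta ler_pdivrMr//; nra.
set q := 1 - eta.
have q01 : 0 < q < 1 by apply/andP; split; rewrite /q; lra.
have n0 : 0 < n%:R :> R by rewrite ltr0n.
have [j hj] := exists_expr_le q01 (divr_gt0 (divr_gt0 e0 (ltr0Sn _ 1)) n0).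
have itv (x : R) l : 0 < x < 1 -> 0 <= x ^+ l <= 1.
  by move=> /andP[? ?]; rewrite exprn_ge0 ?exprn_ile1 ?ltW.
(* The summand T makes M - T equal to j, the exponent at which n q^(2j) is at most e / 2. *)
exists lam, q, n', (j + T)%N => /=; rewrite -/n -/T addnK leq_addl.
have qj : n%:R * q ^+ j ^+ 2 <= e / 2.
  apply: le_trans (ler_wpM2l (ltW n0) (sq _ (itv _ j q01))) _.
  by rewrite mulrC -ler_pdivlMr.
split=> //; split.
- have := sq _ (itv _ n' lam01); have := itv _ n' lam01 => _ h.
  have : (1 - lam) ^+ 2 + (1 - lam ^+ 2) = m / 2 by rewrite /lam; field.
  by move=> h2; lra.
- have qT := itv _ T q01.
  have s1 : (1 - q ^+ T) ^+ 2 <= 1 - q ^+ T.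
    by apply: sq; case/andP: qT => ? ?; apply/andP; split; lra.
  have s2 : 1 - q ^+ T <= T%:R * (1 - q).
    by apply: expr_bernoulli1; case/andP: q01 => ? ?; rewrite !ltW.
  have s3 : T%:R * (1 - q) <= m / 8.
    by rewrite -etak /q (_ : 1 - (1 - eta) = eta) ?subKr// mulrC ler_pM2l.
  have s4 : (1 - q ^+ 2) * k <= m / 4.
    have -> : (1 - q ^+ 2) * k = 2 * (eta * k) - eta * (eta * k) by rewrite /q; ring.
    have : 0 <= eta * (eta * k) by rewrite etak mulr_ge0 ?divr_ge0 ?ltW.
    by rewrite etak => ?; lra.
  by rewrite -/k; lra.
- have lamn : lam ^+ n ^+ 2 <= e / 2.
    apply: le_trans (sq _ (itv _ n lam01)) _; apply: le_trans hn'.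
    by rewrite /n exprS ler_piMl ?exprn_ge0//; case/andP: lam01 => ? ?; rewrite ltW.
  have qM : n%:R * q ^+ (j + T) ^+ 2 <= e / 2.
    apply: le_trans qj; rewrite ler_pM2l//.
    have /andP[a0 a1] := itv _ (j + T)%N q01; have /andP[b0 b1] := itv _ j q01.
    rewrite lerXn2r ?nnegrE// exprD ler_piMr//.
    by case/andP: (itv _ T q01).
  by lra.
Qed.

End Constants.

Local Close Scope complex_scope.
Local Close Scope ring_scope.

Theorem theoremA1 (R : realType) (c d : nat) (hc : 0 < c) (hd : 0 < d) :
  nica_amenable R (BS_pos c d).
Proof.
move=> A i [i_nica i_gen _] Phi Phi_exp r.
apply: (faithful_of_approx_invariant (@BS_pos1 c d) (@BS_posM c d) i_nica
  _ i_gen Phi_exp (X := [set BS_a c d; BS_b c d]%classic)).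
- by move=> x g u; exact: hom_star_mull.
- move=> Q Q1 QX QM; apply: BS_pos_ind => //; apply: QX; [by left|by right].
move=> e e0.
have [lam [q [n' [M [[/andP[l0 l1] /andP[q0 q1] TM] [h1 h2 h3]]]]]] :=
  exists_parameters hc e0.
exists (support c d n'.+1 M), (kap i lam q n'.+1 M).
exact: (approx_invariant_grid hc hd i_nica l0 l1 q0 q1 erefl TM h1 h2 h3).
Qed.
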